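(* Let $\mathcal U\subset\mathbb R^n$ be open, let $\pi$ be a Poisson structure on $\mathcal U$ which admits an (explicitly known) bi-realisation $\mathcal W\rightrightarrows\mathcal U$ with source $\alpha$ and target $\beta$, let $H\in C^\infty(\mathcal U)$ and let $k\ge 1$ be an integer. Define $S_1,\dots,S_k\in C^\infty(\mathcal U)$ recursively by $S_1=H$ and $$S_{i+1}(m)=\left.\frac{d^i}{dt^i}\right|_{t=0}H\Big(\alpha\big(d_mS^{(i)}_t\big)\Big),\qquad S^{(i)}_t=\sum_{j=1}^{i}\frac{t^j}{j!}S_j ,$$ where $d_mS^{(i)}_t$ denotes the point $(m,\nabla S^{(i)}_t(m))\in\mathcal U\times\mathbb R^n$. Fix a small timestep $h>0$ and, starting from an initial value $x_0\in\mathcal U$, define a sequence $(x_n)$ as follows: assuming that for every $n$ the equation $$\alpha\Big(y_n,\sum_{i=1}^k\frac{h^i}{i!}\nabla S_i(y_n)\Big)=x_n$$ admits a unique solution $y_n$ (otherwise the timestep is too large), set $$x_{n+1}:=\beta\Big(y_n,\sum_{i=1}^k\frac{h^i}{i!}\nabla S_i(y_n)\Big).$$ Then this numerical scheme, i.e. the family of maps $\phi_h:x_n\mapsto x_{n+1}$, is a Poisson Hamiltonian integrator of order $k$ for the Hamiltonian differential equation $\dot x(t)=\pi(x(t))\,\nabla_{x(t)}H$.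
   Context: A Poisson structure on an open set $\mathcal U\subset\mathbb R^n$ is a smooth map $x\mapsto\pi(x)=(\pi_{ij}(x))$ into $n\times n$ matrices such that $\{f,g\}_\pi(x)={}^t\nabla_x f\,\pi(x)\,\nabla_x g$ is skew-symmetric and satisfies the Jacobi identity. The Hamiltonian differential equation of $H$ is $\dot x=\pi(x)\nabla_xH$; for a time-dependent Hamiltonian $(H_t)_t$ it is $\dot x(t)=\pi(x(t))\nabla_{x(t)}H_t$. Bi-realisation. Let $\mathcal W$ be an open subset of $\mathcal U\times\mathbb R^n$ containing $\mathcal U\times\{0\}$, with coordinates $(x_1,\dots,x_n,p_1,\dots,p_n)$ and symplectic form $\omega=\sum_i dp_i\wedge dx_i$, whose Poisson bracket satisfies $\{x_i,x_j\}_\omega=\{p_i,p_j\}_\omega=0$, $\{x_i,p_j\}_\omega=\delta_{ij}$. A bi-realisation $\mathcal W\rightrightarrows\mathcal U$ of $(\mathcal U,\pi)$ is a pair of surjective submersions $\alpha,\beta:\mathcal W\to\mathcal U$ (source and target) with $\alpha(x,0)=\beta(x,0)=x$ for all $x\in\mathcal U$, such that $\alpha$ is a Poisson map, $\beta$ is an anti-Poisson map, and the fibres of $\alpha$ and $\beta$ are symplectically orthogonal to each other; that is, for all $F,G\in C^\infty(\mathcal U)$: $\alpha^*\{F,G\}_\pi=\{\alpha^*F,\alpha^*G\}_\omega$, $\beta^*\{F,G\}_\pi=-\{\beta^*F,\beta^*G\}_\omega$, $\{\alpha^*F,\beta^*G\}_\omega=0$. Integrators. An integrator of order $k$ for $\dot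 x=F(x)$ is a family of diffeomorphisms $\phi_h:\mathcal U\to\mathcal U$, depending smoothly on a real parameter $h$, such that $\|\phi_h(x)-x(h)\|=o(h^k)$, where $x(\cdot)$ is the exact solution with $x(0)=x$. (It is only required that for all $h$ small enough there be an open subset $\mathcal U_h\subset\mathcal U$ on which $\phi_h$ is a diffeomorphism onto its image.) An integrator of order $k$ for $\dot x=\pi(x)\nabla_xH$ is a Poisson integrator if $\phi_h$ is a Poisson diffeomorphism (it preserves $\{\cdot,\cdot\}_\pi$), from $\mathcal U_h$ to $\phi_h(\mathcal U_h)$, for all $h$ for which it is defined. A Poisson integrator of order $k$ for this equation is a Poisson Hamiltonian integrator of order $k$ if there exists a time-dependent Hamiltonian function $(H_t)_t$, depending smoothly on $t$, that coincides with $H$ up to order $k$, i.e. $H_t-H=o(t^k)$ as $t\to0$, and whose integral curve starting at $x$ coincides with the curve $h\mapsto\phi_h(x)$.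
   Formalization: ''H_t coincides with H up to order k'' is taken as H_t − H = O(t^k) as t→0+ instead of o(t^k), which fails for symplectic Euler with k = 1 (there H_t − H = −t x_1 x_2 + O(t^2)). *)

(* Defs.v *)
From HB Require Import structures.
From mathcomp Require Import all_boot all_order all_algebra.
From mathcomp Require Import all_classical all_reals all_analysis.

Set Implicit Arguments.
Unset Strict Implicit.
Unset Printing Implicit Defensive.

Import Order.TTheory GRing.Theory Num.Theory.
Import numFieldNormedType.Exports.

Local Open Scope classical_set_scope.
Local Open Scope ring_scope.

(* [f] is of class C^m on [A]; meaningful for open [A] and finite-dimensional
   domain, where C^(m+1) means differentiable with all directional derivatives
   of class C^m. *)
Fixpoint Ck {R : realType} {V V' : normedModType R} (m : nat) (A : set V)
    (f : V -> V') : Prop :=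
  if m is m'.+1 then
    (forall x, A x -> differentiable f x)
    /\ (forall v, Ck m' A (fun x => 'D_v f x))
  else forall x, A x -> {for x, continuous f}.

Definition smooth_on {R : realType} {V V' : normedModType R} (A : set V)
    (f : V -> V') : Prop :=
  forall m, Ck m A f.

Definition diffeo_onto_image {R : realType} {V V' : normedModType R}
    (A : set V) (f : V -> V') : Prop :=
  [/\ open A, smooth_on A f, open (f @` A)
    & exists g : V' -> V,
        smooth_on (f @` A) g /\ forall x, A x -> g (f x) = x].

Definition submersion_on {R : realType} {V V' : normedModType R}
    (A : set V) (f : V -> V') : Prop :=
  smooth_on A f /\ forall x, A x -> forall v, exists u, 'd f x u = v.

Section Poisson.
Context {R : realType} {n : nat}.
Local Notation Rn := 'cV[R]_n.

Definition basis_vec (i : 'I_n) : Rn := delta_mx i 0.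

Definition grad (f : Rn -> R) (x : Rn) : Rn :=
  \col_i 'D_(basis_vec i) f x.

Definition pbracket (pi : Rn -> 'M[R]_n) (f g : Rn -> R) (x : Rn) : R :=
  ((grad f x)^T *m pi x *m grad g x) 0 0.

Record poisson_structure (U : set Rn) (pi : Rn -> 'M[R]_n) : Prop := {
  poisson_smooth : smooth_on U pi;
  poisson_skew : forall f g, smooth_on U f -> smooth_on U g ->
    forall x, U x -> pbracket pi f g x = - pbracket pi g f x;
  poisson_jacobi : forall f g h,
    smooth_on U f -> smooth_on U g -> smooth_on U h ->
    forall x, U x ->
      pbracket pi f (pbracket pi g h) x + pbracket pi g (pbracket pi h f) x
      + pbracket pi h (pbracket pi f g) x = 0 }.

Definition hamiltonian_field (pi : Rn -> 'M[R]_n) (H : Rn -> R) (x : Rn) : Rn :=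
  pi x *m grad H x.

(* The bracket of [\sum_i dp_i /\ dx_i], with the sign {x_i, p_j} = delta_ij. *)
Definition obracket (F G : Rn * Rn -> R) (w : Rn * Rn) : R :=
  \sum_(i < n)
    ('D_((basis_vec i, 0) : Rn * Rn) F w * 'D_((0, basis_vec i) : Rn * Rn) G w
     - 'D_((0, basis_vec i) : Rn * Rn) F w
       * 'D_((basis_vec i, 0) : Rn * Rn) G w).

Record bi_realisation (U : set Rn) (pi : Rn -> 'M[R]_n) (W : set (Rn * Rn))
    (alpha beta : Rn * Rn -> Rn) : Prop := {
  breal_open : open W;
  breal_sub : forall w, W w -> U w.1;
  breal_zero : forall x, U x -> W (x, 0);
  breal_alpha_onto : alpha @` W = U;
  breal_beta_onto : beta @` W = U;
  breal_alpha_subm : submersion_on W alpha;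
  breal_beta_subm : submersion_on W beta;
  breal_alpha_unit : forall x, U x -> alpha (x, 0) = x;
  breal_beta_unit : forall x, U x -> beta (x, 0) = x;
  breal_alpha_poisson : forall F G, smooth_on U F -> smooth_on U G ->
    forall w, W w ->
      pbracket pi F G (alpha w) = obracket (F \o alpha) (G \o alpha) w;
  breal_beta_antipoisson : forall F G, smooth_on U F -> smooth_on U G ->
    forall w, W w ->
      pbracket pi F G (beta w) = - obracket (F \o beta) (G \o beta) w;
  breal_orthogonal : forall F G, smooth_on U F -> smooth_on U G ->
    forall w, W w -> obracket (F \o alpha) (G \o beta) w = 0 }.

Definition solution_from (U : set Rn) (F : Rn -> Rn) (x : Rn) (c : R -> Rn)
    : Prop :=
  c 0 = x
  /\ (\forall t \near (0 : R), U (c t) /\ is_derive t (1 : R) c (F (c t))).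

Definition slice (D : set (R * Rn)) (h : R) : set Rn := [set x | D (h, x)].

(* The timestep is nonnegative, so only the part [0 <= h] of [D] matters; there
   [U_h] is [slice D h].  Smoothness in [(h, x)] up to [h = 0] means that the
   family extends smoothly to the open set [D].  As [D] is a neighbourhood of
   [{0} x U], every point of [U] lies in [U_h] for all small [h]. *)
Record integrator (k : nat) (U : set Rn) (F : Rn -> Rn) (phi : R -> Rn -> Rn)
    (D : set (R * Rn)) : Prop := {
  integ_open : open D;
  integ_zero : forall x, U x -> D (0, x);
  integ_sub : forall h x, D (h, x) -> U x;
  integ_star : forall (h : R) x (s : R), D (h, x) -> 0 <= s <= h -> D (s, x);
  integ_smooth : exists g : R * Rn -> Rn,
    smooth_on D g /\ forall h x, D (h, x) -> 0 <= h -> phi h x = g (h, x);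
  integ_into : forall (h : R) x, D (h, x) -> 0 <= h -> U (phi h x);
  integ_diffeo : forall h : R, 0 <= h -> diffeo_onto_image (slice D h) (phi h);
  integ_order : forall x c, U x -> solution_from U F x c ->
    (fun h : R => phi h x - c h) =o_ (0^'+) (fun h : R => h ^+ k) }.

Definition poisson_map (pi : Rn -> 'M[R]_n) (A : set Rn) (f : Rn -> Rn)
    : Prop :=
  forall F G, smooth_on (f @` A) F -> smooth_on (f @` A) G ->
    forall x, A x -> pbracket pi (F \o f) (G \o f) x = pbracket pi F G (f x).

Definition poisson_integrator (k : nat) (U : set Rn) (pi : Rn -> 'M[R]_n)
    (H : Rn -> R) (phi : R -> Rn -> Rn) (D : set (R * Rn)) : Prop :=
  integrator k U (hamiltonian_field pi H) phi D
  /\ forall h : R, 0 <= h -> poisson_map pi (slice D h) (phi h).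

(* [Ht t] is a function on the open slice of [E] at [t], which contains
   [phi t (U_t)].
   "[H_t] coincides with [H] up to order [k]" is [O(t^k)], i.e. the Taylor
   coefficients in [t] of degrees [0, .., k - 1] agree, which makes the flows
   agree up to [o(t^k)].  Requiring [o(t^k)] here would force [phi] to be of
   order [k + 1], which fails e.g. for [k = 1], [n = 2], [pi] the standard
   symplectic matrix, [alpha (x, p) = (x_1, x_2 + p_1)],
   [beta (x, p) = (x_1 + p_2, x_2)] and [H = (x_1^2 + x_2^2) / 2]: the scheme
   is the symplectic Euler method, with
   [H_t = x_1^2 / 2 - t x_1 x_2 + (1 + t^2) x_2^2 / 2] up to a constant. *)
Definition generated_by (k : nat) (U : set Rn) (pi : Rn -> 'M[R]_n)
    (H : Rn -> R) (phi : R -> Rn -> Rn) (D : set (R * Rn))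
    (Ht : R -> Rn -> R) : Prop :=
  exists E : set (R * Rn),
  [/\ open E /\ (forall t z, E (t, z) -> U z),
      forall (t : R) x, D (t, x) -> 0 <= t -> E (t, phi t x),
      smooth_on E (fun q : R * Rn => Ht q.1 q.2),
      forall x, U x ->
        (fun t : R => Ht t x - H x) =O_ (0^'+) (fun t : R => t ^+ k)
    & forall x, U x -> phi 0 x = x
        /\ forall t : R, 0 < t -> D (t, x) ->
             is_derive t (1 : R) (fun s => phi s x)
               (hamiltonian_field pi (Ht t) (phi t x))].

Definition poisson_hamiltonian_integrator (k : nat) (U : set Rn)
    (pi : Rn -> 'M[R]_n) (H : Rn -> R) (phi : R -> Rn -> Rn) : Prop :=
  exists D : set (R * Rn),
    poisson_integrator k U pi H phi D
    /\ exists Ht, generated_by k U pi H phi D Ht.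

Definition dgraph (f : Rn -> R) (m : Rn) : Rn * Rn := (m, grad f m).

Definition partial_S (S : nat -> Rn -> R) (i : nat) (t : R) (m : Rn) : R :=
  \sum_(1 <= j < i.+1) t ^+ j / j`!%:R * S j m.

(* Only the values of [S_1, .., S_k] on [U] are constrained. *)
Definition generating_sequence (k : nat) (U : set Rn) (alpha : Rn * Rn -> Rn)
    (H : Rn -> R) (S : nat -> Rn -> R) : Prop :=
  (forall m, U m -> S 1%N m = H m)
  /\ forall i, (1 <= i < k)%N -> forall m, U m ->
       S i.+1 m =
       derive1n i (fun t : R => H (alpha (dgraph (partial_S S i t) m))) 0.

Definition scheme_point (k : nat) (S : nat -> Rn -> R) (h : R) (y : Rn)
    : Rn * Rn :=
  (y, \sum_(1 <= i < k.+1) (h ^+ i / i`!%:R) *: grad (S i) y).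

(* [W] is the domain of [alpha]; membership entails [y \in U]. *)
Definition scheme_equation (k : nat) (W : set (Rn * Rn))
    (alpha : Rn * Rn -> Rn) (S : nat -> Rn -> R) (h : R) (x y : Rn) : Prop :=
  W (scheme_point k S h y) /\ alpha (scheme_point k S h y) = x.

Definition scheme_solvable (k : nat) (U : set Rn) (W : set (Rn * Rn))
    (alpha : Rn * Rn -> Rn) (S : nat -> Rn -> R) : Prop :=
  forall x0, U x0 -> \forall q \near ((0 : R), x0),
    0 < q.1 -> exists! y, scheme_equation k W alpha S q.1 q.2 y.

(* For [h = 0] the only solution is [y = x], so [phi 0] is the identity of
   [U]. *)
Definition scheme_map (k : nat) (U : set Rn) (W : set (Rn * Rn))
    (alpha beta : Rn * Rn -> Rn) (S : nat -> Rn -> R) (phi : R -> Rn -> Rn)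
    : Prop :=
  forall (h : R) x y, 0 <= h -> U x ->
    unique (scheme_equation k W alpha S h x) y ->
    phi h x = beta (scheme_point k S h y).

End Poisson.

(* Main.v *)
Require Import Defs.
From HB Require Import structures.
From mathcomp Require Import all_boot all_order all_algebra.
From mathcomp Require Import all_classical all_reals all_analysis.
From mathcomp Require Import ring lra.

(** Let sigma_t be the sum of the [t^i / i! * S_i] for [1 <= i <= k], and let
    L_t be the graph of its differential, a submanifold of [W].  As L_0 is the
    zero section, on which [alpha] and [beta] are the identity, both restrict
    to local diffeomorphisms of L_t for small [t], and the scheme is
    phi_t = beta o (alpha | L_t)^-1.  Everything follows from L_t being
    Lagrangian, that is, from the symmetry of the Hessian of sigma_t.

    Poisson maps.  Let K be the differential of phi_t.  The rows of
    [D beta - K * D alpha] annihilate the tangent space of L_t, hence commute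
    with one another for the symplectic bracket.  Expanding these brackets,
    the mixed terms vanish by orthogonality of the fibres and the others say
    that [K * pi * K^T = pi] ([lagrangian_poisson], [fwd_poisson]).

    Hamiltonian.  Define H_t by H_t o beta = d sigma_t / dt on L_t.  The same
    linear algebra shows that [t |-> phi_t x] is the integral curve of H_t
    ([lagrangian_flow], [fwd_time]).  The situation is symmetric: exchanging
    [alpha] with [beta] and [pi] with [- pi], the inverse psi_t of phi_t
    follows the field of - H'_t, where H'_t o alpha = d sigma_t / dt on L_t
    ([bwd_time]).

    Order.  The recursion for the S_i is the Taylor expansion of the
    Hamilton-Jacobi equation: d sigma_t / dt = H o alpha + O(t^k) on L_t
    ([hj_defect_near]), which says that H'_t = H + O(t^k).  Therefore the
    derivative of H along psi_t, the bracket of H with - H'_t, is O(t^k), so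
    that H_t = H'_t o psi_t = H o psi_t + O(t^k) = H + O(t^k)
    ([target_defect_vanishes]).  Gradients of such differences are O(t^k) as
    well, because the derivatives in time and in space commute
    ([flat_derive_near]), and Gronwall's argument gives the order of the scheme
    ([fwd_order]).

    This rests on some calculus in finite dimension: closure properties of
    smooth functions ([Ck_comp], [smooth_invmx]), symmetry of second
    derivatives ([derive_commute]), Taylor's formula with a remainder uniform
    in a parameter ([taylor_time]), and the smooth inversion, on a
    neighbourhood of [{0} x U], of a family of maps that starts at the identity
    ([family_inverse_smooth]).  Gluing the local inverses needs no compactness:
    boxes are chosen so that injectivity passes to their union
    ([good_boxes_inj]). *)

Set Implicit Arguments.
Unset Strict Implicit.
Unset Printing Implicit Defensive.

Import Order.TTheory GRing.Theory Num.Theory.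
Import numFieldNormedType.Exports.

Local Open Scope classical_set_scope.
Local Open Scope ring_scope.

(** * Differentials and directional derivatives *)

Section Differentials.
Context {R : realType}.
Implicit Types V W : normedModType R.

Lemma near_open V (A : set V) x (P : V -> Prop) :
  open A -> A x -> (forall y, A y -> P y) -> \forall y \near x, P y.
Proof.
by move=> oA Ax AP; apply: (filterS AP); exact: open_nbhs_nbhs.
Qed.

(** Differentiability in epsilon form, which is how the differential of an
    inverse map is found. *)
Lemma differentiable_of_eps V W (f : V -> W) (x : V) (L : {linear V -> W}) :
  continuous L ->
  (forall e, 0 < e -> \forall h \near 0, `|f (h + x) - f x - L h| <= e * `|h|) ->
  differentiable f x /\ 'd f x = L :> (V -> W).
Proof.
move=> cL fL.
have e0 : f \o shift x = cst (f x) + L +o_ (0 : V) id.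
  apply/eqaddoP => e e0; near=> h.
  rewrite /= opprD addrA; near: h; exact: fL.
have dL := diff_unique cL e0.
split=> //; apply/diff_locallyP; rewrite dL; split => //.
Unshelve. all: by end_near. Qed.

Lemma diff_eps V W (f : V -> W) (x : V) : differentiable f x ->
  forall e, 0 < e ->
    \forall h \near 0, `|f (h + x) - f x - 'd f x h| <= e * `|h|.
Proof.
move=> /diff_locally /eqaddoP fx e e0; have := fx e e0.
by apply: filterS => h /=; rewrite opprD addrA.
Qed.

Lemma near_eq_differentiable V W (f g : V -> W) (x : V) :
  (\forall y \near x, f y = g y) -> differentiable f x -> differentiable g x.
Proof.
move=> fg df.
apply: (proj1 (@differentiable_of_eps _ _ g x ('d f x) (diff_continuous df) _)).
move=> e e0.
have fg0 : \forall h \near 0, f (h + x) = g (h + x).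
  by move: fg; rewrite (near_shift 0) /= subr0.
move: fg0 (diff_eps df e0); apply: filterS2 => h -> .
by rewrite (nbhs_singleton fg).
Qed.

End Differentials.

Lemma scale_is_bilinear (R : realType) (W : normedModType R) :
  bilinear_for
    (GRing.Scale.Law.clone _ _ *:%R _) (GRing.Scale.Law.clone _ _ *:%R _)
    (@GRing.scale R W).
Proof.
split=> [u'|u] a x y /=.
- by rewrite scalerDl scalerA.
- by rewrite scalerDr !scalerA mulrC.
Qed.
HB.instance Definition _ (R : realType) (W : normedModType R) :=
  bilinear_isBilinear.Build R R W W _ _ (@GRing.scale R W)
  (@scale_is_bilinear R W).

Section DirectionalDerivatives.
Context {R : realType}.
Implicit Types V W : normedModType R.

Lemma differentiable_scale V W (a : V -> R) (b : V -> W) x :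
  differentiable a x -> differentiable b x ->
  differentiable (fun y => a y *: b y) x.
Proof.
move=> da db.
apply: (@differentiable_comp _ _ _ _ (fun y => (a y, b y))
  (fun p : R * W => p.1 *: p.2)); first exact: differentiable_pair.
by apply: differentiable_bilin => p; exact: scale_continuous.
Qed.

Lemma derive_scale V W (a : V -> R) (b : V -> W) x v :
  differentiable a x -> differentiable b x ->
  'D_v (fun y => a y *: b y) x = a x *: 'D_v b x + 'D_v a x *: b x.
Proof.
move=> da db; rewrite !deriveE //; last exact: differentiable_scale.
rewrite (@diff_comp _ _ _ _ (fun y => (a y, b y)) (fun p : R * W => p.1 *: p.2)).
- rewrite /= diff_bilin /=; last by move=> p; exact: scale_continuous.
  by rewrite diff_pair.
- exact: differentiable_pair.
- by apply: differentiable_bilin => p; exact: scale_continuous.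
Qed.

Lemma derive_pair V W W' (f : V -> W) (g : V -> W') x v :
  differentiable f x -> differentiable g x ->
  'D_v (fun y => (f y, g y)) x = ('D_v f x, 'D_v g x).
Proof.
move=> df dg; rewrite !deriveE // ?diff_pair //.
exact: differentiable_pair.
Qed.

Lemma derive_linear_comp V W W' (L : {linear W -> W'}) (f : V -> W) x v :
  continuous L -> differentiable f x -> 'D_v (L \o f) x = L ('D_v f x).
Proof.
move=> cL df; have dL := linear_differentiable (f x) cL.
have dLf : differentiable (L \o f) x by exact: differentiable_comp.
by rewrite (deriveE _ dLf) (deriveE _ df) (diff_comp df dL) /= (diff_lin _ cL).
Qed.

Lemma derive_comp V W W' (f : V -> W) (g : W -> W') x v :
  differentiable f x -> differentiable g (f x) ->
  'D_v (g \o f) x = 'D_('D_v f x) g (f x).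
Proof.
move=> df dg.
have dgf : differentiable (g \o f) x by exact: differentiable_comp.
by rewrite (deriveE _ dgf) (deriveE _ df) (deriveE _ dg) (diff_comp df dg).
Qed.

Lemma derive_lin V W (L : {linear V -> W}) x v :
  continuous L -> 'D_v L x = L v.
Proof.
move=> cL; rewrite deriveE; last exact: linear_differentiable.
by rewrite diff_lin.
Qed.

Lemma deriveD_fun V W (f g : V -> W) x v :
  differentiable f x -> differentiable g x ->
  'D_v (fun y => f y + g y) x = 'D_v f x + 'D_v g x.
Proof. by move=> df dg; apply: deriveD; exact: diff_derivable. Qed.

Lemma derive_dirP V W (u v : V) (a : R) (f : V -> W) x : differentiable f x ->
  'D_(a *: u + v) f x = a *: 'D_u f x + 'D_v f x.
Proof. by move=> df; rewrite !deriveE // linearP. Qed.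

Lemma derive_dir_sum V W n (l : 'I_n -> R) (e : 'I_n -> V) (f : V -> W) x :
  differentiable f x ->
  'D_(\sum_i l i *: e i) f x = \sum_i l i *: 'D_(e i) f x.
Proof.
move=> df; rewrite deriveE // linear_sum; apply: eq_bigr => i _.
by rewrite linearZ deriveE.
Qed.

End DirectionalDerivatives.

(** * Closure properties of smooth functions *)

Section ClassCk.
Context {R : realType}.
Implicit Types V W : normedModType R.

Lemma Ck_weaken V W m (A : set V) (f : V -> W) : Ck m.+1 A f -> Ck m A f.
Proof.
elim: m f => [|m IH] f [df Df].
  by move=> x Ax; exact: differentiable_continuous (df x Ax).
by split=> // v; exact: IH (Df v).
Qed.

Lemma Ck_sub V W m (A B : set V) (f : V -> W) :
  A `<=` B -> Ck m B f -> Ck m A f.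
Proof.
move=> AB; elim: m f => [|m IH] f; first by move=> cf x /AB; exact: cf.
by move=> [df Df]; split=> [x /AB|v]; [exact: df|exact: IH (Df v)].
Qed.

Lemma eq_Ck V W m (A : set V) (f g : V -> W) : open A ->
  (forall x, A x -> f x = g x) -> Ck m A f -> Ck m A g.
Proof.
move=> oA; elim: m f g => [|m IH] f g fg /=.
  move=> cf x Ax; change (g @ x --> g x); rewrite -(fg _ Ax).
  apply: cvg_trans (cf x Ax); apply: near_eq_cvg.
  by apply: near_open oA Ax _ => y Ay; rewrite fg.
move=> [df Df]; split=> [x Ax|v].
  by apply: near_eq_differentiable (df x Ax); exact: near_open oA Ax fg.
apply: IH (Df v) => x Ax.
by apply: near_eq_derive; exact: near_open oA Ax fg.
Qed.

Lemma Ck_cst V W m (A : set V) (c : W) : Ck m A (fun=> c).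
Proof.
elim: m c => [|m IH] c; first by move=> x _; exact: cvg_cst.
split=> [x _|v]; first exact: differentiable_cst.
suff -> : (fun x => 'D_v (fun=> c) x) = (fun=> 0 : W) by exact: IH.
by apply/funext => x; rewrite derive_cst.
Qed.

Lemma CkD V W m (A : set V) (f g : V -> W) : open A ->
  Ck m A f -> Ck m A g -> Ck m A (fun x => f x + g x).
Proof.
move=> oA; elim: m f g => [|m IH] f g /=.
  by move=> cf cg x Ax; apply: continuousD; [exact: cf|exact: cg].
move=> [df Df] [dg Dg]; split=> [x Ax|v].
  by apply: differentiableD; [exact: df|exact: dg].
apply: (eq_Ck oA _ (IH _ _ (Df v) (Dg v))) => x Ax.
by rewrite deriveD_fun //; [exact: df|exact: dg].
Qed.

Lemma Ck_linear_comp V W W' m (A : set V) (L : {linear W -> W'}) (f : V -> W) :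
  open A -> continuous L -> Ck m A f -> Ck m A (L \o f).
Proof.
move=> oA cL; elim: m f => [|m IH] f /=.
  by move=> cf x Ax; apply: continuous_comp; [exact: cf|exact: cL].
move=> [df Df]; split=> [x Ax|v].
  by apply: differentiable_comp; [exact: df|exact: linear_differentiable].
apply: (eq_Ck oA _ (IH _ (Df v))) => x Ax.
by rewrite derive_linear_comp //; exact: df.
Qed.

Lemma Ck_id V m (A : set V) : Ck m A (@id V).
Proof.
case: m => [|m]; first by move=> x _; exact: cvg_id.
split=> [x _|v]; first by apply: (@linear_differentiable _ _ _ idfun) => y; exact: cvg_id.
suff -> : (fun x => 'D_v (@id V) x) = (fun=> v) by exact: Ck_cst.
by apply/funext => x; rewrite derive_id.
Qed.

Lemma Ck_linear V W m (A : set V) (L : {linear V -> W}) :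
  open A -> continuous L -> Ck m A L.
Proof.
by move=> oA cL; exact: (@Ck_linear_comp _ _ _ _ _ L _ oA cL (@Ck_id V m A)).
Qed.

Lemma CkZ V W m (A : set V) (a : V -> R) (b : V -> W) : open A ->
  Ck m A a -> Ck m A b -> Ck m A (fun x => a x *: b x).
Proof.
move=> oA; elim: m a b => [|m IH] a b /=.
  by move=> ca cb x Ax; apply: continuousZ; [exact: ca|exact: cb].
move=> Ca Cb; have Ca' := Ck_weaken (Ca : Ck m.+1 A a).
have Cb' := Ck_weaken (Cb : Ck m.+1 A b).
case: Ca Cb => [da Da] [db Db]; split=> [x Ax|v].
  by apply: differentiable_scale; [exact: da|exact: db].
apply: (eq_Ck oA _ (CkD oA (IH _ _ Ca' (Db v)) (IH _ _ (Da v) Cb'))) => x Ax.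
by rewrite derive_scale //; [exact: da|exact: db].
Qed.

Lemma Ck_pair V W W' m (A : set V) (f : V -> W) (g : V -> W') : open A ->
  Ck m A f -> Ck m A g -> Ck m A (fun x => (f x, g x)).
Proof.
move=> oA; elim: m f g => [|m IH] f g /=.
  by move=> cf cg x Ax; apply: cvg_pair; [exact: cf|exact: cg].
move=> [df Df] [dg Dg]; split=> [x Ax|v].
  by apply: differentiable_pair; [exact: df|exact: dg].
apply: (eq_Ck oA _ (IH _ _ (Df v) (Dg v))) => x Ax.
by rewrite derive_pair //; [exact: df|exact: dg].
Qed.

Lemma Ck_sum V W m (A : set V) I (r : seq I) (P : pred I) (f : I -> V -> W) :
  open A -> (forall i, P i -> Ck m A (f i)) ->
  Ck m A (fun x => \sum_(i <- r | P i) f i x).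
Proof.
move=> oA Cf; elim: r => [|i r IH].
  by apply: (eq_Ck oA _ (Ck_cst m A 0)) => x _; rewrite big_nil.
case Pi : (P i); last first.
  by apply: (eq_Ck oA _ IH) => x _; rewrite big_cons Pi.
by apply: (eq_Ck oA _ (CkD oA (Cf i Pi) IH)) => x _; rewrite big_cons Pi.
Qed.

Lemma CkM V m (A : set V) (a b : V -> R) : open A ->
  Ck m A a -> Ck m A b -> Ck m A (fun x => a x * b x).
Proof. exact: CkZ. Qed.

Lemma Ck_prod V m (A : set V) I (r : seq I) (f : I -> V -> R) :
  open A -> (forall i, Ck m A (f i)) ->
  Ck m A (fun x => \prod_(i <- r) f i x).
Proof.
move=> oA Cf; elim: r => [|i r IH].
  by apply: (eq_Ck oA _ (@Ck_cst V R m A 1)) => x _; rewrite big_nil.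
by apply: (eq_Ck oA _ (CkM oA (Cf i) IH)) => x _; rewrite big_cons.
Qed.

Lemma Ck_inv V m (A : set V) (a : V -> R) : open A ->
  (forall x, A x -> a x != 0) -> Ck m A a -> Ck m A (fun x => (a x)^-1).
Proof.
move=> oA a0; elim: m => [|m IH].
  by move=> ca x Ax; apply: continuousV; [exact: a0|exact: ca].
move=> Ca; have Ci := IH (Ck_weaken Ca); case: Ca => [da Da]; split=> [x Ax|v].
  by apply: differentiableV; [exact: da|exact: a0].
have C1 := CkM oA (CkM oA Ci Ci) (Da v).
apply: (eq_Ck oA _ (CkM oA (@Ck_cst V R m A (-1)) C1)) => x Ax.
rewrite (deriveV (a0 x Ax)); last exact/diff_derivable/da.
by rewrite -exprVn expr2 mulN1r -scaleNr.
Qed.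

End ClassCk.

Definition mx_entry {R : realType} {p q : nat} (i : 'I_p) (j : 'I_q)
  (M : 'M[R]_(p, q)) : R := M i j.

Lemma mx_entry_is_linear (R : realType) p q (i : 'I_p) (j : 'I_q) :
  linear (@mx_entry R p q i j).
Proof. by move=> a M N; rewrite /mx_entry !mxE. Qed.
HB.instance Definition _ (R : realType) p q (i : 'I_p) (j : 'I_q) :=
  GRing.isLinear.Build R 'M[R]_(p, q) R _ (@mx_entry R p q i j)
    (@mx_entry_is_linear R p q i j).

Lemma continuous_mx_entry (R : realType) p q (i : 'I_p) (j : 'I_q) :
  continuous (@mx_entry R p q i j).
Proof. exact: coord_continuous. Qed.

Section Frames.
Context {R : realType}.
Implicit Types V W : normedModType R.

(** Finite dimension, in the form that the chain rule for [Ck] requires: [Ck]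
    only speaks of derivatives in constant directions. *)
Definition has_frame V := exists (I : finType) (e : I -> V)
  (l : I -> {linear V -> R}), (forall i, continuous (l i)) /\
  forall v, v = \sum_i l i v *: e i.

Lemma frame_real : has_frame (R : normedModType R).
Proof.
exists unit, (fun=> 1), (fun=> idfun); split=> [_ x|v]; first exact: cvg_id.
by rewrite (big_pred1 tt) /= ?[_ *: _]mulr1 // => -[].
Qed.

Lemma frame_mx p q : has_frame ('M[R]_(p, q) : normedModType R).
Proof.
exists ('I_p * 'I_q)%type, (fun k => delta_mx k.1 k.2),
  (fun k => mx_entry k.1 k.2); split=> [k|v]; first exact: continuous_mx_entry.
rewrite [LHS]matrix_sum_delta pair_big /=.
by apply: eq_bigr => k _.
Qed.

Lemma frame_prod V W : has_frame V -> has_frame W ->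
  has_frame (V * W : normedModType R)%type.
Proof.
move=> [I [e [l [cl el]]]] [J [e' [l' [cl' el']]]].
pose g (k : I + J) : {linear (V * W)%type -> R} :=
  match k with inl i => l i \o fst | inr j => l' j \o snd end.
exists (I + J)%type, (fun k => match k with inl i => (e i, 0) | inr j => (0, e' j) end), g.
split=> [[i|j] x|[v w]] /=.
- by apply: (@continuous_comp _ _ _ fst (l i)); [exact: cvg_fst|exact: cl].
- by apply: (@continuous_comp _ _ _ snd (l' j)); [exact: cvg_snd|exact: cl'].
rewrite big_sumType /=.
have -> : \sum_i l i v *: (e i, 0 : W) = (v, 0).
  rewrite {2}(el v); elim/big_rec2: _ => // i x y _ ->.
  by apply: injective_projections => /=; rewrite ?scaler0 ?addr0.
have -> : \sum_i l' i w *: (0 : V, e' i) = (0, w).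
  rewrite {2}(el' w); elim/big_rec2: _ => // i x y _ ->.
  by apply: injective_projections => /=; rewrite ?scaler0 ?addr0.
by apply: injective_projections => /=; rewrite ?addr0 ?add0r.
Qed.

(** The derivative of [g \o f] in a direction is a derivative of [g] in a
    direction that varies from point to point; a frame expands it into
    derivatives in constant directions, to which the induction applies. *)
Lemma Ck_comp V W W' m (A : set V) (B : set W) (f : V -> W) (g : W -> W') :
  has_frame W -> open A -> (forall x, A x -> B (f x)) ->
  Ck m A f -> Ck m B g -> Ck m A (g \o f).
Proof.
move=> [I [e [l [cl el]]]] oA AB; elim: m g => [|m IH] g.
  by move=> cf cg x Ax; apply: continuous_comp; [exact: cf|exact/cg/AB].
move=> Cf [dg Dg]; have Cf' := Ck_weaken Cf; case: Cf => [df Df].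
split=> [x Ax|v].
  by apply: differentiable_comp; [exact: df|exact/dg/AB].
pose F x := \sum_i l i ('D_v f x) *: 'D_(e i) g (f x).
have CF : Ck m A F.
  apply: Ck_sum => // i _; apply: CkZ => //; last exact: IH Cf' (Dg _).
  exact: (@Ck_linear_comp _ _ _ _ _ _ (l i) ('D_v f) oA (cl i) (Df v)).
apply: (eq_Ck oA _ CF) => x Ax.
have dgx : differentiable g (f x) by exact/dg/AB.
rewrite (derive_comp _ (df x Ax) dgx) [in RHS](el ('D_v f x)) /F.
rewrite (deriveE _ dgx) linear_sum; apply: eq_bigr => i _.
by rewrite linearZ (deriveE _ dgx).
Qed.

End Frames.

Section Smooth.
Context {R : realType}.
Implicit Types V W : normedModType R.

Lemma smooth_diff V W (A : set V) (f : V -> W) x :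
  smooth_on A f -> A x -> differentiable f x.
Proof. by move=> sf; exact: (sf 1%N).1. Qed.

Lemma smooth_continuous V W (A : set V) (f : V -> W) x :
  smooth_on A f -> A x -> {for x, continuous f}.
Proof. by move=> sf; exact: sf 0%N x. Qed.

Lemma smooth_derive V W (A : set V) (f : V -> W) v :
  smooth_on A f -> smooth_on A ('D_v f).
Proof. by move=> sf m; exact: (sf m.+1).2. Qed.

Lemma smooth_sub V W (A B : set V) (f : V -> W) :
  A `<=` B -> smooth_on B f -> smooth_on A f.
Proof. by move=> AB sf m; exact: Ck_sub AB (sf m). Qed.

Lemma eq_smooth V W (A : set V) (f g : V -> W) : open A ->
  (forall x, A x -> f x = g x) -> smooth_on A f -> smooth_on A g.
Proof. by move=> oA fg sf m; exact: eq_Ck oA fg (sf m). Qed.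

Lemma smooth_cst V W (A : set V) (c : W) : smooth_on A (fun=> c).
Proof. by move=> m; exact: Ck_cst. Qed.

Lemma smooth_id V (A : set V) : smooth_on A (@id V).
Proof. by move=> m; exact: Ck_id. Qed.

Lemma smoothD V W (A : set V) (f g : V -> W) : open A ->
  smooth_on A f -> smooth_on A g -> smooth_on A (fun x => f x + g x).
Proof. by move=> oA sf sg m; exact: CkD. Qed.

Lemma smoothZ V W (A : set V) (a : V -> R) (b : V -> W) : open A ->
  smooth_on A a -> smooth_on A b -> smooth_on A (fun x => a x *: b x).
Proof. by move=> oA sf sg m; exact: CkZ. Qed.

Lemma smoothM V (A : set V) (a b : V -> R) : open A ->
  smooth_on A a -> smooth_on A b -> smooth_on A (fun x => a x * b x).
Proof. exact: smoothZ. Qed.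

Lemma smoothN V W (A : set V) (f : V -> W) : open A ->
  smooth_on A f -> smooth_on A (fun x => - f x).
Proof.
move=> oA sf; apply: (eq_smooth oA _ (smoothZ oA (@smooth_cst V R A (-1)) sf)).
by move=> x _; rewrite scaleN1r.
Qed.

Lemma smoothB V W (A : set V) (f g : V -> W) : open A ->
  smooth_on A f -> smooth_on A g -> smooth_on A (fun x => f x - g x).
Proof. by move=> oA sf sg; apply: smoothD => //; exact: smoothN. Qed.

Lemma smooth_sum V W (A : set V) I (r : seq I) (P : pred I) (f : I -> V -> W) :
  open A -> (forall i, P i -> smooth_on A (f i)) ->
  smooth_on A (fun x => \sum_(i <- r | P i) f i x).
Proof. by move=> oA sf m; apply: Ck_sum => // i Pi; exact: sf. Qed.

Lemma smooth_linear V W (A : set V) (L : {linear V -> W}) :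
  open A -> continuous L -> smooth_on A L.
Proof. by move=> oA cL m; exact: Ck_linear. Qed.

Lemma smooth_pair V W W' (A : set V) (f : V -> W) (g : V -> W') : open A ->
  smooth_on A f -> smooth_on A g -> smooth_on A (fun x => (f x, g x)).
Proof. by move=> oA sf sg m; exact: Ck_pair. Qed.

Lemma smooth_comp V W W' (A : set V) (B : set W) (f : V -> W) (g : W -> W') :
  has_frame W -> open A -> (forall x, A x -> B (f x)) ->
  smooth_on A f -> smooth_on B g -> smooth_on A (g \o f).
Proof. by move=> fW oA AB sf sg m; exact: Ck_comp fW oA AB (sf m) (sg m). Qed.

Lemma smooth_fst V W (A : set (V * W)) : open A -> smooth_on A (@fst V W).
Proof. by move=> oA; apply: smooth_linear => // x; exact: cvg_fst. Qed.

Lemma smooth_snd V W (A : set (V * W)) : open A -> smooth_on A (@snd V W).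
Proof. by move=> oA; apply: smooth_linear => // x; exact: cvg_snd. Qed.

Lemma smooth_entry V p q (A : set V) (f : V -> 'M[R]_(p, q)) i j : open A ->
  smooth_on A f -> smooth_on A (fun x => f x i j).
Proof.
move=> oA sf m.
apply: (@Ck_linear_comp _ _ _ _ _ _ (mx_entry i j) f) => //.
exact: continuous_mx_entry.
Qed.

Lemma smooth_mx V p q (A : set V) (f : V -> 'M[R]_(p, q)) : open A ->
  (forall i j, smooth_on A (fun x => f x i j)) -> smooth_on A f.
Proof.
move=> oA sf.
have sF : smooth_on A (fun x => \sum_i \sum_j f x i j *: delta_mx i j).
  apply: smooth_sum => // i _; apply: smooth_sum => // j _.
  by apply: smoothZ => //; exact: smooth_cst.
by apply: (eq_smooth oA _ sF) => x _; rewrite -matrix_sum_delta.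
Qed.

Lemma smooth_mul V p q r (A : set V) (f : V -> 'M[R]_(p, q))
    (g : V -> 'M[R]_(q, r)) : open A ->
  smooth_on A f -> smooth_on A g -> smooth_on A (fun x => f x *m g x).
Proof.
move=> oA sf sg; apply: smooth_mx => // i j.
have sF : smooth_on A (fun x => \sum_k f x i k * g x k j).
  by apply: smooth_sum => // k _; apply: smoothM => //; exact: smooth_entry.
by apply: (eq_smooth oA _ sF) => x _; rewrite mxE.
Qed.

Lemma smooth_det V p (A : set V) (f : V -> 'M[R]_p) : open A ->
  smooth_on A f -> smooth_on A (fun x => \det (f x)).
Proof.
move=> oA sf; rewrite /determinant; apply: smooth_sum => // s _.
apply: smoothM => //; first exact: smooth_cst.
by move=> m; apply: Ck_prod => // i; exact: smooth_entry.
Qed.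

(** By Cramer's rule. *)
Lemma smooth_invmx V p (A : set V) (f : V -> 'M[R]_p) : open A ->
  (forall x, A x -> f x \in unitmx) ->
  smooth_on A f -> smooth_on A (fun x => invmx (f x)).
Proof.
move=> oA fU sf.
have sd := smooth_det oA sf.
have sF : smooth_on A (fun x => (\det (f x))^-1 *: \adj (f x)).
  apply: smoothZ => //.
    by move=> m; apply: Ck_inv => // x /fU; rewrite unitmxE unitfE.
  apply: smooth_mx => // i j.
  pose G x : 'M[R]_p.-1 := row' j (col' i (f x)).
  have sG : smooth_on A G.
    apply: smooth_mx => // k l.
    have := smooth_entry (lift j k) (lift i l) oA sf.
    by apply: eq_smooth => // x _; rewrite !mxE.
  have sE := smoothM oA (@smooth_cst V R A ((-1) ^+ (j + i))) (smooth_det oA sG).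
  by apply: (eq_smooth oA _ sE) => x _; rewrite mxE.
by apply: (eq_smooth oA _ sF) => x /fU fx; rewrite /invmx fx.
Qed.

Lemma derive_entry V p q (f : V -> 'M[R]_(p, q)) i j x v : differentiable f x ->
  ('D_v f x) i j = 'D_v (fun y => f y i j) x.
Proof.
move=> df; rewrite derive_mx ?mxE //; exact: diff_derivable.
Qed.

End Smooth.

(** * Mean value estimates and symmetry of second derivatives *)

Section MeanValue.
Context {R : realType}.
Implicit Types V W : normedModType R.

Lemma is_derive_line V W (f : V -> W) x v (s : R) :
  differentiable f (s *: v + x) ->
  is_derive s 1 (fun a : R => f (a *: v + x)) ('D_v f (s *: v + x)).
Proof.
move=> df.
have E : (fun h : R => h^-1 *: (((fun a : R => f (a *: v + x)) \o shift s) (h *: (1 : R))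
    - f (s *: v + x))) =
    (fun h : R => h^-1 *: ((f \o shift (s *: v + x)) (h *: v) - f (s *: v + x))).
  by apply/funext => h /=; rewrite [h *: 1]mulr1 scalerDl addrA.
split; last by rewrite /derive E.
by rewrite /derivable E; exact: diff_derivable.
Qed.

Lemma differentiable_addr V (c y : V) : differentiable (fun z => z + c) y.
Proof.
apply: (@differentiableD _ _ _ id (cst c)); last exact: differentiable_cst.
by apply: (@linear_differentiable _ _ _ idfun) => z; exact: cvg_id.
Qed.

Lemma derive_addr V W (f : V -> W) (c y w : V) :
  'D_w (fun z => f (z + c)) y = 'D_w f (y + c).
Proof.
have E : (fun h : R => h^-1 *: (((fun z => f (z + c)) \o shift y) (h *: w) - f (y + c))) =
    (fun h : R => h^-1 *: ((f \o shift (y + c)) (h *: w) - f (y + c))).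
  by apply/funext => h /=; rewrite addrA.
by rewrite /derive E.
Qed.

Lemma is_derive_mean_bound (f df : R -> R) (B t : R) :
  (forall s : R, `|s| <= `|t| -> is_derive s (1 : R) f (df s) /\ `|df s| <= B) ->
  `|f t - f 0| <= B * `|t|.
Proof.
move=> H.
have cf s : `|s| <= `|t| -> {for s, continuous f}.
  move=> /H[dfs _]; apply: differentiable_continuous.
  by apply/derivable1_diffP.
have cw (a b : R) : (forall s, s \in `[a, b] -> `|s| <= `|t|) ->
    {within `[a, b], continuous f}.
  move=> ab; apply: continuous_in_subspaceT => s /set_mem sab.
  by apply: cf; exact: ab.
have [t0|t0] := leP 0 t.
  have st s : s \in `[0, t] -> `|s| <= `|t|.
    by rewrite in_itv /= => /andP[s0 st]; rewrite !ger0_norm.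
  have [||c ct ->] := @MVT_segment R f df 0 t t0.
  - move=> s st'; apply: (H s _).1; apply: st.
    by move: st'; rewrite !in_itv /= => /andP[/ltW -> /ltW ->].
  - exact: cw.
  rewrite subr0 normrM; apply: ler_wpM2r => //.
  by apply: (H c _).2; exact: st.
have st s : s \in `[t, 0] -> `|s| <= `|t|.
  rewrite in_itv /= => /andP[ts s0]; rewrite !ler0_norm ?lerN2 //.
  exact: ltW.
have [||c ct E] := @MVT_segment R f df t 0 (ltW t0).
- move=> s st'; apply: (H s _).1; apply: st.
  by move: st'; rewrite !in_itv /= => /andP[/ltW -> /ltW ->].
- exact: cw.
rewrite distrC E sub0r normrM normrN; apply: ler_wpM2r => //.
by apply: (H c _).2; exact: st.
Qed.

Lemma MVT_line V (f : V -> R) x v :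
  (forall s : R, 0 <= s <= 1 -> differentiable f (s *: v + x)) ->
  exists2 s, 0 <= s <= 1 & f (v + x) - f x = 'D_v f (s *: v + x).
Proof.
move=> df.
have [||s s01] := @MVT_segment R (fun a : R => f (a *: v + x))
  (fun s => 'D_v f (s *: v + x)) 0 1 ler01.
- move=> s; rewrite in_itv /= => /andP[s0 s1].
  by apply: is_derive_line; apply: df; rewrite !ltW.
- apply: continuous_in_subspaceT => s /set_mem /=; rewrite in_itv /= => s01.
  apply: differentiable_continuous; apply/derivable1_diffP.
  by have [] := is_derive_line (df s s01).
rewrite scale1r scale0r add0r subr0 mulr1 => ->.
by exists s => //; move: s01; rewrite in_itv.
Qed.

Lemma mx_norm_le p q (M : 'M[R]_(p, q)) (B : R) : 0 <= B ->
  (forall i j, `|M i j| <= B) -> `|M| <= B.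
Proof.
move=> B0 MB; rewrite [leLHS]/Num.Def.normr /= mx_normrE.
by apply: bigmax_le => // -[i j] _.
Qed.

Lemma mx_entry_le p q (M : 'M[R]_(p, q)) i j : `|M i j| <= `|M|.
Proof.
rewrite [leRHS]/Num.Def.normr /= mx_normrE.
by have := le_bigmax (0:R) (fun k : 'I_p * 'I_q => `|M k.1 k.2|) (i, j).
Qed.

(** In the sup norm, the mean value theorem can be applied to each entry
    separately, with different intermediate points. *)
Lemma mean_bound_line V p q (f : V -> 'M[R]_(p, q)) x v (B : R) :
  (forall s : R, 0 <= s <= 1 -> differentiable f (s *: v + x) /\
     `|'D_v f (s *: v + x)| <= B) ->
  `|f (v + x) - f x| <= B.
Proof.
move=> H; apply: mx_norm_le.
  have h0 : 0 <= (0 : R) <= 1 by rewrite lexx ler01.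
  by have [_] := H 0 h0; apply: le_trans.
move=> i j.
have dfij s : 0 <= s <= 1 -> differentiable (fun y => f y i j) (s *: v + x).
  move=> /H[df _]; apply: (@differentiable_comp _ _ _ _ f (fun M : 'M[R]_(p, q) => M i j : R)) => //.
  exact: differentiable_coord.
have [s s01] := MVT_line dfij; rewrite !mxE => ->.
have [df] := H s s01; apply: le_trans.
by rewrite -derive_entry //; exact: mx_entry_le.
Qed.

Lemma ball_segment V (x y z : V) (r s : R) : ball x r y -> ball x r z ->
  0 <= s <= 1 -> ball x r (s *: (z - y) + y).
Proof.
rewrite -!ball_normE /= => xy xz /andP[s0 s1].
have -> : x - (s *: (z - y) + y) = (1 - s) *: (x - y) + s *: (x - z).
  rewrite scalerBl scale1r -addrA (addrC (- _)) -scalerBr.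
  have -> : x - z - (x - y) = - (z - y) by rewrite !opprB addrC addrA subrK.
  by rewrite scalerN opprD addrA addrAC.
apply: (le_lt_trans (ler_normD _ _)); rewrite !normrZ (ger0_norm s0).
rewrite ger0_norm ?subr_ge0 //.
have [->|s0'] := eqVneq s 0; first by rewrite subr0 mul1r mul0r addr0.
have sp : 0 < s by rewrite lt_neqAle eq_sym s0'.
have := ler_wpM2l (_ : 0 <= 1 - s) (ltW xy); rewrite subr_ge0 s1 => /(_ isT).
have := xz; rewrite -(ltr_pM2l sp).
lra.
Qed.

(** The estimate is uniform in the direction since the finitely many
    directions of a frame control the others.  A map [J] other than the
    identity gives partial differentials. *)
Lemma derive_dir_near V1 V W (J : {linear V1 -> V}) (A : set V) (f : V -> W) x :
  has_frame V1 -> open A -> A x -> Ck 1 A f -> forall e, 0 < e ->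
  \forall y \near x, A y /\ forall v, `|'D_(J v) f y - 'D_(J v) f x| <= e * `|v|.
Proof.
move=> [I [b [l [cl bl]]]] oA Ax [df Df] e e0.
have kl i : {k | k > 0 & forall v, `|l i v| <= k * `|v|}.
  by apply: cid2; exact: linear_lipschitz (cl i).
pose k i := s2val (kl i).
have k0 i : 0 < k i by exact: (s2valP (kl i)).
have kP i v : `|l i v| <= k i * `|v| by exact: (s2valP' (kl i)).
pose K := 1 + \sum_i k i.
have K0 : 0 < K by rewrite ltr_pwDl // sumr_ge0 // => i _; exact: ltW.
have e1 : 0 < e / K by rewrite divr_gt0.
near=> y.
have Ay : A y by near: y; exact: open_nbhs_nbhs.
split=> // v.
have E z : A z -> 'D_(J v) f z = \sum_i l i v *: 'D_(J (b i)) f z.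
  move=> Az; rewrite (deriveE _ (df z Az)) {1}(bl v) !linear_sum.
  by apply: eq_bigr => i _; rewrite !linearZ /= (deriveE _ (df z Az)).
rewrite !E // -sumrB.
apply: (@le_trans _ _ (\sum_i k i * `|v| * (e / K))).
  apply: (le_trans (ler_norm_sum _ _ _)); apply: ler_sum => i _.
  rewrite -scalerBr normrZ; apply: ler_pM => //.
  move: i; near: y; apply: filter_forall => i.
  have := Df (J (b i)) x Ax.
  move/(@cvgr_dist_le _ _ _ (nbhs x) _)=> /(_ _ e1).
  by apply: filterS => y; rewrite distrC.
rewrite -!mulr_suml mulrAC; apply: ler_wpM2r => //.
rewrite mulrCA -[leRHS]mulr1; apply: ler_wpM2l; first exact: ltW.
by rewrite ler_pdivrMr // mul1r /K lerDr.
Unshelve. all: by end_near. Qed.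

Lemma derive_bound_near V W (A : set V) (f : V -> W) x :
  has_frame V -> open A -> A x -> Ck 1 A f -> exists2 L, 0 < L &
  \forall y \near x, A y /\ forall v, `|'D_v f y| <= L * `|v|.
Proof.
move=> fV oA Ax Cf.
have dfx := Cf.1 x Ax.
have [k k0 kP] := linear_lipschitz (diff_continuous dfx).
exists (k + 1); first by rewrite addr_gt0.
have := @derive_dir_near V V W idfun A f x fV oA Ax Cf 1 ltr01.
apply: filterS => y [Ay Hy]; split => // v.
have := Hy v => /=; have := kP v; rewrite -(deriveE v dfx) => h1 h2.
have := ler_normD ('D_v f y - 'D_v f x) ('D_v f x); rewrite subrK.
lra.
Qed.

Lemma lipschitz_near V p q (A : set V) (f : V -> 'M[R]_(p, q)) x :
  has_frame V -> open A -> A x -> Ck 1 A f ->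
  exists2 L, 0 < L & exists2 d, 0 < d & forall y z, ball x d y -> ball x d z ->
    `|f y - f z| <= L * `|y - z|.
Proof.
move=> fV oA Ax Cf; have [L L0] := derive_bound_near fV oA Ax Cf.
move=> /nbhs_ballP[d d0 dL]; exists L => //; exists d => // y z xy xz.
have := @mean_bound_line V p q f z (y - z) (L * `|y - z|).
rewrite subrK; apply => s s01.
have [As Ls] := dL _ (ball_segment xz xy s01).
by split; [exact: Cf.1|exact: Ls].
Qed.

(** The second difference of [f] over a small parallelogram is, up to the
    factor [s ^+ 2], a value of either mixed derivative at a point close to
    [x], and both are continuous at [x]. *)
Lemma derive_commute V (A : set V) (f : V -> R) x u v :
  open A -> A x -> Ck 2 A f -> 'D_u ('D_v f) x = 'D_v ('D_u f) x.
Proof.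
have third (M : R) : 0 < M / 3 -> M < M / 3 + M / 3 -> False by lra.
move=> oA Ax [df Df].
(* The mean value theorem, once in each direction. *)
have key (u1 v1 : V) (s : R) : 0 < s ->
    (forall a b, 0 <= a <= s -> 0 <= b <= s -> A (a *: u1 + (b *: v1 + x))) ->
    exists a b, [/\ 0 <= a <= s, 0 <= b <= s &
     f (s *: u1 + (s *: v1 + x)) - f (s *: v1 + x) - (f (s *: u1 + x) - f x) =
     s * (s * 'D_v1 ('D_u1 f) (a *: u1 + (b *: v1 + x)))].
  move=> s0 sA.
  have s1 (r : R) : 0 <= r <= 1 -> 0 <= r * s <= s.
    move=> /andP[r0 r1]; rewrite mulr_ge0 ?(ltW s0) //=.
    by rewrite ger_pMl.
  have s00 : 0 <= (0:R) <= s by rewrite lexx ltW.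
  pose g y := f (y + s *: v1) - f y.
  have sc y : differentiable f y -> 'D_(s *: u1) f y = s * 'D_u1 f y.
    by move=> dfy; rewrite (deriveE _ dfy) linearZ (deriveE _ dfy).
  have sc' y : A y -> 'D_(s *: v1) ('D_u1 f) y = s * 'D_v1 ('D_u1 f) y.
    move=> Ay; have dfy := (Df u1).1 y Ay.
    by rewrite (deriveE _ dfy) linearZ (deriveE _ dfy).
  have Ar (r r' : R) : 0 <= r <= 1 -> 0 <= r' <= 1 ->
      A ((r * s) *: u1 + ((r' * s) *: v1 + x)).
    by move=> r01 r01'; apply: sA; exact: s1.
  have r00 : 0 <= (0:R) <= 1 by rewrite lexx ler01.
  have r11 : 0 <= (1:R) <= 1 by rewrite lexx ler01.
  have A0 r : 0 <= r <= 1 -> A (r *: (s *: u1) + x).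
    by move=> r01; have := Ar r 0 r01 r00; rewrite mul0r scale0r add0r scalerA.
  have A1 r : 0 <= r <= 1 -> A (r *: (s *: u1) + x + s *: v1).
    move=> r01; have := Ar r 1 r01 r11.
    by rewrite mul1r scalerA -addrA (addrC x).
  have dsh y : differentiable f (y + s *: v1) ->
      differentiable (fun y => f (y + s *: v1)) y.
    by move=> dfy; exact: (differentiable_comp (differentiable_addr (s *: v1) y) dfy).
  have [r r01|r r01] := @MVT_line V g x (s *: u1).
    by apply: differentiableB; [apply/dsh/df/A1|apply/df/A0].
  have -> : f (s *: u1 + (s *: v1 + x)) - f (s *: v1 + x) - (f (s *: u1 + x) - f x) =
      g (s *: u1 + x) - g x.
    by rewrite /g -(addrA (s *: u1)) (addrC x (s *: v1)); ring.
  move=> ->; rewrite /g.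
  rewrite deriveB; [|exact/diff_derivable/dsh/df/A1|exact/diff_derivable/df/A0].
  rewrite derive_addr.
  rewrite sc; last exact/df/A1.
  rewrite sc; last exact/df/A0.
  rewrite -mulrBr.
  have [r' r01'|r' r01'] := @MVT_line V ('D_u1 f) (r *: (s *: u1) + x) (s *: v1).
    apply: (Df u1).1; have := Ar r r' r01 r01'.
    by rewrite addrCA !scalerA.
  rewrite (addrC (s *: v1)) => ->; exists (r * s), (r' * s).
  split; [exact: s1|exact: s1|rewrite sc'].
    by rewrite addrCA !scalerA.
  by have := Ar r r' r01 r01'; rewrite addrCA !scalerA.
have [//|neq] := eqVneq ('D_u ('D_v f) x) ('D_v ('D_u f) x).
pose e := `|'D_u ('D_v f) x - 'D_v ('D_u f) x| / 3.
have e0 : 0 < e by rewrite divr_gt0 // normr_gt0 subr_eq0.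
have : \forall y \near x, [/\ A y, `|'D_u ('D_v f) x - 'D_u ('D_v f) y| < e
   & `|'D_v ('D_u f) x - 'D_v ('D_u f) y| < e].
  have c1 := (Df v).2 u x Ax; have c2 := (Df u).2 v x Ax.
  have A1 : \forall y \near x, A y by exact: open_nbhs_nbhs.
  move/(@cvgr_dist_lt _ _ _ (nbhs x) _)/(_ _ e0): c1 => c1.
  move/(@cvgr_dist_lt _ _ _ (nbhs x) _)/(_ _ e0): c2 => c2.
  by move: A1 c1 c2; apply: filterS3 => y a b c; exact (And3 a b c).
move=> /nbhs_ballP[d /= d0 dP].
pose N := `|u| + `|v| + 1.
have N0 : 0 < N by rewrite ltr_wpDl // addr_ge0.
pose s := d / N.
have s0 : 0 < s by rewrite divr_gt0.
have sP a b : 0 <= a <= s -> 0 <= b <= s -> ball x d (a *: u + (b *: v + x)).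
  move=> /andP[a0 as_] /andP[b0 bs]; rewrite -ball_normE /=.
  rewrite addrA opprD addrCA subrr addr0 normrN.
  apply: (le_lt_trans (ler_normD _ _)); rewrite !normrZ !ger0_norm //.
  apply: (@le_lt_trans _ _ (s * (`|u| + `|v|))).
    by rewrite mulrDr lerD // ler_wpM2r.
  rewrite /s -mulrA gtr_pMr // ltr_pdivrMl // mulr1 /N ltrDl.
  exact: ltr01.
have [a [b [as_ bs E1]]] := key u v s s0 (fun a b ha hb => let: And3 h _ _ := dP _ (sP a b ha hb) in h).
have [|a' [b' [as' bs' E2]]] := key v u s s0.
  move=> a' b' ha hb; rewrite addrCA.
  by have [] := dP _ (sP b' a' hb ha).
have E : 'D_v ('D_u f) (a *: u + (b *: v + x)) =
         'D_u ('D_v f) (b' *: u + (a' *: v + x)).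
  have sn0 := lt0r_neq0 s0.
  have sub4 (a1 a2 a3 a4 : R) : a1 - a2 - (a3 - a4) = a1 - a3 - (a2 - a4) by ring.
  rewrite (addrCA (a' *: v) (b' *: u) x) (addrCA (s *: v) (s *: u) x) in E2.
  exact: (mulfI sn0 (mulfI sn0 (etrans (esym E1) (etrans (sub4 _ _ _ _) E2)))).
have [_ _ h1] := dP _ (sP a b as_ bs).
have [_ h2 _] := dP _ (sP b' a' bs' as').
rewrite E in h1.
have dist3 (p q r : R) : `|p - q| < e -> `|r - q| < e -> `|p - r| < e + e.
  move=> pq rq; rewrite distrC in rq; rewrite -(subrKA q).
  by apply: le_lt_trans (ltrD pq rq); exact: ler_normD.
exact (False_ind _ (third _ e0 (dist3 _ _ _ h2 h1))).
Unshelve. all: by end_near. Qed.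

End MeanValue.

(** * Taylor expansion in time, uniformly in a parameter *)

Section Taylor.
Context {R : realType}.
Implicit Types V W : normedModType R.

Definition time_deriv V W (f : R * V -> W) : R * V -> W :=
  'D_((1, 0) : R * V) f.

Lemma derive_time V W (f : R * V -> W) (t : R) x :
  time_deriv f (t, x) = 'D_1 (fun s : R => f (s, x)) t.
Proof.
rewrite /time_deriv /derive.
have E : (fun h : R => h^-1 *: ((f \o shift (t, x)) (h *: ((1, 0) : R * V)) - f (t, x))) =
   (fun h : R => h^-1 *: (((fun s : R => f (s, x)) \o shift t) (h *: (1 : R)) - f (t, x))).
  apply/funext => h /=; congr (_ *: (f _ - _)).
  by apply: injective_projections => //=; rewrite scaler0 add0r.
by rewrite E.
Qed.

Lemma derivable_time V W (f : R * V -> W) (t : R) x :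
  differentiable f (t, x) -> derivable (fun s : R => f (s, x)) t 1.
Proof.
move=> df; have : derivable f (t, x) ((1, 0) : R * V) by exact: diff_derivable.
rewrite /derivable.
have E : (fun h : R => h^-1 *: ((f \o shift (t, x)) (h *: ((1, 0) : R * V)) - f (t, x))) =
   (fun h : R => h^-1 *: (((fun s : R => f (s, x)) \o shift t) (h *: (1 : R)) - f (t, x))).
  apply/funext => h /=; congr (_ *: (f _ - _)).
  by apply: injective_projections => //=; rewrite scaler0 add0r.
by rewrite E.
Qed.

Lemma is_derive_time V W (f : R * V -> W) (t : R) x :
  differentiable f (t, x) ->
  is_derive t (1 : R) (fun s : R => f (s, x)) (time_deriv f (t, x)).
Proof.
by move=> df; split; [exact: derivable_time|rewrite derive_time].
Qed.

Lemma derive_space V W (f : R * V -> W) (t : R) x v :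
  'D_((0, v) : R * V) f (t, x) = 'D_v (fun y => f (t, y)) x.
Proof.
rewrite /derive.
have E : (fun h : R => h^-1 *: ((f \o shift (t, x)) (h *: ((0, v) : R * V)) - f (t, x))) =
   (fun h : R => h^-1 *: (((fun y => f (t, y)) \o shift x) (h *: v) - f (t, x))).
  apply/funext => h /=; congr (_ *: (f _ - _)).
  by apply: injective_projections => //=; rewrite scaler0 add0r.
by rewrite E.
Qed.

Lemma iter_time_deriv_smooth V W (A : set (R * V)) (f : R * V -> W) i :
  smooth_on A f -> smooth_on A (iter i (@time_deriv V W) f).
Proof. by move=> sf; elim: i => //= i; exact: smooth_derive. Qed.

Lemma is_derive_taylor k (c : nat -> R) (t : R) :
  is_derive t (1 : R) (fun s : R => \sum_(i < k.+1) s ^+ i / i`!%:R * c i)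
    (\sum_(i < k) t ^+ i / i`!%:R * c i.+1).
Proof.
elim: k => [|k IH].
  rewrite big_ord0.
  have -> : (fun s : R => \sum_(i < 1) s ^+ i / i`!%:R * c i) = cst (c 0%N).
    by apply/funext => s; rewrite big_ord1 expr0 divr1 mul1r.
  exact: is_derive_cst.
have -> : (fun s : R => \sum_(i < k.+2) s ^+ i / i`!%:R * c i) =
    (fun s : R => \sum_(i < k.+1) s ^+ i / i`!%:R * c i) +
    (c k.+1 / k.+1`!%:R) \*: (fun s : R => s ^+ k.+1).
  have E (a b d : R) : a * b * d = (d * b) *: (a : R) by rewrite /GRing.scale /=; ring.
  by apply/funext => s; rewrite big_ord_recr /=; congr (_ + _); exact: E.
rewrite big_ord_recr /=; apply: is_deriveD.
have h : is_derive t (1 : R) (fun s : R => s ^+ k.+1) (k.+1%:R * t ^+ k).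
  split; first exact: exprn_derivable.
  by rewrite exp_derive [_ *: 1]mulr1.
apply: is_derive_eq.
rewrite factS natrM invfM.
have k0 : (k.+1%:R : R) != 0 by rewrite pnatr_eq0.
have kf : (k`!%:R : R) != 0 by rewrite pnatr_eq0 -lt0n fact_gt0.
rewrite /GRing.scale /=; field.
by rewrite kf (addrC 1) natr1 k0.
Qed.

(** By induction on [k]: the remainder vanishes at time 0 and its time
    derivative is the previous remainder of [time_deriv f], so that the mean
    value theorem gains one power of the time. *)
Lemma taylor_time V (A : set (R * V)) (f : R * V -> R) x0 k :
  open A -> A (0, x0) -> smooth_on A f -> exists2 C, 0 <= C &
  \forall q \near ((0 : R), x0),
    `|f q - \sum_(i < k) q.1 ^+ i / i`!%:R *
       iter i (@time_deriv V R) f (0, q.2)| <= C * `|q.1| ^+ k.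
Proof.
move=> oA A0; elim: k f => [|k IH] f sf.
  exists (`|f (0, x0)| + 1); first by rewrite addr_ge0.
  have cf := smooth_continuous sf A0.
  move/(@cvgr_dist_lt _ _ _ (nbhs _) _)/(_ _ ltr01): cf.
  apply: filterS => q; rewrite big_ord0 subr0 expr0 mulr1 => h.
  have := ler_distD (f (0, x0)) 0 (f q); rewrite !sub0r !normrN.
  by move=> /le_trans; apply; rewrite lerD2l ltW.
have sdf : smooth_on A (@time_deriv V R f) by exact: smooth_derive.
have [C C0 HC] := IH _ sdf; exists C => //.
have HA : \forall q \near ((0 : R), x0), A q by exact: open_nbhs_nbhs.
have : \forall q \near ((0 : R), x0), A q /\ `|@time_deriv V R f q -
    \sum_(i < k) q.1 ^+ i / i`!%:R * iter i (@time_deriv V R) (@time_deriv V R f) (0, q.2)|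
    <= C * `|q.1| ^+ k.
  by move: HA HC; apply: filterS2 => q a b; split.
move=> /nbhs_ballP[d /= d0 dP].
apply/nbhs_ballP; exists d => //= -[t x] [/= td xd].
pose c i := iter i (@time_deriv V R) f (0, x).
pose r (s : R) := f (s, x) - \sum_(i < k.+1) s ^+ i / i`!%:R * c i.
have r0 : r 0 = 0.
  rewrite /r big_ord_recl expr0 divr1 mul1r /c /= big1 ?addr0 ?subrr // => i _.
  by rewrite expr0n /= !mul0r.
have := @is_derive_mean_bound R r (fun s => time_deriv f (s, x) -
   \sum_(i < k) s ^+ i / i`!%:R * c i.+1) (C * `|t| ^+ k) t.
rewrite r0 subr0 -mulrA -exprSr; apply=> s st.
have sd : ball ((0 : R), x0) d (s, x).
  split=> //=; move: td; rewrite -!ball_normE /= !sub0r !normrN.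
  exact: le_lt_trans.
have [As Bs] := dP _ sd; split.
  apply: is_deriveB; last exact: is_derive_taylor.
  exact/is_derive_time/(smooth_diff sf As).
apply: (@le_trans _ _ (C * `|s| ^+ k)); last first.
  by rewrite ler_wpM2l // lerXn2r // nnegrE.
move: Bs => /=; congr (`|_ - _| <= _).
by apply: eq_bigr => i _; rewrite /c -iterSr.
Qed.

Lemma le0_of_small (a M : R) : (\forall t \near (0 : R)^'+, a <= M * t) -> a <= 0.
Proof.
move=> H; rewrite leNgt; apply/negP => a0.
have N0 : 0 < `|M| + 1 by rewrite ltr_wpDl.
have : \forall t \near (0 : R)^'+, [/\ a <= M * t, 0 < t & t < a / (`|M| + 1)].
  have h1 := nbhs_right_gt (0 : R).
  have h2 := nbhs_right_lt (divr_gt0 a0 N0).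
  by move: H h1 h2; apply: filterS3 => t *; split.
move=> /filter_ex[t [h1 t0]]; rewrite ltr_pdivlMr // => h2.
have := ler_norm M => h3; have := ler_wpM2r (ltW t0) h3.
lra.
Qed.

(** By Taylor's formula, the first non-zero coefficient would dominate. *)
Lemma flat_coef V (A : set (R * V)) (f : R * V -> R) x k C :
  open A -> A (0, x) -> smooth_on A f ->
  (\forall t \near (0 : R)^'+, `|f (t, x)| <= C * t ^+ k) ->
  forall i, (i < k)%N -> iter i (@time_deriv V R) f (0, x) = 0.
Proof.
move=> oA Ax sf fC i; elim/ltn_ind: i => i IH ik.
have [C' C'0 HT] := @taylor_time V A f x i.+1 oA Ax sf.
set c := iter i _ _ _.
have fi : 0 < (i`!%:R : R) by rewrite ltr0n fact_gt0.
apply/eqP; rewrite -normr_le0.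
suff : `|c| / i`!%:R <= 0 by rewrite pmulr_lle0 // invr_gt0.
(* Dividing by [t ^+ i] leaves a bound that is linear in [t]. *)
apply: (@le0_of_small _ (`|C| + C')).
have HT' : \forall t \near (0 : R)^'+,
    `|f (t, x) - t ^+ i / i`!%:R * c| <= C' * t ^+ i.+1.
  move: HT => /nbhs_ballP[d /= d0 dP].
  near=> t; have t0 : 0 < t by near: t; exact: nbhs_right_gt.
  have td : t < d by near: t; exact: nbhs_right_lt.
  have := dP (t, x); rewrite /= big_ord_recr /= big1 ?add0r; last first.
    move=> j _; rewrite IH ?mulr0 //; exact: ltn_trans ik.
  rewrite (gtr0_norm t0); apply; split; last exact: ballxx.
  by rewrite -ball_normE /= sub0r normrN gtr0_norm.
near=> t.
have t0 : 0 < t by near: t; exact: nbhs_right_gt.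
have t1 : t <= 1 by near: t; exact: nbhs_right_le.
have h1 : `|f (t, x)| <= C * t ^+ k by near: t.
have h2 : `|f (t, x) - t ^+ i / i`!%:R * c| <= C' * t ^+ i.+1 by near: t.
have ti : 0 < t ^+ i by exact: exprn_gt0.
have h3 : C * t ^+ k <= `|C| * t ^+ i.+1.
  apply: le_trans (ler_wpM2r _ (ler_norm C)) _; first exact/exprn_ge0/ltW.
  by rewrite ler_wpM2l // ler_wiXn2l // ltW.
have h4 : `|t ^+ i / i`!%:R * c| <= (`|C| + C') * t ^+ i.+1.
  rewrite -normrN -[X in `|X|](addKr (f (t, x))) mulrDl.
  apply: le_trans (ler_normD _ _) _; rewrite normrN.
  by apply: lerD => //; exact: le_trans h1 h3.
move: h4; rewrite normrM gtr0_norm ?divr_gt0 // exprSr mulrA.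
rewrite [X in X <= _](_ : _ = `|c| / i`!%:R * t ^+ i); last first.
  by rewrite mulrC mulrA mulrAC.
by rewrite [leRHS]mulrAC ler_pM2r.
Unshelve. all: by end_near. Qed.

End Taylor.

Section Flatness.
Context {R : realType}.
Implicit Types V W : normedModType R.

Lemma time_space_commute V (A : set (R * V)) (f : R * V -> R) v i q :
  open A -> smooth_on A f -> A q ->
  iter i (@time_deriv R V R) ('D_((0, v) : R * V) f) q =
  'D_((0, v) : R * V) (iter i (@time_deriv R V R) f) q.
Proof.
move=> oA sf; elim: i q => [//|i IH] q Aq /=.
transitivity (time_deriv ('D_((0, v) : R * V) (iter i (@time_deriv R V R) f)) q).
  by apply: near_eq_derive; exact: near_open oA Aq IH.
exact: (derive_commute _ _ oA Aq (iter_time_deriv_smooth i sf 2%N)).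
Qed.

(** The constant may depend on the point; for a smooth function it can be
    chosen locally uniform, and the space derivatives obey the same bound
    ([flat_derive_near]). *)
Definition vanishes_to V (k : nat) (U : set V) (f : R * V -> R) :=
  forall x, U x -> exists C, \forall t \near (0 : R)^'+, `|f (t, x)| <= C * t ^+ k.

Section FlatFunction.
Context {V : normedModType R} (A : set (R * V)) (U : set V) (f : R * V -> R)
  (k : nat).
Hypotheses (oA : open A) (oU : open U) (UA : forall x, U x -> A (0, x))
  (sf : smooth_on A f) (f0 : vanishes_to k U f).

(** The Taylor coefficients in time of [f] vanish identically around [x0],
    hence so do those of its space derivatives, as both kinds of derivatives
    commute. *)
Lemma flat_derive_near v x0 : U x0 -> exists2 C, 0 <= C &
  \forall q \near ((0 : R), x0), `|'D_((0, v) : R * V) f q| <= C * `|q.1| ^+ k.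
Proof.
move=> Ux0.
have sdf : smooth_on A ('D_((0, v) : R * V) f) by exact: smooth_derive.
have [C C0 HC] := taylor_time k oA (UA Ux0) sdf.
exists C => //.
have HU : \forall q \near ((0 : R), x0), U q.2.
  by apply: (cvg_snd (F := nbhs (0 : R))); exact: open_nbhs_nbhs.
move: HU HC; apply: filterS2 => q Uq; rewrite big1 ?subr0 // => i _.
have -> : iter i (@time_deriv R V R) ('D_((0, v) : R * V) f) (0, q.2) = 0.
  rewrite (time_space_commute _ _ oA sf (UA Uq)) derive_space.
  rewrite (@near_eq_derive _ _ _ _ (cst 0)) ?derive_cst //.
  apply: near_open oU Uq _ => y Uy.
  by have [D HD] := f0 Uy; rewrite (flat_coef oA (UA Uy) sf HD).
by rewrite mulr0.
Qed.

End FlatFunction.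
End Flatness.

(** * Gradients *)

Section Gradients.
Context {R : realType} {n : nat}.
Local Notation Rn := 'cV[R]_n.

Lemma basis_vec_sum (v : Rn) : v = \sum_i v i 0 *: basis_vec i.
Proof.
rewrite [LHS]matrix_sum_delta; apply: eq_bigr => i _.
by rewrite big_ord1.
Qed.

Lemma derive_grad (f : Rn -> R) x v : differentiable f x ->
  'D_v f x = ((grad f x)^T *m v) 0 0.
Proof.
move=> df; rewrite {1}(basis_vec_sum v) derive_dir_sum // !mxE.
by apply: eq_bigr => i _; rewrite !mxE mulrC.
Qed.

Lemma smooth_grad (A : set Rn) (f : Rn -> R) : open A ->
  smooth_on A f -> smooth_on A (grad f).
Proof.
move=> oA sf; apply: smooth_mx => // i j.
have : smooth_on A ('D_(basis_vec i) f) by exact: smooth_derive.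
by apply: eq_smooth => // x _; rewrite /grad mxE.
Qed.

Lemma near_eq_grad (f g : Rn -> R) x :
  (\forall y \near x, f y = g y) -> grad f x = grad g x.
Proof.
by move=> fg; apply/colP => i; rewrite !mxE; exact: near_eq_derive.
Qed.

Lemma smooth_hamiltonian_field (A : set Rn) (pi : Rn -> 'M[R]_n) (H : Rn -> R) :
  open A -> smooth_on A pi -> smooth_on A H ->
  smooth_on A (hamiltonian_field pi H).
Proof.
by move=> oA sp sH; apply: smooth_mul => //; exact: smooth_grad.
Qed.

End Gradients.

(** * Smooth inversion of a family of maps close to the identity *)

HB.instance Definition _ (R : realType) (m n : nat) :=
  Uniform_isComplete.Build 'M[R]_(m, n) (@cauchy_cvg 'M[R]_(m, n)).

Lemma contraction_closed_ball (R : realType) (X : completeNormedModType R)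
    (T : X -> X) (y0 : X) (r : R) : 0 <= r ->
  (forall y, `|y - y0| <= r -> `|T y - y0| <= r) ->
  (forall y z, `|y - y0| <= r -> `|z - y0| <= r ->
     `|T y - T z| <= 2^-1 * `|y - z|) ->
  exists2 y, `|y - y0| <= r & T y = y.
Proof.
move=> r0 TB Tc; pose B := [set y | `|y - y0| <= r].
have fB : set_fun B B T by move=> y; exact: TB.
have h2 : 0 <= (2^-1 : R) by rewrite invr_ge0.
have ctr : is_contraction (mkfun_fun fB).
  exists (NngNum h2); split => /=; first by rewrite invf_lt1 ?ltr1n.
  by move=> [y z] [/= By Bz]; exact: Tc.
have cB : closed B.
  have cf : continuous (fun y : X => `|y - y0|).
    by move=> y; apply: cvg_norm; apply: cvgB; [exact: cvg_id|exact: cvg_cst].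
  exact: (preimage_closed (fun y _ => cf y) (@closed_le R r)).
have [|y By E] := banach_fixed_point ctr cB.
  by exists y0; rewrite /B /= subrr normr0.
by exists y.
Qed.

Section SpaceJacobian.
Context {R : realType} {n : nat}.
Local Notation Rn := 'cV[R]_n.

Definition space_dir (v : Rn) : R * Rn := (0, v).

Lemma space_dir_is_linear : linear space_dir.
Proof.
move=> a v w; apply: injective_projections => //=.
by rewrite scaler0 addr0.
Qed.
HB.instance Definition _ :=
  GRing.isLinear.Build R Rn (R * Rn)%type _ space_dir space_dir_is_linear.

Definition space_jac (F : R * Rn -> Rn) (q : R * Rn) : 'M[R]_n :=
  \matrix_(i, j) ('D_((0, basis_vec j) : R * Rn) F q) i 0.

Lemma space_jacE (F : R * Rn -> Rn) q v : differentiable F q ->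
  'D_((0, v) : R * Rn) F q = space_jac F q *m v.
Proof.
move=> dF; rewrite (deriveE _ dF) -[((0, v) : R * Rn)]/(space_dir v).
rewrite {1}(basis_vec_sum v) !linear_sum; apply/colP => i; rewrite summxE !mxE.
apply: eq_bigr => j _; rewrite !linearZ /= !mxE mulrC; congr (_ * _).
by rewrite (deriveE _ dF).
Qed.

Lemma derive_time_space (F : R * Rn -> Rn) q (s : R) v : differentiable F q ->
  'D_((s, v) : R * Rn) F q = s *: time_deriv F q + space_jac F q *m v.
Proof.
move=> dF; rewrite -(space_jacE v dF) -(derive_dirP _ _ _ dF).
congr ('D_(_) F q); apply: injective_projections => /=.
  by rewrite [_ *: 1]mulr1 addr0.
by rewrite scaler0 add0r.
Qed.

Lemma smooth_space_jac (A : set (R * Rn)) (F : R * Rn -> Rn) : open A ->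
  smooth_on A F -> smooth_on A (space_jac F).
Proof.
move=> oA sF; apply: smooth_mx => // i j.
have h : smooth_on A ('D_((0, basis_vec j) : R * Rn) F) by exact: smooth_derive.
have := smooth_entry i 0 oA h.
by apply: eq_smooth => // x _; rewrite mxE.
Qed.

Lemma unitmx_near_id (M : 'M[R]_n) :
  (forall v : Rn, `|M *m v - v| <= 2^-1 * `|v|) -> M \in unitmx.
Proof.
move=> HM; rewrite -unitmx_tr -row_free_unit; apply: inj_row_free => v Mv.
have := HM v^T; have -> : M *m v^T = 0 by rewrite -[M]trmxK -trmx_mul Mv trmx0.
rewrite sub0r normrN => h.
have v0 : `|v^T| <= 0 by move: h; move: `|_| => a h; lra.
by move: v0; rewrite normr_le0 => /eqP v0; rewrite -[v]trmxK v0 trmx0.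
Qed.

End SpaceJacobian.

Section GoodBoxes.
Context {R : realType} {n : nat}.
Local Notation Rn := 'cV[R]_n.
Variables (A : set (R * Rn)) (U : set Rn) (F : R * Rn -> Rn).
Hypotheses (oA : open A) (oU : open U) (UA : forall x, U x -> A (0, x))
  (F0 : forall x, U x -> F (0, x) = x) (sF : smooth_on A F).

(** The estimates hold on a ball four times as large as the box, so that
    injectivity passes to unions of boxes: see [good_boxes_inj]. *)
Definition good_box (c : Rn) (r e : R) :=
  [/\ 0 < r, 0 < e,
     forall t y, `|t| < e -> ball c (4 * r) y -> A (t, y) /\
       forall v : Rn, `|'D_((0, v) : R * Rn) F (t, y) - v| <= 2^-1 * `|v|,
     forall t y z, `|t| < e -> ball c (4 * r) y -> ball c (4 * r) z ->
       `|F (t, y) - F (t, z) - (y - z)| <= 2^-1 * `|y - z|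
   & forall t y, `|t| < e -> ball c r y -> `|F (t, y) - y| < r].

Lemma good_box_exists c : U c -> exists r e, good_box c r e.
Proof.
move=> Uc; have Ac := UA Uc.
have h2 : 0 < (2^-1 : R) by rewrite invr_gt0.
have dF0 v : 'D_((0, v) : R * Rn) F (0, c) = v.
  rewrite derive_space (@near_eq_derive _ _ _ _ id) ?derive_id //.
  exact: near_open oU Uc F0.
have := @derive_dir_near R Rn _ _ space_dir A F (0, c) (@frame_mx R n 1) oA Ac
  (sF 1%N) _ h2.
move=> /nbhs_ballP[d /= d0 dP].
have Pd t y : `|t| < d -> ball c d y -> A (t, y) /\
       forall v : Rn, `|'D_((0, v) : R * Rn) F (t, y) - v| <= 2^-1 * `|v|.
  move=> td yd; have [|Aty H] := dP (t, y).
    by split => //; rewrite -ball_normE /= sub0r normrN.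
  by split=> // v; have := H v; rewrite dF0.
have dFy t y : A (t, y) -> differentiable (fun z => F (t, z)) y.
  move=> Aty; apply: (@differentiable_comp _ _ _ _ (fun z => (t, z)) F).
    apply: differentiable_pair; first exact: differentiable_cst.
    by apply: (@linear_differentiable _ _ _ idfun) => z; exact: cvg_id.
  exact: smooth_diff sF Aty.
have did y : differentiable (@id Rn) y.
  by apply: (@linear_differentiable _ _ _ idfun) => z; exact: cvg_id.
have lip t y z : `|t| < d -> ball c d y -> ball c d z ->
       `|F (t, y) - F (t, z) - (y - z)| <= 2^-1 * `|y - z|.
  move=> td yd zd.
  have := @mean_bound_line R _ _ _ (fun z => F (t, z) - z) z (y - z) (2^-1 * `|y - z|).
  rewrite subrK => H.
  have -> : F (t, y) - F (t, z) - (y - z) = F (t, y) - y - (F (t, z) - z).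
    by rewrite !opprD !opprK addrACA.
  apply: H => s s01; have sd := ball_segment zd yd s01.
  have [As Bs] := Pd t _ td sd; split.
    by apply: differentiableB; [exact: dFy|exact: did].
  rewrite deriveB; [|exact/diff_derivable/dFy|exact/diff_derivable/did].
  by rewrite derive_id -derive_space; exact: Bs.
pose r := d / 4.
have r0 : 0 < r by rewrite divr_gt0.
have r4 : 4 * r = d by rewrite /r mulrC divfK.
have cF := smooth_continuous sF Ac.
have : \forall q \near ((0 : R), c), `|F (0, c) - F q| < r / 2.
  by move/(@cvgr_dist_lt _ _ _ (nbhs _) _): cF; apply; rewrite divr_gt0.
move=> /nbhs_ballP[e /= e0 eP].
exists r, (Num.min d e); split=> //.
- by rewrite lt_min d0.
- by move=> t y; rewrite lt_min r4 => /andP[td _]; exact: Pd.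
- by move=> t y z; rewrite lt_min r4 => /andP[td _]; exact: lip.
- move=> t y; rewrite lt_min => /andP[td te] yr.
  have ye : ball c d y by apply: le_ball yr; rewrite -r4; move: r0; lra.
  have := lip t y c td ye (ballxx _ d0).
  have : `|F (0, c) - F (t, c)| < r / 2.
    apply: (eP (t, c)); split; last exact: ballxx.
    by rewrite -ball_normE /= sub0r normrN.
  rewrite F0 //; move: yr; rewrite -ball_normE /= (distrC c y).
  have -> : F (t, y) - y = (F (t, y) - F (t, c) - (y - c)) - (c - F (t, c)).
    by rewrite !opprB [RHS]addrAC !subrKA.
  move: (F (t, y) - F (t, c) - (y - c)) (c - F (t, c)) => a b h1 h2' h3.
  have := ler_normB a b; move: h1 h2' h3; move: `|a| `|b| `|y - c| `|a - b|.
  by clearbody r => w1 w2 w3 w4 u1 u2 u3 u4; lra.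
Qed.

End GoodBoxes.

Lemma near_fst (T T' : topologicalType) (x : T) (y : T') (P : set T) :
  nbhs x P -> \forall q \near (x, y), P q.1.
Proof. by move=> Px; exact: (cvg_fst (F := nbhs x) (G := nbhs y) Px). Qed.

Lemma near_snd (T T' : topologicalType) (x : T) (y : T') (P : set T') :
  nbhs y P -> \forall q \near (x, y), P q.2.
Proof. by move=> Px; exact: (cvg_snd (F := nbhs x) (G := nbhs y) Px). Qed.

Lemma near_norm_lt (R : realType) (V : normedModType R) (x : V) (e : R) :
  `|x| < e -> \forall y \near x, `|y| < e.
Proof.
move=> xe; apply/nbhs_ballP; exists (e - `|x|); first by rewrite /= subr_gt0.
move=> y; rewrite -ball_normE /= => xy.
by rewrite -(subrK x y) (le_lt_trans (ler_normD _ _)) // distrC -ltrBrDr.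
Qed.

Lemma near_dist_lt (R : realType) (V : normedModType R) (x : V) (e : R) :
  0 < e -> \forall y \near x, `|y - x| < e.
Proof.
move=> e0; apply/nbhs_ballP; exists e => // y.
by rewrite -ball_normE /= distrC.
Qed.

Lemma near_continuous_lt (R : realType) (T : topologicalType)
    (W : normedModType R) (f : T -> W) (x : T) (e : R) :
  {for x, continuous f} -> 0 < e -> \forall y \near x, `|f y - f x| < e.
Proof.
move=> cf e0; have := @cvgr_distC_lt R W T (nbhs x) _ f (f x) cf e e0; exact.
Qed.

Section InjectivityDomain.
Context {R : realType} {n : nat}.
Local Notation Rn := 'cV[R]_n.
Variables (A : set (R * Rn)) (U : set Rn) (F : R * Rn -> Rn).
Hypotheses (oA : open A) (oU : open U) (UA : forall x, U x -> A (0, x))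
  (F0 : forall x, U x -> F (0, x) = x) (sF : smooth_on A F).

(** The union of all boxes: a neighbourhood of [{0} x U] on which [F] is
    injective at each time, whatever the shape of [U]. *)
Definition inj_dom : set (R * Rn) :=
  [set q | exists c r e, [/\ good_box A F c r e, `|q.1| < e & ball c r q.2]].

Lemma good_box_le (c : Rn) (r : R) y : 0 < r -> ball c r y -> ball c (4 * r) y.
Proof. by move=> r0; apply: le_ball; lra. Qed.

Lemma inj_dom_open : open inj_dom.
Proof.
rewrite openE => -[t y] [c [r [e [gb te yr]]]].
have [r0 e0 _ _ _] := gb.
have h1 : \forall s \near t, `|s| < e := near_norm_lt te.
have h2 : \forall z \near y, ball c r z.
  by apply: open_nbhs_nbhs; split => //; exact: ball_open.
exists ([set s | `|s| < e], [set z | ball c r z]) => //= -[s z] [/= sh zh].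
by exists c, r, e; split.
Qed.

Lemma inj_dom_sub q : inj_dom q -> A q.
Proof.
case: q => t y [c [r [e [[r0 _ H _ _] te yr]]]].
exact: (H t y te (good_box_le r0 yr)).1.
Qed.

Lemma inj_dom0 x : U x -> inj_dom (0, x).
Proof.
move=> Ux; have [r [e gb]] := good_box_exists oA oU UA F0 sF Ux.
exists x, r, e; split=> //=; first by rewrite normr0; case: gb.
by apply: ballxx; case: gb.
Qed.

Lemma inj_dom_jac q : inj_dom q -> 
  forall v : Rn, `|space_jac F q *m v - v| <= 2^-1 * `|v|.
Proof.
case: q => t y Iq; have dF := smooth_diff sF (inj_dom_sub Iq).
move: Iq => [c [r [e [[r0 _ H _ _] te yr]]]] v.
by rewrite -(space_jacE v dF); exact: (H t y te (good_box_le r0 yr)).2.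
Qed.

(** Both points are moved by less than the radius of their box, so they are
    at distance less than [2 * r] and lie in the enlarged ball of the larger
    box, where a 1/2-Lipschitz perturbation of the identity is injective. *)
Lemma good_boxes_inj c r e c' r' e' t y z : r' <= r ->
  good_box A F c r e -> `|t| < e -> ball c r y ->
  good_box A F c' r' e' -> `|t| < e' -> ball c' r' z ->
  F (t, y) = F (t, z) -> y = z.
Proof.
move=> rr gb te yr gb' te' zr.
move=> E; have [r0 _ _ L Fb] := gb; have [_ _ _ _ Fb'] := gb'.
have yF := Fb t y te yr; have zF := Fb' t z te' zr.
have yz : `|y - z| < r + r.
  rewrite -(subrKA (F (t, y))) {2}E; apply: le_lt_trans (ler_normD _ _) _.
  by rewrite distrC ltrD // (lt_le_trans zF).
have zc : ball c (4 * r) z.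
  move: yr; rewrite -!ball_normE /= => yr.
  rewrite -(subrKA y); apply: le_lt_trans (ler_normD _ _) _.
  move: yr yz; move: `|c - y| `|y - z| => a b; lra.
have := L t y z te (good_box_le r0 yr) zc.
rewrite E subrr sub0r normrN => h.
have : `|y - z| <= 0 by move: h; move: `|y - z| => a; lra.
by rewrite normr_le0 subr_eq0 => /eqP.
Qed.

Lemma inj_dom_inj t y z : inj_dom (t, y) -> inj_dom (t, z) ->
  F (t, y) = F (t, z) -> y = z.
Proof.
move=> [c [r [e [gb /= te yr]]]] [c' [r' [e' [gb' /= te' zr]]]] E.
have [rr|rr] := leP r' r; first exact: good_boxes_inj rr gb te yr gb' te' zr E.
exact/esym/(good_boxes_inj (ltW rr) gb' te' zr gb te yr (esym E)).
Qed.

Definition inv_dom : set (R * Rn) :=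
  [set q | exists y, inj_dom (q.1, y) /\ F (q.1, y) = q.2].

Definition family_inverse (q : R * Rn) : Rn :=
  xget 0 [set y | inj_dom (q.1, y) /\ F (q.1, y) = q.2].

Local Notation G := family_inverse.

Lemma family_inverseP q : inv_dom q -> inj_dom (q.1, G q) /\ F (q.1, G q) = q.2.
Proof.
exact: (@xgetPex _ 0 [set y | inj_dom (q.1, y) /\ F (q.1, y) = q.2]).
Qed.

Lemma inv_dom_image t y : inj_dom (t, y) -> inv_dom (t, F (t, y)).
Proof. by move=> Iy; exists y. Qed.

Lemma family_inverseK t y : inj_dom (t, y) -> G (t, F (t, y)) = y.
Proof.
move=> Iy; have [/= h1 h2] := family_inverseP (inv_dom_image Iy).
exact: inj_dom_inj h1 Iy h2.
Qed.

(** The solution of [F (t, y) = x] is the fixed point of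
    [y |-> y - F (t, y) + x], which contracts a small ball around [y0]. *)
Lemma local_solution t0 y0 rho : inj_dom (t0, y0) -> 0 < rho ->
  \forall q \near (t0, F (t0, y0)), inv_dom q /\ `|G q - y0| <= rho.
Proof.
move=> I0 rho0; have [c [r [e [gb /= te yr]]]] := I0.
have [r0 e0 _ L _] := gb.
have [d d0 dr] : exists2 d, 0 < d & forall z, `|z - y0| <= d -> ball c r z.
  have := open_nbhs_nbhs (conj (@ball_open R Rn c r) yr : open_nbhs y0 (ball c r)).
  move=> /nbhs_ballP[d /= d0 dP]; exists (d / 2); first by rewrite divr_gt0.
  move=> z zd; apply: dP; rewrite -ball_normE /= distrC.
  by apply: le_lt_trans zd _; rewrite ltr_pdivrMr // ltr_pMr // ltr1n.
pose p := Num.min d rho; have p0 : 0 < p by rewrite lt_min d0.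
have p4 : 0 < p / 4 by rewrite divr_gt0.
set x0 := F (t0, y0).
have h1 : \forall q \near (t0, x0), `|q.1| < e.
  exact: (near_fst x0 (near_norm_lt te)).
have h2 : \forall q \near (t0, x0), `|q.2 - x0| < p / 4.
  exact: (near_snd t0 (near_dist_lt x0 p4)).
have h3 : \forall q \near (t0, x0), `|F (q.1, y0) - x0| < p / 4.
  apply: (@near_fst _ _ t0 x0 (fun s => `|F (s, y0) - x0| < p / 4)).
  have cF := smooth_continuous sF (inj_dom_sub I0).
  have cFt : {for t0, continuous (fun s : R => F (s, y0))}.
    apply: (@continuous_comp _ _ _ (fun s : R => (s, y0)) F); last exact: cF.
    have sp := smooth_pair openT (@smooth_id R R setT) (@smooth_cst R R Rn setT y0).
    exact: (smooth_continuous sp I).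
  exact: (near_continuous_lt cFt p4).
move: h1 h2 h3; apply: filterS3 => -[t x] /= th xh Fh.
have Ib y : `|y - y0| <= p -> ball c r y.
  by move=> yp; apply: dr; rewrite (le_trans yp) // ge_min lexx.
have h2 : 2^-1 * p + p / 2 = p by rewrite mulrC -splitr.
have [||y yp E] := @contraction_closed_ball R Rn (fun y => y - F (t, y) + x) y0 p (ltW p0).
- move=> y yp.
  have := L t y y0 th (good_box_le r0 (Ib y yp)) (good_box_le r0 yr).
  have -> : y - F (t, y) + x - y0 =
     (x - x0) - (F (t, y0) - x0) - (F (t, y) - F (t, y0) - (y - y0)).
    by apply/colP => i; rewrite !mxE; ring.
  move: (F (t, y) - F (t, y0) - (y - y0)) => w.
  move: xh Fh yp; move: (x - x0) (F (t, y0) - x0) => u v.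
  have := ler_normB (u - v) w; have := ler_normB u v.
  move: `|u - v - w| `|u - v| `|u| `|v| `|w| `|y - y0| => a1 a2 a3 a4 a5 a6.
  lra.
- move=> y z yp zp.
  have := L t z y th (good_box_le r0 (Ib z zp)) (good_box_le r0 (Ib y yp)).
  rewrite (distrC z).
  by have -> : y - F (t, y) + x - (z - F (t, z) + x) =
    F (t, z) - F (t, y) - (z - y)
    by apply/colP => i; rewrite !mxE; ring.
have Fy : F (t, y) = x.
  by apply: (addIr (y - F (t, y))); rewrite addrC subrK [RHS]addrC E.
have Iy : inj_dom (t, y) by exists c, r, e; split => //=; exact: Ib.
have Dx : inv_dom (t, x) by exists y.
split=> //; rewrite -Fy family_inverseK //; apply: le_trans yp _.
by rewrite ge_min lexx orbT.
Qed.

End InjectivityDomain.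

Section SmoothInverse.
Context {R : realType} {n : nat}.
Local Notation Rn := 'cV[R]_n.
Variables (A : set (R * Rn)) (U : set Rn) (F : R * Rn -> Rn).
Hypotheses (oA : open A) (oU : open U) (UA : forall x, U x -> A (0, x))
  (F0 : forall x, U x -> F (0, x) = x) (sF : smooth_on A F).

Local Notation O := (inj_dom A F).
Local Notation D := (inv_dom A F).
Local Notation G := (family_inverse A F).

Lemma inv_dom_open : open D.
Proof.
rewrite openE => -[t x] Dx.
have [/= Iy Fy] := family_inverseP Dx.
have := local_solution sF Iy ltr01; rewrite Fy.
by apply: filterS => q [].
Qed.

Lemma family_inverse_near q e : D q -> 0 < e -> \forall p \near q, `|G p - G q| < e.
Proof.
case: q => t x Dx e0.
have [/= Iy Fy] := family_inverseP Dx.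
have e2 : 0 < e / 2 by rewrite divr_gt0.
have := local_solution sF Iy e2; rewrite Fy.
apply: filterS => p [_ h]; apply: le_lt_trans h _.
by rewrite ltr_pdivrMr // ltr_pMr // ltr1n.
Qed.

Lemma family_inverse_continuous q : D q -> {for q, continuous G}.
Proof.
move=> Dq; apply: (@cvgrPdist_lt _ _ _ (nbhs q) _ G (G q)).2 => e e0.
by have := family_inverse_near Dq e0; apply: filterS => p; rewrite distrC.
Qed.

Lemma jac_unit q : O q -> space_jac F q \in unitmx.
Proof. by move=> Oq; apply: unitmx_near_id; exact: (inj_dom_jac sF Oq). Qed.

Lemma jac_expand q (v : Rn) : O q -> `|v| <= 2 * `|space_jac F q *m v|.
Proof.
move=> Oq; have := inj_dom_jac sF Oq v.
have := ler_normB (space_jac F q *m v) (space_jac F q *m v - v).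
rewrite opprB addrC subrK.
by move: `|_| => a h1; lra.
Qed.

(** The solution [v] of the linearised equation: the derivative of [F] at [q]
    in direction [(h.1, v)] equals [h.2]. *)
Definition inverse_deriv (q h : R * Rn) : Rn :=
  invmx (space_jac F q) *m (h.2 - h.1 *: time_deriv F q).

Lemma inverse_deriv_linear q : linear (inverse_deriv q).
Proof.
move=> a h k; rewrite /inverse_deriv scalemxAr -mulmxDr; congr (_ *m _).
have -> : (a *: h + k).2 = a *: h.2 + k.2 by [].
have -> : (a *: h + k).1 = a * h.1 + k.1 by [].
by apply/colP => i; rewrite !mxE; ring.
Qed.

Lemma inverse_deriv_smooth q : smooth_on setT (inverse_deriv q).
Proof.
apply: smooth_mul; [exact: openT|exact: smooth_cst|].
apply: smoothB; [exact: openT|exact: (smooth_snd openT)|].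
by apply: smoothZ; [exact: openT|exact: (smooth_fst openT)|exact: smooth_cst].
Qed.

(** The error of the linearised equation is small compared with the
    increment of the inverse, which [jac_expand] bounds in terms of the
    increment of the argument. *)
Lemma family_inverse_diff q : D q -> differentiable G q /\
  'd G q = inverse_deriv (q.1, G q) :> (_ -> _).
Proof.
case: q => t x Dx; have [/= Iy Fy] := family_inverseP Dx.
set p := (t, G (t, x)) in Iy Fy *.
pose LM := GRing.isLinear.Build _ _ _ _ _ (inverse_deriv_linear p).
pose L : {linear _ -> _} := HB.pack (inverse_deriv p) LM.
apply: (@differentiable_of_eps _ _ _ G (t, x) L).
  by move=> h; exact: (smooth_continuous (inverse_deriv_smooth p) (x:=h) I).
move=> e e0.
have dF : differentiable F p := smooth_diff sF (inj_dom_sub Iy).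
set w := time_deriv F p; set M := space_jac F p.
(* [K] bounds the ratio of [`|(s, eta)|] to [`|(s, k)|] below. *)
pose K := 6 + 4 * `|w|; have K0 : 0 < K by rewrite ltr_wpDr // mulr_ge0.
pose e' := Num.min (4^-1) (e / (2 * K)).
have e'0 : 0 < e' by rewrite lt_min invr_gt0 ltr0n divr_gt0 // mulr_gt0.
have e'4 : e' <= 4^-1 by rewrite ge_min lexx.
have e'K : e' * (2 * K) <= e.
  by rewrite -ler_pdivlMr ?mulr_gt0 // ge_min lexx orbT.
have /nbhs_ballP[d /= d0 dP] := diff_eps dF e'0.
have hD : \forall h \near (0 : R * Rn), D (h + (t, x)) /\ `|G (h + (t, x)) - G (t, x)| < d.
  have h1 := family_inverse_near Dx d0.
  have h2 : \forall p \near (t, x), D p.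
    by apply: open_nbhs_nbhs; split => //; exact: inv_dom_open.
  have : \forall p \near (t, x), D p /\ `|G p - G (t, x)| < d.
    by move: h2 h1; apply: filterS2 => p' a b; split.
  by rewrite (near_shift 0) /= subr0.
have hd : \forall h \near (0 : R * Rn), `|h| < d by exact: nbhs0_lt.
move: hD hd; apply: filterS2 => -[s k] [Dh Gh] hsk.
have [/= Ih Fh] := family_inverseP Dh.
set y' := G _ in Gh Ih Fh *.
pose eta := y' - G (t, x).
have sk1 : `|s| <= `|(s, k)| by rewrite prod_normE le_max lexx.
have sk2 : `|k| <= `|(s, k)| by rewrite prod_normE le_max lexx orbT.
have := dP (s, eta); have -> : (s, eta) + p = (s + t, y').
  by apply: injective_projections => //=; rewrite subrK.
rewrite Fh Fy -(deriveE _ dF) (derive_time_space _ _ dF) -/w -/M.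
have sed : ball (0 : R * Rn) d (s, eta).
  split; rewrite -ball_normE /= sub0r normrN //.
  exact: le_lt_trans sk1 hsk.
move=> /(_ sed); rewrite addrK => H.
have se : `|(s, eta)| <= `|s| + `|eta|.
  by rewrite prod_normE ge_max lerDl lerDr !normr_ge0.
have Heta : `|eta| <= 2 * `|M *m eta| := jac_expand _ Iy.
have HL : `|eta - L (s, k)| <= 2 * (e' * `|(s, eta)|).
  apply: le_trans (jac_expand _ Iy) _; rewrite ler_pM2l //.
  apply: le_trans H; rewrite /L /= /inverse_deriv /= mulmxBr mulmxA.
  rewrite mulmxV ?jac_unit // mul1mx -/M -/w.
  have -> : M *m eta - (k - s *: w) = - (k - (s *: w + M *m eta)).
    by apply/colP => i; rewrite !mxE; ring.
  by rewrite normrN.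
have HM : `|M *m eta| <= `|k| + `|s| * `|w| + e' * `|(s, eta)|.
  have -> : M *m eta = k - s *: w - (k - (s *: w + M *m eta)).
    by apply/colP => i; rewrite !mxE; ring.
  apply: le_trans (ler_normB _ _) _; apply: lerD H.
  by apply: le_trans (ler_normB _ _) _; rewrite normrZ.
have E : `|eta| <= (5 + 4 * `|w|) * `|(s, k)|.
  have h1 : e' * `|(s, eta)| <= 4^-1 * (`|s| + `|eta|).
    by apply: ler_pM => //; exact: ltW.
  have h2 : `|s| * `|w| <= `|w| * `|(s, k)| by rewrite mulrC ler_wpM2l.
  rewrite mulrDl -mulrA.
  move: h1 h2 HM Heta sk1 sk2.
  move: `|M *m eta| (`|s| * `|w|) (`|w| * `|(s, k)|) (e' * `|(s, eta)|).
  by move: `|eta| `|s| `|k| `|(s, k)| => a1 a2 a3 a4 a5 a6 a7 a8; lra.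
apply: le_trans HL _; rewrite mulrCA.
apply: le_trans (ler_wpM2r (normr_ge0 _) e'K); rewrite -mulrA ler_pM2l //.
rewrite -mulrA ler_pM2l // /K.
apply: le_trans se _; move: E sk1; rewrite !mulrDl -mulrA.
by move: `|eta| `|s| `|(s, k)| (`|w| * _) => *; lra.
Qed.

(** The differential of the inverse is a smooth function of the time and of
    the inverse itself, so it has the same regularity as the inverse. *)
Lemma family_inverse_smooth : smooth_on D G.
Proof.
elim=> [|m IH]; first by move=> q; exact: family_inverse_continuous.
split=> [q Dq|h]; first by have [] := family_inverse_diff Dq.
pose Psi q := invmx (space_jac F q) *m (h.2 - h.1 *: time_deriv F q).
have oO := @inj_dom_open R n A F.
have sFO : smooth_on O F by apply: smooth_sub sF => q; exact: inj_dom_sub.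
have sPsi : smooth_on O Psi.
  apply: smooth_mul => //.
    apply: smooth_invmx => //; first by move=> q; exact: jac_unit.
    exact: smooth_space_jac.
  apply: smoothB => //; first exact: smooth_cst.
  by apply: smoothZ => //; [exact: smooth_cst|exact: smooth_derive].
have CG : Ck m D (Psi \o (fun q => (q.1, G q))).
  apply: (@Ck_comp _ _ _ _ _ _ O _ _ _ inv_dom_open) (sPsi m).
  - exact: frame_prod (@frame_real R) (@frame_mx R n 1).
  - by move=> q /family_inverseP[].
  - apply: Ck_pair => //; [exact: inv_dom_open| exact: (smooth_fst inv_dom_open)].
apply: (eq_Ck inv_dom_open _ CG) => q Dq /=.
by have [dG dGE] := family_inverse_diff Dq; rewrite (deriveE _ dG) dGE.
Qed.

End SmoothInverse.

(** * Linear algebra of a Lagrangian graph *)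

Section LagrangianAlgebra.
Context {R : realType} {n : nat}.
Variables (Ax Ap Bx Bp Sg K : 'M[R]_n).
Hypotheses (orth : Ax *m Bp^T = Ap *m Bx^T) (symS : Sg^T = Sg)
  (KM : K *m (Ax + Ap *m Sg) = Bx + Bp *m Sg).

Let V := Bp - K *m Ap.

(** The rows of [(Bx, Bp) - K (Ax, Ap)] annihilate the tangent space of the
    graph, the image of [(1, Sg)]. *)
Lemma lagrangian_covector : Bx - K *m Ax = - (V *m Sg).
Proof.
move: KM; rewrite mulmxDr mulmxA /V mulmxBl.
move: (K *m Ax) (Bp *m Sg) (K *m Ap *m Sg) => a b c E.
have -> : Bx = a + c - b by rewrite E addrK.
by apply/matrixP => i j; rewrite !mxE; ring.
Qed.

(** With [K] the differential of the map from source to target induced by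
    the graph, [V] maps the momentum part of the velocity of the graph to the
    velocity of the target at a fixed source. *)
Lemma lagrangian_flow : V *m (Bx + Bp *m Sg)^T = Bp *m Bx^T - Bx *m Bp^T.
Proof.
rewrite linearD /= trmx_mul symS mulmxDr mulmxA.
have -> : V *m Sg = - (Bx - K *m Ax) by rewrite lagrangian_covector opprK.
rewrite mulNmx /V !mulmxBl -(mulmxA K Ax) orth mulmxA.
move: (Bp *m Bx^T) (K *m Ap *m Bx^T) (Bx *m Bp^T) => a b c.
by apply/matrixP => i j; rewrite !mxE; ring.
Qed.

(** The annihilator of a Lagrangian subspace is isotropic.  The left-hand
    side of the identity [C J C^T = 0], for [C = (Bx, Bp) - K (Ax, Ap)] and
    [J] the symplectic matrix, loses its mixed terms by [orth]. *)
Lemma lagrangian_poisson :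
  K *m (Ax *m Ap^T - Ap *m Ax^T) *m K^T = - (Bx *m Bp^T - Bp *m Bx^T).
Proof.
have orthT : Bp *m Ax^T = Bx *m Ap^T.
  by rewrite -[LHS]trmxK trmx_mul trmxK orth trmx_mul trmxK.
have : (Bx - K *m Ax) *m V^T - V *m (Bx - K *m Ax)^T = 0.
  rewrite lagrangian_covector linearN /= trmx_mul symS mulmxN mulNmx mulmxA.
  by rewrite opprK addNr.
have tr (X Y : 'M[R]_n) : (X - K *m Y)^T = X^T - Y^T *m K^T.
  by rewrite linearB /= trmx_mul.
have ex (X Y X' Y' : 'M[R]_n) : (X - K *m Y) *m (X'^T - Y'^T *m K^T) =
    X *m X'^T - X *m Y'^T *m K^T - (K *m (Y *m X'^T) - K *m (Y *m Y'^T) *m K^T).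
  by rewrite mulmxBl !mulmxBr !mulmxA.
rewrite /V !tr !ex orthT orth mulmxBr mulmxBl.
move: (Bx *m Bp^T) (Bp *m Bx^T) (Bx *m Ap^T *m K^T) (K *m (Ap *m Bx^T)).
move: (K *m (Ax *m Ap^T) *m K^T) (K *m (Ap *m Ax^T) *m K^T) => a b c d e f E.
apply/eqP; rewrite -subr_eq0; apply/eqP; rewrite -[RHS]E.
by apply/matrixP => i j; rewrite !mxE; ring.
Qed.

End LagrangianAlgebra.

(** * Jacobians on phase space and the symplectic bracket *)

Section PhaseJacobians.
Context {R : realType} {n : nat}.
Local Notation Rn := 'cV[R]_n.

Definition jac_x (f : Rn * Rn -> Rn) (w : Rn * Rn) : 'M[R]_n :=
  \matrix_(i, j) ('D_((basis_vec j, 0) : Rn * Rn) f w) i 0.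
Definition jac_p (f : Rn * Rn -> Rn) (w : Rn * Rn) : 'M[R]_n :=
  \matrix_(i, j) ('D_((0, basis_vec j) : Rn * Rn) f w) i 0.

Lemma derive_phase (f : Rn * Rn -> Rn) w u v : differentiable f w ->
  'D_((u, v) : Rn * Rn) f w = jac_x f w *m u + jac_p f w *m v.
Proof.
move=> df.
have E : ((u, v) : Rn * Rn) = \sum_i u i 0 *: ((basis_vec i, 0) : Rn * Rn) +
    \sum_i v i 0 *: ((0, basis_vec i) : Rn * Rn).
  apply: injective_projections => /=.
    rewrite !(raddf_sum fst) /= [X in _ + X]big1 ?addr0; first exact: basis_vec_sum.
    by move=> i _; rewrite scaler0.
  rewrite !(raddf_sum snd) /= [X in X + _]big1 ?add0r; first exact: basis_vec_sum.
  by move=> i _; rewrite scaler0.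
rewrite E (deriveE _ df) linearD !linear_sum.
congr (_ + _); apply/colP => i; rewrite summxE !mxE; apply: eq_bigr => j _.
  by rewrite linearZ !mxE (deriveE _ df) mulrC.
by rewrite linearZ !mxE (deriveE _ df) mulrC.
Qed.

Definition coordf (i : 'I_n) (x : Rn) : R := x i 0.

Lemma smooth_coordf (U : set Rn) i : open U -> smooth_on U (coordf i).
Proof. by move=> oU; apply: smooth_entry => //; exact: smooth_id. Qed.

Lemma grad_coordf i x : grad (coordf i) x = basis_vec i.
Proof.
apply/colP => j; rewrite mxE.
have -> : 'D_(basis_vec j) (coordf i) x = coordf i (basis_vec j).
  by apply: (@derive_lin _ _ _ (mx_entry i 0)); exact: continuous_mx_entry.
by rewrite /coordf !mxE eq_sym.
Qed.

Lemma pbracket_coordf (pi : Rn -> 'M[R]_n) i j x :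
  pbracket pi (coordf i) (coordf j) x = pi x i j.
Proof.
rewrite /pbracket !grad_coordf /basis_vec trmx_delta -mulmxA -rowE mxE.
by rewrite -colE mxE.
Qed.

Lemma obracket_coordf (f g : Rn * Rn -> Rn) i j w :
  differentiable f w -> differentiable g w ->
  obracket (coordf i \o f) (coordf j \o g) w =
  (jac_x f w *m (jac_p g w)^T - jac_p f w *m (jac_x g w)^T) i j.
Proof.
move=> df dg.
have jx f' i' l : differentiable f' w ->
    'D_((basis_vec l, 0) : Rn * Rn) (coordf i' \o f') w = jac_x f' w i' l.
  by move=> df'; rewrite mxE; rewrite (derive_entry _ _ _ df').
have jp f' i' l : differentiable f' w ->
    'D_((0, basis_vec l) : Rn * Rn) (coordf i' \o f') w = jac_p f' w i' l.
  by move=> df'; rewrite mxE; rewrite (derive_entry _ _ _ df').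
move: (jac_x f w) (jx f i ^~ df) (jac_p f w) (jp f i ^~ df) => Jxf E1 Jpf E2.
move: (jac_x g w) (jx g j ^~ dg) (jac_p g w) (jp g j ^~ dg) => Jxg E3 Jpg E4.
rewrite !mxE /obracket -sumrB; apply: eq_bigr => l _.
by rewrite E1 E2 E3 E4 !mxE.
Qed.

End PhaseJacobians.

(** * The graph of the differential of a generating function *)

Section SpaceGradient.
Context {R : realType} {n : nat}.
Local Notation Rn := 'cV[R]_n.

Lemma open_preimage_on (V W : normedModType R) (T : set V) (B : set W) (f : V -> W) :
  open T -> open B -> (forall x, T x -> {for x, continuous f}) ->
  open [set x | T x /\ B (f x)].
Proof.
move=> oT oB cf; rewrite openE => x [Tx Bx].
have h1 : \forall y \near x, T y by exact: open_nbhs_nbhs.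
have h2 : \forall y \near x, B (f y) by apply: (cf x Tx); exact: open_nbhs_nbhs.
by apply: filterS2 h1 h2 => y a b; split.
Qed.

Definition tube (U : set Rn) : set (R * Rn) := [set q | U q.2].

Lemma tube_open U : open U -> open (tube U).
Proof.
move=> oU; rewrite openE => -[t x] Ux.
apply: (@near_snd _ _ t x U); exact: open_nbhs_nbhs.
Qed.

Definition grad_space (f : R * Rn -> R) (q : R * Rn) : Rn :=
  \col_i 'D_((0, basis_vec i) : R * Rn) f q.

Lemma grad_spaceE (f : R * Rn -> R) t x :
  grad_space f (t, x) = grad (fun y => f (t, y)) x.
Proof. by apply/colP => i; rewrite !mxE derive_space. Qed.

Lemma smooth_grad_space (A : set (R * Rn)) f : open A ->
  smooth_on A f -> smooth_on A (grad_space f).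
Proof.
move=> oA sf; apply: smooth_mx => // i j.
have : smooth_on A ('D_((0, basis_vec i) : R * Rn) f) by exact: smooth_derive.
by apply: eq_smooth => // x _; rewrite mxE.
Qed.

Lemma derive_space_grad (f : R * Rn -> R) q v : differentiable f q ->
  'D_((0, v) : R * Rn) f q = ((grad_space f q)^T *m v) 0 0.
Proof.
move=> df; rewrite (deriveE _ df) -[((0, v) : R * Rn)]/(space_dir v).
rewrite {1}(basis_vec_sum v) !linear_sum !mxE; apply: eq_bigr => i _.
by rewrite !linearZ !mxE (deriveE _ df) mulrC.
Qed.

(** This symmetry makes the graph of [grad_space f] Lagrangian at each time. *)
Lemma space_hessian_sym (A : set (R * Rn)) f q : open A ->
  smooth_on A f -> A q -> (space_jac (grad_space f) q)^T = space_jac (grad_space f) q.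
Proof.
move=> oA sf Aq; have sg := smooth_grad_space oA sf.
have E i j : space_jac (grad_space f) q i j =
    'D_((0, basis_vec j) : R * Rn) ('D_((0, basis_vec i) : R * Rn) f) q.
  rewrite mxE (derive_entry _ _ _ (smooth_diff sg Aq)).
  suff -> : (fun q => grad_space f q i 0) = 'D_((0, basis_vec i) : R * Rn) f by [].
  by apply/funext => x; rewrite mxE.
apply/matrixP => i j; rewrite mxE !E.
exact (derive_commute _ _ oA Aq (sf 2%N)).
Qed.

Lemma time_grad_space (A : set (R * Rn)) f q : open A ->
  smooth_on A f -> A q -> time_deriv (grad_space f) q = grad_space (time_deriv f) q.
Proof.
move=> oA sf Aq; have sg := smooth_grad_space oA sf.
apply/colP => i; rewrite [RHS]mxE (derive_entry _ _ _ (smooth_diff sg Aq)).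
have -> : (fun q => grad_space f q i 0) = 'D_((0, basis_vec i) : R * Rn) f.
  by apply/funext => x; rewrite mxE.
exact (derive_commute _ _ oA Aq (sf 2%N)).
Qed.

End SpaceGradient.

Section GeneratingFunction.
Context {R : realType} {n : nat}.
Local Notation Rn := 'cV[R]_n.
Variables (U : set Rn) (W : set (Rn * Rn)) (sigma : R * Rn -> R).
Hypotheses (oU : open U) (oW : open W) (ss : smooth_on (tube U) sigma).

(** At a fixed time, a parametrisation of the graph of the differential of
    [sigma]. *)
Definition phase_lift (q : R * Rn) : Rn * Rn := (q.2, grad_space sigma q).

Definition phase_dom : set (R * Rn) := [set q | U q.2 /\ W (phase_lift q)].

Let oT : open (tube U) := tube_open oU.

Lemma smooth_phase_lift : smooth_on (tube U) phase_lift.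
Proof. by apply: smooth_pair => //; [exact: smooth_snd|exact: smooth_grad_space]. Qed.

Lemma phase_dom_open : open phase_dom.
Proof.
apply: (open_preimage_on (f := phase_lift) oT oW) => q Tq.
exact: smooth_continuous smooth_phase_lift Tq.
Qed.

Lemma phase_dom_tube q : phase_dom q -> tube U q.
Proof. by case. Qed.

Lemma smooth_lifted (Z : normedModType R) (a : Rn * Rn -> Z) :
  smooth_on W a -> smooth_on phase_dom (a \o phase_lift).
Proof.
move=> sa; apply: (smooth_comp (B := W)) => //.
- exact: frame_prod (@frame_mx R n 1) (@frame_mx R n 1).
- exact: phase_dom_open.
- by move=> q [].
- by apply: smooth_sub smooth_phase_lift => q; exact: phase_dom_tube.
Qed.

Lemma derive_lifted (a : Rn * Rn -> Rn) q s v : smooth_on W a -> phase_dom q ->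
  'D_((s, v) : R * Rn) (a \o phase_lift) q =
  jac_x a (phase_lift q) *m v + jac_p a (phase_lift q) *m
    (s *: grad_space (time_deriv sigma) q + space_jac (grad_space sigma) q *m v).
Proof.
move=> sa Lq; have Tq := phase_dom_tube Lq.
have da : differentiable a (phase_lift q) by apply: smooth_diff sa _; case: Lq.
have dg := smooth_diff (smooth_grad_space oT ss) Tq.
have dl := smooth_diff smooth_phase_lift Tq.
rewrite (derive_comp _ dl da).
have -> : 'D_((s, v) : R * Rn) phase_lift q = (v, 'D_((s, v) : R * Rn) (grad_space sigma) q).
  rewrite derive_pair //; last by apply: (@linear_differentiable _ _ _ snd) => x; exact: cvg_snd.
  by congr pair; apply: (@derive_lin _ _ _ snd) => x; exact: cvg_snd.
rewrite (derive_phase _ _ da) (derive_time_space _ _ dg).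
by rewrite (time_grad_space oT ss Tq).
Qed.

Lemma space_jac_lifted (a : Rn * Rn -> Rn) q : smooth_on W a -> phase_dom q ->
  space_jac (a \o phase_lift) q =
  jac_x a (phase_lift q) + jac_p a (phase_lift q) *m space_jac (grad_space sigma) q.
Proof.
move=> sa Lq; apply/matrixP => i j; rewrite [LHS]mxE.
rewrite (derive_lifted 0 (basis_vec j) sa Lq).
move: (jac_x _ _) (jac_p _ _) (space_jac _ _) (grad_space _ _) => X P S g.
by rewrite scale0r add0r mulmxA -mulmxDl /basis_vec -colE mxE.
Qed.

Lemma time_deriv_lifted (a : Rn * Rn -> Rn) q : smooth_on W a -> phase_dom q ->
  time_deriv (a \o phase_lift) q = jac_p a (phase_lift q) *m grad_space (time_deriv sigma) q.
Proof.
move=> sa Lq; rewrite {1}/time_deriv (derive_lifted 1 0 sa Lq).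
move: (jac_x _ _) (jac_p _ _) (space_jac _ _) (grad_space _ _) => X P S g.
by rewrite !mulmx0 addr0 add0r scale1r.
Qed.

End GeneratingFunction.

(** * The flow carried by a family of Lagrangian graphs *)

Section LagrangianFlow.
Context {R : realType} {n : nat}.
Local Notation Rn := 'cV[R]_n.
Variables (U : set Rn) (W : set (Rn * Rn)) (sigma : R * Rn -> R).
Hypotheses (oU : open U) (oW : open W) (ss : smooth_on (tube U) sigma).
Variables (a b : Rn * Rn -> Rn).
Hypotheses (sa : smooth_on W a) (sb : smooth_on W b)
  (orth : forall w, W w -> jac_x a w *m (jac_p b w)^T = jac_p a w *m (jac_x b w)^T).

Local Notation L := (phase_dom U W sigma).
Local Notation Fa := (a \o phase_lift sigma).
Local Notation Fb := (b \o phase_lift sigma).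

Local Notation Oa := (inj_dom L Fa).
Local Notation Da := (inv_dom L Fa).
Local Notation Ya := (family_inverse L Fa).
Local Notation Ob := (inj_dom L Fb).
Local Notation Db := (inv_dom L Fb).
Local Notation Yb := (family_inverse L Fb).

Let oL : open L := phase_dom_open oU oW ss.
Let sFa : smooth_on L Fa := smooth_lifted oU oW ss sa.
Let sFb : smooth_on L Fb := smooth_lifted oU oW ss sb.

(** The correspondence between the images under [a] and under [b] of the
    points of the graph of the differential of [sigma]. *)
Definition gen_flow (q : R * Rn) : Rn := Fb (q.1, Ya q).
(** The Hamiltonian of the Hamilton-Jacobi equation: the time derivative of
    the generating function, seen as a function of the image under [c]. *)
Definition gen_ham (c : Rn * Rn -> Rn) (q : R * Rn) : R :=
  time_deriv sigma (q.1, family_inverse L (c \o phase_lift sigma) q).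

Lemma smooth_graph_inverse (c : Rn * Rn -> Rn) : smooth_on W c ->
  smooth_on (inv_dom L (c \o phase_lift sigma))
    (fun q => (q.1, family_inverse L (c \o phase_lift sigma) q)).
Proof.
move=> sc; have oD := inv_dom_open (smooth_lifted oU oW ss sc).
by apply: smooth_pair => //; [exact: smooth_fst|exact: (family_inverse_smooth (smooth_lifted oU oW ss sc))].
Qed.

Lemma frame_time_space : has_frame (R * Rn : normedModType R)%type.
Proof. exact: frame_prod (@frame_real R) (@frame_mx R n 1). Qed.

Lemma smooth_gen_flow : smooth_on Da gen_flow.
Proof.
apply: (smooth_comp (B := L) frame_time_space (inv_dom_open sFa)) (smooth_graph_inverse sa) sFb.
by move=> q Dq; have [/inj_dom_sub] := family_inverseP Dq.
Qed.

Lemma smooth_gen_ham (c : Rn * Rn -> Rn) : smooth_on W c ->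
  smooth_on (inv_dom L (c \o phase_lift sigma)) (gen_ham c).
Proof.
move=> sc; have sFc := smooth_lifted oU oW ss sc.
apply: (smooth_comp (B := tube U) frame_time_space (inv_dom_open sFc))
  (smooth_graph_inverse sc) (smooth_derive _ ss).
by move=> q Dq; have [/inj_dom_sub[]] := family_inverseP Dq.
Qed.

Section AtPoint.
Variable q : R * Rn.
Hypothesis Dq : Da q.
Let y := (q.1, Ya q).
Let w := phase_lift sigma y.
Let M := space_jac Fa y.
Let N := space_jac Fb y.
Let K := N *m invmx M.

Let Oy : Oa y := (family_inverseP Dq).1.
Let Ly : L y := inj_dom_sub Oy.

Lemma derive_gen_flow (s : R) v :
  'D_((s, v) : R * Rn) gen_flow q =
  s *: (time_deriv Fb y - K *m time_deriv Fa y) + K *m v.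
Proof.
have [dY YE] := family_inverse_diff sFa Dq.
have dFb := smooth_diff sFb Ly.
have dfst : differentiable (@fst R Rn) q.
  by apply: (@linear_differentiable _ _ _ fst) => x; exact: cvg_fst.
have dG : differentiable (fun q => (q.1, Ya q)) q by exact: differentiable_pair.
rewrite (@derive_comp _ _ _ _ (fun q => (q.1, Ya q)) Fb q (s, v) dG dFb).
rewrite (derive_pair _ dfst dY) (deriveE _ dY) YE /inverse_deriv /=.
have -> : 'D_((s, v) : R * Rn) (@fst R Rn) q = s.
  by apply: (@derive_lin _ _ _ fst) => x; exact: cvg_fst.
rewrite (derive_time_space _ _ dFb) -/y -/N -/M mulmxA -/K.
move: (time_deriv Fa y) (time_deriv Fb y) => u u'.
rewrite mulmxBr scalerBr -scalemxAr.
by rewrite addrA addrAC.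
Qed.

Lemma space_jac_gen_flow : space_jac gen_flow q = K.
Proof.
apply/matrixP => i j; rewrite [LHS]mxE (derive_gen_flow 0 (basis_vec j)).
by move: K => K'; rewrite scale0r add0r /basis_vec -colE mxE.
Qed.

Lemma time_deriv_gen_flow :
  time_deriv gen_flow q = time_deriv Fb y - K *m time_deriv Fa y.
Proof.
rewrite {1}/time_deriv (derive_gen_flow 1 0).
by move: (time_deriv Fa y) (time_deriv Fb y) => u u'; rewrite scale1r mulmx0 addr0.
Qed.

Let Sg := space_jac (grad_space sigma) y.

Let symS : Sg^T = Sg.
Proof. exact: (space_hessian_sym (tube_open oU) ss (phase_dom_tube Ly)). Qed.

Let KM : K *m (jac_x a w + jac_p a w *m Sg) = jac_x b w + jac_p b w *m Sg.
Proof.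
rewrite -(space_jac_lifted oU ss sa Ly) -(space_jac_lifted oU ss sb Ly).
by rewrite /K -mulmxA mulVmx ?mulmx1 //; exact: (jac_unit sFa Oy).
Qed.

Lemma gen_flow_poisson :
  let J := space_jac gen_flow q in
  J *m (jac_x a w *m (jac_p a w)^T - jac_p a w *m (jac_x a w)^T) *m J^T =
  - (jac_x b w *m (jac_p b w)^T - jac_p b w *m (jac_x b w)^T).
Proof.
rewrite /= space_jac_gen_flow.
apply: (lagrangian_poisson _ symS KM); apply: orth; exact: Ly.2.
Qed.

Hypothesis Oby : Ob y.

Lemma grad_gen_ham :
  grad_space (time_deriv sigma) y = N^T *m grad_space (gen_ham b) (q.1, gen_flow q).
Proof.
have dFb := smooth_diff sFb Ly.
have sh := smooth_gen_ham sb.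
have Dz : Db (q.1, gen_flow q) := inv_dom_image Oby.
have dh := smooth_diff sh Dz.
have dfst : differentiable (@fst R Rn) y.
  by apply: (@linear_differentiable _ _ _ fst) => x; exact: cvg_fst.
have dG : differentiable (fun p : R * Rn => (p.1, Fb p)) y by exact: differentiable_pair.
have near_h : \forall p \near y, time_deriv sigma p = gen_ham b (p.1, Fb p).
  apply: near_open (@inj_dom_open R n L Fb) Oby _ => -[t z] Otz.
  by rewrite /gen_ham (family_inverseK Otz).
apply/colP => j; rewrite [LHS]mxE (near_eq_derive _ near_h).
rewrite (@derive_comp _ _ _ _ (fun p : R * Rn => (p.1, Fb p)) (gen_ham b) y _ dG dh).
rewrite (derive_pair _ dfst dFb) (space_jacE _ dFb) -/N.
have -> : 'D_((0, basis_vec j) : R * Rn) (@fst R Rn) y = 0.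
  by apply: (@derive_lin _ _ _ fst) => x; exact: cvg_fst.
rewrite (derive_space_grad _ dh) /=.
move: (grad_space _ _) N => g N'.
rewrite mulmxA /basis_vec -colE mxE -[g^T *m N']trmxK trmx_mul trmxK.
by rewrite mxE.
Qed.

(** Up to sign, the graph moves along the Hamiltonian field of
    [gen_ham b \o b] on phase space.  This field preserves [a], by
    orthogonality, and [b] projects it onto the field of [gen_ham b]. *)
Lemma gen_flow_time :
  time_deriv gen_flow q =
  (jac_p b w *m (jac_x b w)^T - jac_x b w *m (jac_p b w)^T) *m
    grad_space (gen_ham b) (q.1, gen_flow q).
Proof.
rewrite time_deriv_gen_flow (time_deriv_lifted oU ss sb Ly).
rewrite (time_deriv_lifted oU ss sa Ly) mulmxA -mulmxBl grad_gen_ham mulmxA.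
congr (_ *m _); rewrite /N (space_jac_lifted oU ss sb Ly) -/w -/Sg.
apply: (lagrangian_flow _ symS KM); apply: orth; exact: Ly.2.
Qed.

End AtPoint.
End LagrangianFlow.

(** * The generating series and the Hamilton-Jacobi equation *)

Section TimeDerivatives.
Context {R : realType}.
Implicit Types V W : normedModType R.

Lemma lipschitz_near_real V (A : set V) (f : V -> R) x :
  has_frame V -> open A -> A x -> smooth_on A f ->
  exists2 L, 0 < L & exists2 d, 0 < d & forall y z, ball x d y -> ball x d z ->
    `|f y - f z| <= L * `|y - z|.
Proof.
move=> fV oA Ax sf.
pose g y : 'M[R]_1 := const_mx (f y).
have sg : smooth_on A g.
  by apply: smooth_mx => // i j; apply: eq_smooth sf => // y _; rewrite mxE.
have [L L0 [d d0 H]] := lipschitz_near fV oA Ax (sg 1%N).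
exists L => //; exists d => // y z By Bz.
have := H y z By Bz; apply: le_trans.
have -> : f y - f z = (g y - g z) 0 0 by rewrite !mxE.
exact: mx_entry_le.
Qed.

Lemma differentiable_bigsum V W I (r : seq I) (f : I -> V -> W) x :
  (forall i, differentiable (f i) x) ->
  differentiable (fun y => \sum_(i <- r) f i y) x.
Proof.
move=> df; elim: r => [|i r IH].
  have -> : (fun y => \sum_(i <- [::]) f i y) = cst 0.
    by apply/funext => y; rewrite big_nil.
  exact: differentiable_cst.
have -> : (fun y => \sum_(j <- i :: r) f j y) = (fun y => f i y + \sum_(j <- r) f j y).
  by apply/funext => y; rewrite big_cons.
exact: differentiableD.
Qed.

Lemma derive_bigsum V W I (r : seq I) (f : I -> V -> W) x v :
  (forall i, differentiable (f i) x) ->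
  'D_v (fun y => \sum_(i <- r) f i y) x = \sum_(i <- r) 'D_v (f i) x.
Proof.
move=> df; elim: r => [|i r IH].
  have -> : (fun y => \sum_(i <- [::]) f i y) = cst 0.
    by apply/funext => y; rewrite big_nil.
  by rewrite derive_cst big_nil.
have -> : (fun y => \sum_(j <- i :: r) f j y) = (fun y => f i y + \sum_(j <- r) f j y).
  by apply/funext => y; rewrite big_cons.
by rewrite deriveD_fun ?IH ?big_cons //; exact: differentiable_bigsum.
Qed.

(** This turns the one-variable derivatives of the recursion for the
    generating functions into iterated partial derivatives. *)
Lemma derive1n_time V W (f : R * V -> W) x i (t : R) :
  derive1n i (fun s : R => f (s, x)) t = iter i (@time_deriv R V W) f (t, x).
Proof.
elim: i t => [//|i IH] t; rewrite derive1nS derive1E.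
have -> : derive1n i (fun s : R => f (s, x)) =
    (fun s : R => iter i (@time_deriv R V W) f (s, x)) by apply/funext.
exact: (esym (derive_time _ _ _)).
Qed.

Lemma iter_time_derivB V (A : set (R * V)) (f g : R * V -> R) i q : open A ->
  smooth_on A f -> smooth_on A g -> A q ->
  iter i (@time_deriv R V R) (fun q => f q - g q) q =
  iter i (@time_deriv R V R) f q - iter i (@time_deriv R V R) g q.
Proof.
move=> oA sf sg; elim: i q => [//|i IH] q Aq /=.
rewrite {1}/time_deriv (near_eq_derive _ (near_open oA Aq IH)).
have df := smooth_diff (iter_time_deriv_smooth i sf) Aq.
have dg := smooth_diff (iter_time_deriv_smooth i sg) Aq.
exact: (deriveB (diff_derivable df) (diff_derivable dg)).
Qed.

End TimeDerivatives.

Section GeneratingSeries.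
Context {R : realType} {n : nat}.
Local Notation Rn := 'cV[R]_n.
Variables (k : nat) (U : set Rn) (W : set (Rn * Rn)) (alpha : Rn * Rn -> Rn)
  (H : Rn -> R) (S : nat -> Rn -> R).
Hypotheses (oU : open U) (oW : open W) (W0 : forall x, U x -> W (x, 0))
  (sH : smooth_on U H) (sa : smooth_on W alpha) (aU : forall w, W w -> U (alpha w))
  (a0 : forall x, U x -> alpha (x, 0) = x)
  (genS : generating_sequence k U alpha H S).

Definition gen_series i (q : R * Rn) : R := partial_S S i q.1 q.2.

Lemma gen_seriesE i q :
  gen_series i q = \sum_(j < i) q.1 ^+ j.+1 / j.+1`!%:R * S j.+1 q.2.
Proof. by rewrite /gen_series /partial_S big_add1 /= big_mkord. Qed.

Lemma smooth_gen_series i : (forall j, (j < i)%N -> smooth_on U (S j.+1)) ->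
  smooth_on (tube U) (gen_series i).
Proof.
move=> sS; have oT := tube_open oU.
have sg : smooth_on (tube U)
    (fun q : R * Rn => \sum_(j < i) q.1 ^+ j.+1 / j.+1`!%:R * S j.+1 q.2).
  apply: smooth_sum => // j _; apply: smoothM => //.
    apply: smoothM => //; last exact: smooth_cst.
    move=> m.
    have := @Ck_prod R (R * Rn)%type m (tube U) _ (index_iota 0 j.+1) (fun=> fst) oT
      (fun=> smooth_fst oT m).
    by apply: (eq_Ck oT) => q _; rewrite prodr_const_nat subn0.
  apply: (smooth_comp (B := U) (@frame_mx R n 1) oT _ (smooth_snd oT) (sS j _)) => //.
by apply: (eq_smooth oT _ sg) => q _; rewrite gen_seriesE.
Qed.

Lemma gen_series0 i x : gen_series i (0, x) = 0.
Proof. by rewrite gen_seriesE big1 // => j _; rewrite expr0n !mul0r. Qed.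

Lemma phase_lift_gen_series0 i x : phase_lift (gen_series i) (0, x) = (x, 0).
Proof.
rewrite /phase_lift /=; congr pair; apply/colP => j; rewrite !mxE derive_space.
have -> : (fun y => gen_series i (0, y)) = cst 0.
  by apply/funext => y; rewrite gen_series0.
by rewrite derive_cst.
Qed.

Lemma phase_dom_gen_series0 i x : U x -> phase_dom U W (gen_series i) (0, x).
Proof. by move=> Ux; split => //; rewrite phase_lift_gen_series0; exact: W0. Qed.

Lemma smooth_H_alpha : smooth_on W (H \o alpha).
Proof. exact: smooth_comp (@frame_mx R n 1) oW aU sa sH. Qed.

Definition pulled_H i : R * Rn -> R := (H \o alpha) \o phase_lift (gen_series i).

Lemma smooth_pulled_H i : (forall j, (j < i)%N -> smooth_on U (S j.+1)) ->
  smooth_on (phase_dom U W (gen_series i)) (pulled_H i).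
Proof.
move=> sS.
exact: (smooth_lifted oU oW (smooth_gen_series sS) smooth_H_alpha).
Qed.

(** The case [i = 0] is the initial condition of the recursion, since
    [alpha] is the identity on the zero section. *)
Lemma gen_sequence_deriv i x : (i < k)%N -> U x ->
  S i.+1 x = iter i (@time_deriv R Rn R) (pulled_H i) (0, x).
Proof.
move=> ik Ux; case: i ik => [_|i ik].
  by rewrite (genS.1 x Ux) /= /pulled_H /= phase_lift_gen_series0 a0.
rewrite (genS.2 i.+1 ik x Ux).
have -> : (fun t : R => H (alpha (dgraph (partial_S S i.+1 t) x))) =
    (fun t : R => pulled_H i.+1 (t, x)).
  by apply/funext => t; rewrite /pulled_H /= /phase_lift /dgraph /= grad_spaceE.
exact: derive1n_time.
Qed.

Lemma smooth_gen_sequence i : (i < k)%N -> smooth_on U (S i.+1).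
Proof.
elim/ltn_ind: i => i IH ik.
have sS j : (j < i)%N -> smooth_on U (S j.+1).
  by move=> ji; apply: IH => //; exact: ltn_trans ik.
have sf := iter_time_deriv_smooth i (smooth_pulled_H sS).
have s0 : smooth_on U (fun x : Rn => ((0 : R), x)).
  by apply: smooth_pair => //; [exact: smooth_cst|exact: smooth_id].
have := smooth_comp (@frame_time_space R n) oU (@phase_dom_gen_series0 i) s0 sf.
by apply: (eq_smooth oU) => x Ux; rewrite gen_sequence_deriv.
Qed.

End GeneratingSeries.

Section HamiltonJacobi.
Context {R : realType} {n : nat}.
Local Notation Rn := 'cV[R]_n.
Variables (k : nat) (U : set Rn) (W : set (Rn * Rn)) (alpha : Rn * Rn -> Rn)
  (H : Rn -> R) (S : nat -> Rn -> R).
Hypotheses (oU : open U) (oW : open W) (W0 : forall x, U x -> W (x, 0))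
  (sH : smooth_on U H) (sa : smooth_on W alpha) (aU : forall w, W w -> U (alpha w))
  (a0 : forall x, U x -> alpha (x, 0) = x)
  (genS : generating_sequence k U alpha H S).

Let sS := smooth_gen_sequence oU oW W0 sH sa aU a0 genS.

Lemma smooth_gen_series_le i : (i <= k)%N -> smooth_on (tube U) (gen_series S i).
Proof.
by move=> ik; apply: smooth_gen_series => // j ji; apply: sS; exact: leq_trans ik.
Qed.

Lemma grad_gen_series i q : (i <= k)%N -> U q.2 ->
  grad_space (gen_series S i) q =
  \sum_(j < i) (q.1 ^+ j.+1 / j.+1`!%:R) *: grad (S j.+1) q.2.
Proof.
case: q => t x ik /= Ux; rewrite grad_spaceE; apply/colP => l.
rewrite summxE mxE.
have -> : (fun y => gen_series S i (t, y)) =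
    (fun y => \sum_(j < i) (t ^+ j.+1 / j.+1`!%:R) *: (S j.+1 y : R)).
  by apply/funext => y; rewrite gen_seriesE.
have dS (j : 'I_i) : differentiable (S j.+1) x.
  by apply: smooth_diff Ux; apply: sS; exact: leq_trans ik.
rewrite derive_bigsum; last by move=> j; exact: differentiableZ.
apply: eq_bigr => j _; rewrite !mxE.
exact: (deriveZ _ (diff_derivable (dS j))).
Qed.

Lemma scheme_point_phase_lift h y : U y ->
  scheme_point k S h y = phase_lift (gen_series S k) (h, y).
Proof.
move=> Uy; rewrite /scheme_point /phase_lift grad_gen_series //=.
by rewrite big_add1 /= big_mkord.
Qed.

Lemma time_deriv_gen_series q : U q.2 ->
  time_deriv (gen_series S k) q = \sum_(i < k) q.1 ^+ i / i`!%:R * S i.+1 q.2.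
Proof.
case: q => t x /= Ux; rewrite derive_time.
(* The series has no constant term, whatever [S 0] is. *)
pose c i := if i is j.+1 then S i x else 0.
have -> : (fun s : R => gen_series S k (s, x)) =
    (fun s : R => \sum_(i < k.+1) s ^+ i / i`!%:R * c i).
  by apply/funext => s; rewrite gen_seriesE big_ord_recl /= mulr0 add0r.
by have [_ ->] := is_derive_taylor k c t.
Qed.

(** The failure of the generating series to solve the Hamilton-Jacobi
    equation [d sigma / dt = H (alpha (d sigma))]. *)
Definition hj_defect (q : R * Rn) : R :=
  time_deriv (gen_series S k) q - pulled_H alpha H S k q.

Lemma phase_lift_gen_series_close i x : (i <= k)%N -> U x ->
  exists2 C, 0 <= C & forall t, 0 <= t <= 1 ->
    `|phase_lift (gen_series S k) (t, x) - phase_lift (gen_series S i) (t, x)| <= C * t ^+ i.+1.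
Proof.
move=> ik Ux; exists (\sum_(j < k) `|grad (S j.+1) x|); first exact: sumr_ge0.
move=> t /andP[t0 t1].
have -> : phase_lift (gen_series S k) (t, x) - phase_lift (gen_series S i) (t, x) =
    (0, grad_space (gen_series S k) (t, x) - grad_space (gen_series S i) (t, x)).
  by apply: injective_projections => //=; rewrite subrr.
rewrite prod_normE /= normr0 max_r //.
rewrite !grad_gen_series //=.
have -> : \sum_(j < k) (t ^+ j.+1 / j.+1`!%:R) *: grad (S j.+1) x -
    \sum_(j < i) (t ^+ j.+1 / j.+1`!%:R) *: grad (S j.+1) x =
    \sum_(j < k | (i <= j)%N) (t ^+ j.+1 / j.+1`!%:R) *: grad (S j.+1) x.
  rewrite (big_ord_widen _ (fun j => (t ^+ j.+1 / j.+1`!%:R) *: grad (S j.+1) x) ik).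
  rewrite [X in X - _](bigID (fun j : 'I_k => (j < i)%N)) /= addrAC.
  by rewrite subrr add0r; apply: eq_bigl => j; rewrite -leqNgt.
apply: (le_trans (ler_norm_sum _ _ _)); rewrite mulr_suml.
rewrite [leRHS](bigID (fun j : 'I_k => (i <= j)%N)) /=.
apply: (@le_trans _ _ (\sum_(j < k | (i <= j)%N) `|grad (S j.+1) x| * t ^+ i.+1)).
  apply: ler_sum => j ij; rewrite normrZ mulrC ler_wpM2l //.
  have f1 : 1 <= (j.+1`!%:R : R) by rewrite ler1n fact_gt0.
  rewrite ger0_norm ?divr_ge0 ?exprn_ge0 //.
  rewrite ler_pdivrMr ?(lt_le_trans ltr01) //.
  apply: (@le_trans _ _ (t ^+ i.+1)); first by rewrite ler_wiXn2l.
  by rewrite ler_peMr // exprn_ge0.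
by rewrite lerDl sumr_ge0 // => j _; rewrite mulr_ge0 // exprn_ge0.
Qed.

(** The recursion uses the series truncated at order [i].  Replacing it with
    the full one changes [pulled_H] by O(t^(i+1)), hence not its derivative
    of order [i] at time 0. *)
Lemma gen_sequence_full i x : (i < k)%N -> U x ->
  S i.+1 x = iter i (@time_deriv R Rn R) (pulled_H alpha H S k) (0, x).
Proof.
move=> ik Ux; rewrite (gen_sequence_deriv a0 genS ik Ux).
have sTk := smooth_gen_series_le (leqnn k).
have sTi := smooth_gen_series_le (ltnW ik).
pose Lk := phase_dom U W (gen_series S k); pose Li := phase_dom U W (gen_series S i).
have oLk : open Lk := phase_dom_open oU oW sTk.
have oLi : open Li := phase_dom_open oU oW sTi.
have oB : open (Lk `&` Li) by exact: openI.
have sHa := smooth_H_alpha oW sH sa aU.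
have sk : smooth_on (Lk `&` Li) (pulled_H alpha H S k).
  by apply: smooth_sub (smooth_lifted oU oW sTk sHa) => q [].
have si : smooth_on (Lk `&` Li) (pulled_H alpha H S i).
  by apply: smooth_sub (smooth_lifted oU oW sTi sHa) => q [].
have B0 : (Lk `&` Li) (0, x) by split; exact: phase_dom_gen_series0.
apply/eqP; rewrite eq_sym -subr_eq0; apply/eqP.
rewrite -(iter_time_derivB i oB sk si B0).
have [Lc Lc0 [d d0 lip]] := lipschitz_near_real
  (frame_prod (@frame_mx R n 1) (@frame_mx R n 1)) oW (W0 Ux) sHa.
have [C C0 close] := phase_lift_gen_series_close (ltnW ik) Ux.
apply: (@flat_coef _ _ (Lk `&` Li) _ x i.+1 (Lc * C) oB B0 (smoothB oB sk si)) => //.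
have near_phase_lift j : (j <= k)%N ->
    \forall t \near (0 : R)^'+, ball (x, 0) d (phase_lift (gen_series S j) (t, x)).
  move=> jk; have sT := smooth_gen_series_le jk.
  have sl := smooth_phase_lift oU sT.
  have sp := smooth_pair openT (@smooth_id R R setT) (@smooth_cst R R Rn setT x).
  have cl : {for 0, continuous (phase_lift (gen_series S j) \o (fun t : R => (t, x)))}.
    apply: continuous_comp; first exact: (smooth_continuous sp I).
    exact: (smooth_continuous sl (x := (0, x)) Ux).
  have := near_continuous_lt cl d0.
  rewrite /= phase_lift_gen_series0 => h; apply: cvg_within.
  by apply: filterS h => t; rewrite -ball_normE /= distrC.
have hk := near_phase_lift k (leqnn k); have hi := near_phase_lift i (ltnW ik).
have h01 : \forall t \near (0 : R)^'+, 0 <= t <= 1.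
  near=> t; apply/andP; split; near: t; first exact: nbhs_right_ge.
  exact: nbhs_right_le.
move: hk hi h01; apply: filterS3 => t Bk Bi t01.
rewrite -mulrA; apply: le_trans (lip _ _ Bk Bi) _.
by rewrite ler_pM2l //; exact: close.
Unshelve. all: by end_near. Qed.

(** Taylor's formula for [pulled_H], of which the time derivative of the
    generating series is the Taylor polynomial. *)
Lemma hj_defect_near x : U x -> exists2 C, 0 <= C &
  \forall q \near ((0 : R), x), `|hj_defect q| <= C * `|q.1| ^+ k.
Proof.
move=> Ux; have sTk := smooth_gen_series_le (leqnn k).
have sHa := smooth_H_alpha oW sH sa aU.
have [C C0 HC] := taylor_time k (phase_dom_open oU oW sTk)
  (phase_dom_gen_series0 S W0 k Ux) (smooth_lifted oU oW sTk sHa).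
exists C => //.
have HU : \forall q \near ((0 : R), x), U q.2.
  by apply: (@near_snd _ _ (0 : R) x U); exact: open_nbhs_nbhs.
move: HU HC; apply: filterS2 => q Uq.
rewrite /hj_defect time_deriv_gen_series // distrC; congr (`|_ - _| <= _).
by apply: eq_bigr => i _; rewrite (gen_sequence_full (ltn_ord i) Uq).
Qed.

End HamiltonJacobi.

(** * Gronwall and norm estimates *)

Section Gronwall.
Context {R : realType} {n : nat}.
Local Notation Rn := 'cV[R]_n.

(** The maximum [M] of the norm of [e] between 0 and [t] satisfies
    [M <= t * (L * M + C * t ^+ k)], which bounds it once [t * L <= 1 / 2]. *)
Lemma gronwall_power (e de : R -> Rn) (L C d : R) k :
  0 <= L -> 0 <= C -> 0 < d -> e 0 = 0 ->
  (forall t : R, `|t| < d -> is_derive t (1 : R) e (de t)) ->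
  (forall t, 0 <= t < d -> `|de t| <= L * `|e t| + C * t ^+ k) ->
  \forall t \near (0 : R)^'+, `|e t| <= (2 * C) * t ^+ k.+1.
Proof.
move=> L0 C0 d0 e0 De Be.
have diffe t : `|t| < d -> differentiable e t.
  by move=> td; have [h _] := De t td; apply/derivable1_diffP.
(* Up to this time, [t * L <= 1 / 2]. *)
have d2 : 0 < (2 * (L + 1))^-1 by rewrite invr_gt0 mulr_gt0 // ltr_wpDl.
have small : \forall t \near (0 : R)^'+, [/\ 0 < t, t < d & t <= (2 * (L + 1))^-1].
  have h1 := nbhs_right_gt (0 : R).
  have h2 := nbhs_right_lt d0.
  have h3 := nbhs_right_le d2.
  by move: h1 h2 h3; apply: filterS3 => t a b c; split.
apply: filterS small => t [t0 td tL].
have ce s : `|s| < d -> {for s, continuous (fun s : R => `|e s|)}.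
  move=> sd; apply: (@continuous_comp _ _ _ e (fun v : Rn => `|v|)).
    exact: differentiable_continuous (diffe s sd).
  exact: norm_continuous.
have [|tau tau01 M] := @EVT_max R (fun s => `|e s|) 0 t (ltW t0).
  apply: continuous_in_subspaceT => s /set_mem /=; rewrite in_itv /= => /andP[s0 st].
  by apply: ce; rewrite ger0_norm // (le_lt_trans st).
move: tau01; rewrite in_itv /= => /andP[tau0 taut].
have Me : `|e tau| <= t * (L * `|e tau| + C * t ^+ k).
  have := @mean_bound_line R R n 1 e 0 tau (t * (L * `|e tau| + C * t ^+ k)).
  rewrite addr0 e0 subr0; apply => s /andP[s0 s1]; rewrite addr0.
  have st0 : 0 <= s *: tau by rewrite mulr_ge0.
  have stt : s *: tau <= t by apply: le_trans taut; rewrite ler_piMl.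
  have std : `|s *: tau| < d by rewrite ger0_norm // (le_lt_trans stt).
  split; first exact: diffe.
  have -> : 'D_tau e (s *: tau) = tau *: de (s *: tau).
    have [_ <-] := De _ std.
    by rewrite !(deriveE _ (diffe _ std)) -linearZ; congr ('d _ _ _); rewrite [_ *: 1]mulr1.
  rewrite normrZ ger0_norm //; apply: ler_pM => //.
  have h := Be (s *: tau); rewrite st0 (le_lt_trans stt) // in h.
  apply: le_trans (h isT) _; apply: lerD; apply: ler_wpM2l => //.
    by apply: M; rewrite in_itv /= st0 stt.
  by rewrite lerXn2r // nnegrE // ltW.
have et : `|e t| <= `|e tau| by apply: M; rewrite in_itv /= lexx ltW.
apply: le_trans et _; rewrite exprS mulrCA.
have tL2 : t * L <= 2^-1.
  apply: (@le_trans _ _ ((2 * (L + 1))^-1 * (L + 1))).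
    by apply: ler_pM => //; [exact: ltW | rewrite lerDl].
  by rewrite invfM -mulrA mulVf ?mulr1 // lt0r_neq0 // ltr_wpDl.
have h1 : t * (L * `|e tau|) <= 2^-1 * `|e tau| by rewrite mulrA ler_wpM2r.
have h2 : 0 <= C * t ^+ k by rewrite mulr_ge0 // exprn_ge0 // ltW.
move: Me h1; rewrite mulrDr -(mulrA 2) (mulrCA t 2).
move: (t * (L * `|e tau|)) (t * (C * t ^+ k)) => a1 a2; move: `|e tau|.
by move=> a3 u1 u2; lra.
Qed.

Lemma flat_grad_near (A : set (R * Rn)) (U : set Rn) (f : R * Rn -> R) k x :
  open A -> open U -> (forall x, U x -> A (0, x)) -> smooth_on A f ->
  vanishes_to k U f -> U x ->
  exists2 C, 0 <= C &
  \forall q \near ((0 : R), x), `|grad_space f q| <= C * `|q.1| ^+ k.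
Proof.
move=> oA oU UA sf f0 Ux.
have H i := cid2 (flat_derive_near oA oU UA sf f0 (basis_vec i) Ux).
pose C i := s2val (H i).
have C0 i : 0 <= C i by exact: (s2valP (H i)).
have HC i : \forall q \near ((0 : R), x),
    `|'D_((0, basis_vec i) : R * Rn) f q| <= C i * `|q.1| ^+ k.
  exact: (s2valP' (H i)).
exists (\sum_i C i); first exact: sumr_ge0.
near=> q.
have Hq i : `|'D_((0, basis_vec i) : R * Rn) f q| <= C i * `|q.1| ^+ k.
  by move: i; near: q; exact: filter_forall.
apply: mx_norm_le => [|i j].
  by rewrite mulr_ge0 ?sumr_ge0 // exprn_ge0.
rewrite mxE; apply: le_trans (Hq i) _; rewrite ler_wpM2r ?exprn_ge0 //.
by rewrite (bigD1 i) //= lerDl sumr_ge0.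
Unshelve. all: by end_near. Qed.

Lemma mulmx_norm_le (A : 'M[R]_n) (v : Rn) : `|A *m v| <= n%:R * `|A| * `|v|.
Proof.
apply: mx_norm_le => [|i j]; first by rewrite !mulr_ge0.
rewrite mxE; apply: le_trans (ler_norm_sum _ _ _) _.
have -> : n%:R * `|A| * `|v| = \sum_(l < n) `|A| * `|v|.
  by rewrite sumr_const card_ord -[RHS]mulr_natl mulrA.
by apply: ler_sum => l _; rewrite normrM; apply: ler_pM => //; exact: mx_entry_le.
Qed.

Lemma row_mulmx_norm_le (g : 'rV[R]_n) (v : Rn) : `|(g *m v) 0 0| <= n%:R * `|g| * `|v|.
Proof.
rewrite mxE; apply: le_trans (ler_norm_sum _ _ _) _.
have -> : n%:R * `|g| * `|v| = \sum_(l < n) `|g| * `|v|.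
  by rewrite sumr_const card_ord -[RHS]mulr_natl mulrA.
by apply: ler_sum => l _; rewrite normrM; apply: ler_pM => //; exact: mx_entry_le.
Qed.

End Gronwall.

(** * The scheme as a Hamiltonian flow of a bi-realisation *)

Section SchemeFlow.
Context {R : realType} {n : nat}.
Local Notation Rn := 'cV[R]_n.
Variables (k : nat) (U : set Rn) (pi : Rn -> 'M[R]_n) (W : set (Rn * Rn))
  (alpha beta : Rn * Rn -> Rn) (H : Rn -> R) (S : nat -> Rn -> R).
Hypotheses (oU : open U) (poisson_pi : poisson_structure U pi)
  (breal : bi_realisation U pi W alpha beta) (sH : smooth_on U H)
  (genS : generating_sequence k U alpha H S).

Let oW : open W := breal_open breal.
Let W0 : forall x, U x -> W (x, 0) := breal_zero breal.
Let sa : smooth_on W alpha := (breal_alpha_subm breal).1.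
Let sb : smooth_on W beta := (breal_beta_subm breal).1.
Let aU w : W w -> U (alpha w).
Proof. by move=> Ww; rewrite -(breal_alpha_onto breal); exists w. Qed.
Let bU w : W w -> U (beta w).
Proof. by move=> Ww; rewrite -(breal_beta_onto breal); exists w. Qed.
Let a0 : forall x, U x -> alpha (x, 0) = x := breal_alpha_unit breal.
Let b0 : forall x, U x -> beta (x, 0) = x := breal_beta_unit breal.

Lemma alpha_jac w : W w -> jac_x alpha w *m (jac_p alpha w)^T -
  jac_p alpha w *m (jac_x alpha w)^T = pi (alpha w).
Proof.
move=> Ww; have da := smooth_diff sa Ww; apply/matrixP => i j.
rewrite -(obracket_coordf i j da da).
by rewrite -(breal_alpha_poisson breal (smooth_coordf i oU) (smooth_coordf j oU) Ww)
  pbracket_coordf.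
Qed.

Lemma beta_jac w : W w -> jac_x beta w *m (jac_p beta w)^T -
  jac_p beta w *m (jac_x beta w)^T = - pi (beta w).
Proof.
move=> Ww; have db := smooth_diff sb Ww; apply/matrixP => i j.
rewrite -(obracket_coordf i j db db) [RHS]mxE -(pbracket_coordf pi i j).
rewrite (breal_beta_antipoisson breal (smooth_coordf i oU) (smooth_coordf j oU) Ww).
by rewrite opprK.
Qed.

Lemma alpha_beta_jac w : W w ->
  jac_x alpha w *m (jac_p beta w)^T = jac_p alpha w *m (jac_x beta w)^T.
Proof.
move=> Ww; have da := smooth_diff sa Ww; have db := smooth_diff sb Ww.
apply/eqP; rewrite -subr_eq0; apply/eqP/matrixP => i j.
rewrite -(obracket_coordf i j da db) [RHS]mxE.
exact: (breal_orthogonal breal (smooth_coordf i oU) (smooth_coordf j oU) Ww).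
Qed.

Lemma beta_alpha_jac w : W w ->
  jac_x beta w *m (jac_p alpha w)^T = jac_p beta w *m (jac_x alpha w)^T.
Proof.
move=> Ww; move: (alpha_beta_jac Ww).
move: (jac_x beta w) (jac_p beta w) (jac_x alpha w) (jac_p alpha w) => X P X' P' E.
by apply: trmx_inj; rewrite !trmx_mul !trmxK E.
Qed.

Local Notation sg := (gen_series S k).
Local Notation L := (phase_dom U W sg).
Local Notation Fa := (alpha \o phase_lift sg).
Local Notation Fb := (beta \o phase_lift sg).

Let ss : smooth_on (tube U) sg :=
  smooth_gen_series_le oU oW W0 sH sa aU a0 genS (leqnn k).
Let L0 x : U x -> L (0, x) := @phase_dom_gen_series0 R n U W S W0 k x.
Let oL : open L := phase_dom_open oU oW ss.
Let sFa : smooth_on L Fa := smooth_lifted oU oW ss sa.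
Let sFb : smooth_on L Fb := smooth_lifted oU oW ss sb.
Let Fa0 x : U x -> Fa (0, x) = x.
Proof. by move=> Ux; rewrite /= phase_lift_gen_series0 a0. Qed.
Let Fb0 x : U x -> Fb (0, x) = x.
Proof. by move=> Ux; rewrite /= phase_lift_gen_series0 b0. Qed.

Definition source_dom := inv_dom L Fa.
Definition target_dom := inv_dom L Fb.
Definition source_inv := family_inverse L Fa.
Definition target_inv := family_inverse L Fb.
(** This is the scheme, and exchanging [alpha] with [beta] gives its inverse
    [bwd]. *)
Definition fwd := gen_flow U W sg alpha beta.
Definition bwd := gen_flow U W sg beta alpha.
(** The curves of [fwd] follow the field of [fwd_ham] ([fwd_time]), those of
    [bwd] the field of [- bwd_ham] ([bwd_time]). *)
Definition fwd_ham := gen_ham U W sg beta.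
Definition bwd_ham := gen_ham U W sg alpha.

Definition fwd_dom : set (R * Rn) :=
  [set q | source_dom q /\ inj_dom L Fb (q.1, source_inv q)].
Definition bwd_dom : set (R * Rn) :=
  [set q | target_dom q /\ inj_dom L Fa (q.1, target_inv q)].

Lemma source_inv0 x : U x -> source_dom (0, x) /\ source_inv (0, x) = x.
Proof.
move=> Ux; have I0 := inj_dom0 oL oU L0 Fa0 sFa Ux.
have := inv_dom_image I0; have := family_inverseK I0.
by rewrite Fa0.
Qed.

Lemma target_inv0 x : U x -> target_dom (0, x) /\ target_inv (0, x) = x.
Proof.
move=> Ux; have I0 := inj_dom0 oL oU L0 Fb0 sFb Ux.
have := inv_dom_image I0; have := family_inverseK I0.
by rewrite Fb0.
Qed.

Lemma source_dom_sub q : source_dom q -> U q.2.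
Proof.
move=> Dq; have [/inj_dom_sub Lq <-] := family_inverseP Dq.
by apply: aU; case: Lq.
Qed.

Lemma target_dom_sub q : target_dom q -> U q.2.
Proof.
move=> Dq; have [/inj_dom_sub Lq <-] := family_inverseP Dq.
by apply: bU; case: Lq.
Qed.

Lemma fwd_dom_open : open fwd_dom.
Proof.
apply: (open_preimage_on (inv_dom_open sFa) (@inj_dom_open R n L Fb)) => q Dq.
exact: (smooth_continuous (smooth_graph_inverse oU oW ss sa) Dq).
Qed.

Lemma bwd_dom_open : open bwd_dom.
Proof.
apply: (open_preimage_on (inv_dom_open sFb) (@inj_dom_open R n L Fa)) => q Dq.
exact: (smooth_continuous (smooth_graph_inverse oU oW ss sb) Dq).
Qed.

Lemma fwd_dom0 x : U x -> fwd_dom (0, x).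
Proof.
move=> Ux; have [D0 E0] := source_inv0 Ux; split => //.
rewrite E0; exact: (inj_dom0 oL oU L0 Fb0 sFb Ux).
Qed.

Lemma bwd_dom0 x : U x -> bwd_dom (0, x).
Proof.
move=> Ux; have [D0 E0] := target_inv0 Ux; split => //.
rewrite E0; exact: (inj_dom0 oL oU L0 Fa0 sFa Ux).
Qed.

Lemma fwd0 x : U x -> fwd (0, x) = x.
Proof.
move=> Ux; have [_ E0] := source_inv0 Ux.
rewrite /fwd /gen_flow -[family_inverse L Fa _]/(source_inv (0, x)) E0.
exact: Fb0.
Qed.

Lemma bwd0 x : U x -> bwd (0, x) = x.
Proof.
move=> Ux; have [_ E0] := target_inv0 Ux.
rewrite /bwd /gen_flow -[family_inverse L Fb _]/(target_inv (0, x)) E0.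
exact: Fa0.
Qed.

Lemma smooth_fwd : smooth_on source_dom fwd.
Proof. exact: (smooth_gen_flow oU oW ss sa sb). Qed.
Lemma smooth_bwd : smooth_on target_dom bwd.
Proof. exact: (smooth_gen_flow oU oW ss sb sa). Qed.
Lemma smooth_fwd_ham : smooth_on target_dom fwd_ham.
Proof. exact: (smooth_gen_ham oU oW ss sb). Qed.
Lemma smooth_bwd_ham : smooth_on source_dom bwd_ham.
Proof. exact: (smooth_gen_ham oU oW ss sa). Qed.

Lemma fwd_sub q : source_dom q -> U (fwd q).
Proof.
by move=> Dq; have [/inj_dom_sub Lq _] := family_inverseP Dq; apply: bU; case: Lq.
Qed.

Lemma fwdK q : fwd_dom q ->
  [/\ bwd_dom (q.1, fwd q), target_inv (q.1, fwd q) = source_inv q &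
      bwd (q.1, fwd q) = q.2].
Proof.
move=> [Dq Oq]; have [Oa Eq] := family_inverseP Dq.
have E : target_inv (q.1, fwd q) = source_inv q := family_inverseK Oq.
split => //; first by split; [exact: inv_dom_image Oq|rewrite /= E].
by rewrite /bwd /gen_flow -[family_inverse L Fb _]/(target_inv _) E.
Qed.

Lemma bwdK q : bwd_dom q ->
  [/\ fwd_dom (q.1, bwd q), source_inv (q.1, bwd q) = target_inv q &
      fwd (q.1, bwd q) = q.2].
Proof.
move=> [Dq Oq]; have [Oa Eq] := family_inverseP Dq.
have E : source_inv (q.1, bwd q) = target_inv q := family_inverseK Oq.
split => //; first by split; [exact: inv_dom_image Oq|rewrite /= E].
by rewrite /fwd /gen_flow -[family_inverse L Fa _]/(source_inv _) E.
Qed.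

Lemma fwd_time q : fwd_dom q ->
  time_deriv fwd q = pi (fwd q) *m grad_space fwd_ham (q.1, fwd q).
Proof.
move=> [Dq Oq]; have [/inj_dom_sub Lq _] := family_inverseP Dq.
rewrite (gen_flow_time oU oW ss sa sb alpha_beta_jac Dq Oq); congr (_ *m _).
by rewrite -[LHS]opprK opprB (beta_jac Lq.2) opprK.
Qed.

Lemma bwd_time q : bwd_dom q ->
  time_deriv bwd q = - pi (bwd q) *m grad_space bwd_ham (q.1, bwd q).
Proof.
move=> [Dq Oq]; have [/inj_dom_sub Lq _] := family_inverseP Dq.
rewrite (gen_flow_time oU oW ss sb sa beta_alpha_jac Dq Oq); congr (_ *m _).
by rewrite -[LHS]opprK opprB (alpha_jac Lq.2).
Qed.

Lemma fwd_poisson q : source_dom q ->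
  space_jac fwd q *m pi q.2 *m (space_jac fwd q)^T = pi (fwd q).
Proof.
move=> Dq; have [/inj_dom_sub Lq Eq] := family_inverseP Dq.
have := gen_flow_poisson oU oW ss sa sb alpha_beta_jac Dq.
rewrite /= (alpha_jac Lq.2) (beta_jac Lq.2) opprK.
by rewrite -[alpha _]/(Fa (q.1, family_inverse L Fa q)) Eq.
Qed.

Lemma fwd_dom_scheme q : source_dom q ->
  scheme_equation k W alpha S q.1 q.2 (source_inv q) /\
  fwd q = beta (scheme_point k S q.1 (source_inv q)).
Proof.
move=> Dq; have [/inj_dom_sub[Uy Wy] Eq] := family_inverseP Dq.
rewrite /scheme_equation (scheme_point_phase_lift oU oW W0 sH sa aU a0 genS) //.
Qed.

Lemma source_dom_open : open source_dom.
Proof. exact: inv_dom_open sFa. Qed.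

Lemma target_dom_open : open target_dom.
Proof. exact: inv_dom_open sFb. Qed.

Lemma source_graph_continuous q : source_dom q ->
  {for q, continuous (fun q => (q.1, source_inv q))}.
Proof. exact: (smooth_continuous (smooth_graph_inverse oU oW ss sa)). Qed.

(** On the graph, [H \o alpha] is [H] at the source point [q.2]. *)
Lemma bwd_ham_defect q : source_dom q ->
  bwd_ham q - H q.2 = hj_defect k alpha H S (q.1, source_inv q).
Proof.
move=> Dq; have [_ Eq] := family_inverseP Dq.
by rewrite -[in LHS]Eq.
Qed.

Lemma fwd_ham_bwd q : bwd_dom q -> fwd_ham q = bwd_ham (q.1, bwd q).
Proof.
move=> /bwdK[_ E _].
by rewrite /bwd_ham /gen_ham -[family_inverse L Fa _]/(source_inv (q.1, bwd q)) E.
Qed.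

End SchemeFlow.

(** * Order of the scheme *)

Lemma near_preimage (T T' : topologicalType) (f : T -> T') (x : T) (P : set T') :
  {for x, continuous f} -> nbhs (f x) P -> \forall y \near x, P (f y).
Proof. by move=> cf; exact: cf. Qed.

Section NearTime.
Context {R : realType} {V : normedModType R}.

Lemma continuous_time_line (x : V) (t : R) : {for t, continuous (fun s : R => (s, x))}.
Proof.
have sp := smooth_pair openT (@smooth_id R R setT) (@smooth_cst R R V setT x).
exact: (smooth_continuous sp I).
Qed.

Lemma near_time (x : V) (P : R * V -> Prop) :
  (\forall q \near ((0 : R), x), P q) -> \forall t \near (0 : R), P (t, x).
Proof. exact: (@continuous_time_line x 0). Qed.

Lemma near_time_right (x : V) (P : R * V -> Prop) :
  (\forall q \near ((0 : R), x), P q) -> \forall t \near (0 : R)^'+, P (t, x).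
Proof. by move=> h; apply: cvg_within; exact: near_time h. Qed.

Lemma near_vanishes (U : set V) (f : R * V -> R) k :
  (forall x, U x -> exists2 C, 0 <= C &
     \forall q \near ((0 : R), x), `|f q| <= C * `|q.1| ^+ k) ->
  vanishes_to k U f.
Proof.
move=> H x /H[C C0 HC]; exists C.
have h0 := nbhs_right_ge (0 : R).
by move: h0 (near_time_right HC); apply: filterS2 => t t0 /=; rewrite (ger0_norm t0).
Qed.

End NearTime.

Section Defects.
Context {R : realType} {n : nat}.
Local Notation Rn := 'cV[R]_n.
Variables (k : nat) (U : set Rn) (pi : Rn -> 'M[R]_n) (W : set (Rn * Rn))
  (alpha beta : Rn * Rn -> Rn) (H : Rn -> R) (S : nat -> Rn -> R).
Hypotheses (oU : open U) (poisson_pi : poisson_structure U pi)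
  (breal : bi_realisation U pi W alpha beta) (sH : smooth_on U H)
  (genS : generating_sequence k U alpha H S).

Local Notation Da := (source_dom k U W alpha S).
Local Notation Db := (target_dom k U W beta S).
Local Notation Phi := (fwd k U W alpha beta S).
Local Notation Psi := (bwd k U W alpha beta S).
Local Notation Ha := (bwd_ham k U W alpha S).
Local Notation Hb := (fwd_ham k U W beta S).

Let spi : smooth_on U pi := poisson_smooth poisson_pi.

Definition source_defect (q : R * Rn) : R := Ha q - H q.2.
Definition target_defect (q : R * Rn) : R := Hb q - H q.2.

Lemma source_defect_near x : U x -> exists2 C, 0 <= C &
  \forall q \near ((0 : R), x), `|source_defect q| <= C * `|q.1| ^+ k.
Proof.
move=> Ux.
have aU w : W w -> U (alpha w).
  by move=> Ww; rewrite -(breal_alpha_onto breal); exists w.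
have [C C0 HC] := hj_defect_near oU (breal_open breal) (breal_zero breal) sH
  (breal_alpha_subm breal).1 aU (breal_alpha_unit breal) genS Ux.
exists C => //.
have [D0 E0] := source_inv0 oU breal sH genS Ux.
have cg := source_graph_continuous oU breal sH genS D0.
have HC' : \forall q \near ((0 : R), x),
    `|hj_defect k alpha H S (q.1, source_inv k U W alpha S q)| <= C * `|q.1| ^+ k.
  apply: (near_preimage (P := fun p => `|hj_defect k alpha H S p| <= C * `|p.1| ^+ k) cg).
  by rewrite /= E0; exact: HC.
have HD : \forall q \near ((0 : R), x), Da q.
  by apply: open_nbhs_nbhs; split => //; exact: (source_dom_open oU breal sH genS).
move: HD HC'; apply: filterS2 => q Dq.
by rewrite /source_defect (bwd_ham_defect _ Dq).
Qed.

Lemma smooth_H_space (A : set (R * Rn)) : open A -> (forall q, A q -> U q.2) ->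
  smooth_on A (fun q : R * Rn => H q.2).
Proof.
by move=> oA AU; apply: (smooth_comp (B := U) (@frame_mx R n 1) oA AU (smooth_snd oA) sH).
Qed.

Lemma smooth_source_defect : smooth_on Da source_defect.
Proof.
have oD := source_dom_open oU breal sH genS.
apply: smoothB => //; first exact: (smooth_bwd_ham oU breal sH genS).
by apply: smooth_H_space => // q; exact: (source_dom_sub breal).
Qed.

Lemma smooth_target_defect : smooth_on Db target_defect.
Proof.
have oD := target_dom_open oU breal sH genS.
apply: smoothB => //; first exact: (smooth_fwd_ham oU breal sH genS).
by apply: smooth_H_space => // q; exact: (target_dom_sub breal).
Qed.

Lemma source_grad_near x : U x -> exists2 C, 0 <= C &
  \forall q \near ((0 : R), x), `|grad_space source_defect q| <= C * `|q.1| ^+ k.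
Proof.
move=> Ux; apply: (flat_grad_near (source_dom_open oU breal sH genS) oU) Ux.
- by move=> y Uy; have [] := source_inv0 oU breal sH genS Uy.
- exact: smooth_source_defect.
- exact: near_vanishes source_defect_near.
Qed.

Lemma grad_space_split (A : set (R * Rn)) (K : R * Rn -> R) q : open A ->
  smooth_on A K -> A q -> U q.2 ->
  grad_space K q = grad_space (fun q => K q - H q.2) q + grad H q.2.
Proof.
case: q => t x oA sK Aq Ux; apply/colP => i; rewrite !mxE !derive_space.
have dK : derivable (fun y => K (t, y)) x (basis_vec i).
  apply: diff_derivable; apply: (@differentiable_comp _ _ _ _ (fun y => (t, y)) K).
    have := smooth_pair openT (@smooth_cst R Rn R setT t) (@smooth_id R Rn setT).
    by move/smooth_diff; apply.
  exact: smooth_diff sK Aq.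
have dH : derivable H x (basis_vec i) by apply: diff_derivable; exact: smooth_diff sH Ux.
by rewrite (deriveB dK dH) subrK.
Qed.

Lemma poisson_self (x : Rn) : U x -> ((grad H x)^T *m pi x *m grad H x) 0 0 = 0.
Proof.
move=> Ux; have := poisson_skew poisson_pi sH sH Ux.
rewrite /pbracket; move: (_ 0 0) => a; lra.
Qed.

(** As [fwd_ham] is [bwd_ham] along [bwd], it remains to bound the variation
    of [H] along [bwd].  The derivative of [H] there is a bracket with
    [bwd_ham], or equivalently with [source_defect], because the bracket of
    [H] with itself vanishes. *)
Lemma target_defect_vanishes : vanishes_to k U target_defect.
Proof.
move=> z Uz.
have [C1 C10 H1] := source_defect_near Uz.
have [C2 C20 H2] := source_grad_near Uz.
have [D0 _] := target_inv0 oU breal sH genS Uz.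
have bz : Psi (0, z) = z := bwd0 oU breal sH genS Uz.
have sPsi := smooth_bwd oU breal sH genS.
have cPsi := smooth_continuous sPsi D0.
have oDb := target_dom_open oU breal sH genS.
have sg2 : smooth_on Db (fun q : R * Rn => (q.1, Psi q)).
  by apply: smooth_pair => //; exact: smooth_fst.
have cg2 := smooth_continuous sg2 D0.
pose g x := (grad H x)^T *m pi x.
have sg : smooth_on U g.
  apply: smooth_mul => //; apply: smooth_mx => // i j.
  have := smooth_entry j i oU (smooth_grad oU sH).
  by apply: eq_smooth => // x _; rewrite [RHS]mxE.
have cg := smooth_continuous sg Uz.
pose G := `|g z| + 1.
have H3 : \forall q \near ((0 : R), z), `|g (Psi q)| <= G.
  have cgP : {for (0, z), continuous (g \o Psi)}.
    apply: (@continuous_comp _ _ _ Psi g); first exact: cPsi.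
    by rewrite bz; exact: cg.
  have := near_continuous_lt cgP ltr01; rewrite /= bz; apply: filterS => q h.
  rewrite -(subrK (g z) (g (Psi q))) addrC; apply: le_trans (ler_normD _ _) _.
  by rewrite lerD2l ltW.
have H1' : \forall q \near ((0 : R), z), `|source_defect (q.1, Psi q)| <= C1 * `|q.1| ^+ k.
  apply: (near_preimage (P := fun p => `|source_defect p| <= C1 * `|p.1| ^+ k) cg2).
  by rewrite /= bz; exact: H1.
have H2' : \forall q \near ((0 : R), z),
    `|grad_space source_defect (q.1, Psi q)| <= C2 * `|q.1| ^+ k.
  apply: (near_preimage (P := fun p => `|grad_space source_defect p| <= C2 * `|p.1| ^+ k) cg2).
  by rewrite /= bz; exact: H2.
have H4 : \forall q \near ((0 : R), z), bwd_dom k U W alpha beta S q.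
  apply: open_nbhs_nbhs; split; first exact: (bwd_dom_open oU breal sH genS).
  exact: (bwd_dom0 oU breal sH genS Uz).
have : \forall q \near ((0 : R), z),
   (bwd_dom k U W alpha beta S q /\ `|source_defect (q.1, Psi q)| <= C1 * `|q.1| ^+ k) /\
   (`|grad_space source_defect (q.1, Psi q)| <= C2 * `|q.1| ^+ k /\ `|g (Psi q)| <= G).
  by apply: filterI; [apply: filterI; [exact: H4|exact: H1']|
    apply: filterI; [exact: H2'|exact: H3]].
move=> /near_time /nbhs_ballP[d /= d0 dP].
have dPt (t : R) : `|t| < d ->
   (bwd_dom k U W alpha beta S (t, z) /\ `|source_defect (t, Psi (t, z))| <= C1 * `|t| ^+ k) /\
   (`|grad_space source_defect (t, Psi (t, z))| <= C2 * `|t| ^+ k /\ `|g (Psi (t, z))| <= G).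
  by move=> td; apply: (dP t); rewrite -ball_normE /= sub0r normrN.
pose B := n%:R * G * C2.
have G0 : 0 <= G by rewrite addr_ge0.
have B0 : 0 <= B by rewrite !mulr_ge0.
exists (C1 + B).
have h1 := nbhs_right_gt (0 : R).
have h2 := nbhs_right_lt d0.
have h3 := nbhs_right_le (@ltr01 R).
move: h1 h2 h3; apply: filterS3 => t t0 td t1.
have tn : `|t| = t by rewrite gtr0_norm.
have td' : `|t| < d by rewrite tn.
have [[Dt S1] _] := dPt t td'.
pose u (s : R) := H (Psi (s, z)).
have key : `|u t - u 0| <= B * `|t| ^+ k * `|t|.
  apply: (@is_derive_mean_bound R u
    (fun s => - (g (Psi (s, z)) *m grad_space source_defect (s, Psi (s, z))) 0 0)).
  move=> s st; have sd : `|s| < d := le_lt_trans st td'.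
  have [[Ds _] [S2 S3]] := dPt s sd.
  have Dbs : Db (s, z) by case: Ds.
  have [Fs _ _] := bwdK Ds.
  have Das : Da (s, Psi (s, z)) by case: Fs.
  have Us : U (Psi (s, z)) := source_dom_sub breal Das.
  have dH := smooth_diff sH Us.
  have dP' := smooth_diff sPsi Dbs.
  have dHP : differentiable (H \o Psi) (s, z) by exact: differentiable_comp.
  split; last first.
    rewrite normrN; apply: le_trans (row_mulmx_norm_le _ _) _.
    rewrite /B -!mulrA ler_wpM2l // ler_pM //.
    by apply: le_trans S2 _; rewrite ler_wpM2l // lerXn2r // nnegrE.
  suff <- : time_deriv (H \o Psi) (s, z) =
      - (g (Psi (s, z)) *m grad_space source_defect (s, Psi (s, z))) 0 0.
    exact: (is_derive_time dHP).
  rewrite /time_deriv (derive_comp _ dP' dH) (derive_grad _ dH).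
  rewrite -[derive Psi _ _]/(time_deriv Psi (s, z)) (bwd_time oU breal sH genS Ds).
  rewrite (grad_space_split (source_dom_open oU breal sH genS)
    (smooth_bwd_ham oU breal sH genS) Das Us) -/source_defect /=.
  move: (poisson_self Us); rewrite /g.
  move: (grad H _) (pi _) (grad_space _ _) => v P w E.
  rewrite mulNmx mulmxN mulmxA mulmxDr [LHS]mxE [X in - X]mxE.
  by rewrite E addr0.
have [_ _ _] := bwdK Dt.
have -> : target_defect (t, z) = source_defect (t, Psi (t, z)) + (u t - u 0).
  rewrite /target_defect (fwd_ham_bwd Dt) /source_defect /= /u bz.
  by rewrite addrA subrK.
apply: le_trans (ler_normD _ _) _; rewrite mulrDl.
rewrite tn in S1 key; apply: lerD => //; apply: le_trans key _.
by rewrite ler_piMr // mulr_ge0 // exprn_ge0 // ltW.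
Qed.

Lemma target_grad_near x : U x -> exists2 C, 0 <= C &
  \forall q \near ((0 : R), x), `|grad_space target_defect q| <= C * `|q.1| ^+ k.
Proof.
move=> Ux; apply: (flat_grad_near (target_dom_open oU breal sH genS) oU) Ux.
- by move=> y Uy; have [] := target_inv0 oU breal sH genS Uy.
- exact: smooth_target_defect.
- exact: target_defect_vanishes.
Qed.

End Defects.

Section OrderOfFlow.
Context {R : realType} {n : nat}.
Local Notation Rn := 'cV[R]_n.
Variables (k : nat) (U : set Rn) (pi : Rn -> 'M[R]_n) (W : set (Rn * Rn))
  (alpha beta : Rn * Rn -> Rn) (H : Rn -> R) (S : nat -> Rn -> R).
Hypotheses (oU : open U) (poisson_pi : poisson_structure U pi)
  (breal : bi_realisation U pi W alpha beta) (sH : smooth_on U H)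
  (genS : generating_sequence k U alpha H S).

Local Notation Da := (source_dom k U W alpha S).
Local Notation Db := (target_dom k U W beta S).
Local Notation Phi := (fwd k U W alpha beta S).
Local Notation Psi := (bwd k U W alpha beta S).
Local Notation Hb := (fwd_ham k U W beta S).
Local Notation tdef := (target_defect k U W beta H S).

Let spi : smooth_on U pi := poisson_smooth poisson_pi.

(** Both curves start at [x] and follow fields that differ by O(t^k), as
    [target_grad_near] bounds the difference of the Hamiltonians in C^1. *)
Lemma fwd_order x (c : R -> Rn) : U x ->
  solution_from U (hamiltonian_field pi H) x c ->
  exists C, \forall t \near (0 : R)^'+, `|Phi (t, x) - c t| <= C * t ^+ k.+1.
Proof.
move=> Ux [c0 cS].
have [C C0 HC] := target_grad_near oU poisson_pi breal sH genS Ux.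
have sX := smooth_hamiltonian_field oU spi sH.
set X := hamiltonian_field pi H in sX cS.
have [L0 L00 [d1 d10 lip]] := lipschitz_near (@frame_mx R n 1) oU Ux (sX 1%N).
have [D0 _] := source_inv0 oU breal sH genS Ux.
have fx : Phi (0, x) = x := fwd0 oU breal sH genS Ux.
have sPhi := smooth_fwd oU breal sH genS.
have cPhi := smooth_continuous sPhi D0.
have oDa := source_dom_open oU breal sH genS.
have sg2 : smooth_on Da (fun q : R * Rn => (q.1, Phi q)).
  by apply: smooth_pair => //; exact: smooth_fst.
have cg2 := smooth_continuous sg2 D0.
have cpi := smooth_continuous spi Ux.
pose G := `|pi x| + 1.
have G0 : 0 <= G by rewrite addr_ge0.
have H1 : \forall q \near ((0 : R), x), fwd_dom k U W alpha beta S q.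
  apply: open_nbhs_nbhs; split; first exact: (fwd_dom_open oU breal sH genS).
  exact: (fwd_dom0 oU breal sH genS Ux).
have H2 : \forall q \near ((0 : R), x), ball x d1 (Phi q).
  apply: (near_preimage cPhi); rewrite fx; exact: nbhsx_ballx.
have H3 : \forall q \near ((0 : R), x), `|grad_space tdef (q.1, Phi q)| <= C * `|q.1| ^+ k.
  apply: (near_preimage (P := fun p => `|grad_space tdef p| <= C * `|p.1| ^+ k) cg2).
  by rewrite /= fx; exact: HC.
have H4 : \forall q \near ((0 : R), x), `|pi (Phi q)| <= G.
  apply: (near_preimage (P := fun y => `|pi y| <= G) cPhi); rewrite fx.
  have := near_continuous_lt cpi ltr01; apply: filterS => q h.
  rewrite -(subrK (pi x) (pi q)) addrC; apply: le_trans (ler_normD _ _) _.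
  by rewrite lerD2l ltW.
have H5 : \forall t \near (0 : R), ball x d1 (c t).
  have [_ /nbhs_singleton [_ [dc _]]] := conj c0 cS.
  have cc : {for 0, continuous c}.
    by apply: differentiable_continuous; apply/derivable1_diffP.
  by apply: (near_preimage cc); rewrite c0; exact: nbhsx_ballx.
have : \forall t \near (0 : R),
   ((fwd_dom k U W alpha beta S (t, x) /\ ball x d1 (Phi (t, x))) /\
    (`|grad_space tdef (t, Phi (t, x))| <= C * `|t| ^+ k /\ `|pi (Phi (t, x))| <= G)) /\
   ((U (c t) /\ is_derive t (1 : R) c (X (c t))) /\ ball x d1 (c t)).
  apply: filterI; last by apply: filterI; [exact: cS|exact: H5].
  apply: filterI; first by apply: filterI; [exact: near_time H1|exact: near_time H2].
  by apply: filterI; [exact: near_time H3|exact: near_time H4].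
move=> /nbhs_ballP[d /= d0 dP].
have dball (t : R) : `|t| < d -> ball (0 : R) d t.
  by move=> td; rewrite -ball_normE /= sub0r normrN.
exists (2 * (n%:R * G * C)).
apply: (@gronwall_power R n (fun t => Phi (t, x) - c t)
  (fun t => time_deriv Phi (t, x) - X (c t)) L0 (n%:R * G * C) d k) => //.
- exact: ltW.
- by rewrite !mulr_ge0.
- by rewrite fx c0 subrr.
- move=> t td; have [[[Ft _] _] [[_ Dc] _]] := dP t (dball t td).
  apply: is_deriveB; apply: is_derive_time; apply: (smooth_diff sPhi).
  by case: Ft.
- move=> t /andP[t0 td].
  have tn : `|t| = t by rewrite ger0_norm.
  have td' : `|t| < d by rewrite tn.
  have [[[Ft Bt] [S3 S4]] [_ Bc]] := dP t (dball t td').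
  rewrite (fwd_time oU breal sH genS Ft) /=.
  have [Gt _ _] := fwdK Ft.
  have Dbt : Db (t, Phi (t, x)) by case: Gt.
  have Dat : Da (t, x) by case: Ft.
  have Ut : U (Phi (t, x)) := fwd_sub breal Dat.
  rewrite (grad_space_split sH (target_dom_open oU breal sH genS)
    (smooth_fwd_ham oU breal sH genS) Dbt Ut) /= mulmxDr.
  rewrite -[fun q => Hb q - H q.2]/tdef.
  rewrite -[pi _ *m grad H _]/(X (Phi (t, x))) -addrA addrC.
  apply: le_trans (ler_normD _ _) _; apply: lerD; first exact: lip.
  apply: le_trans (mulmx_norm_le _ _) _.
  rewrite -!mulrA ler_wpM2l // ler_pM //.
  by rewrite tn in S3.
Qed.

End OrderOfFlow.

(** * The integrator *)

Section Integrator.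
Context {R : realType} {n : nat}.
Local Notation Rn := 'cV[R]_n.
Variables (k : nat) (U : set Rn) (pi : Rn -> 'M[R]_n) (W : set (Rn * Rn))
  (alpha beta : Rn * Rn -> Rn) (H : Rn -> R) (S : nat -> Rn -> R)
  (phi : R -> Rn -> Rn).
Hypotheses (oU : open U) (poisson_pi : poisson_structure U pi)
  (breal : bi_realisation U pi W alpha beta) (sH : smooth_on U H)
  (genS : generating_sequence k U alpha H S)
  (solvable : scheme_solvable k U W alpha S)
  (scheme_phi : scheme_map k U W alpha beta S phi).

Local Notation Phi := (fwd k U W alpha beta S).
Local Notation Psi := (bwd k U W alpha beta S).
Local Notation Hb := (fwd_ham k U W beta S).
Local Notation Y := (source_inv k U W alpha S).
Local Notation FD := (fwd_dom k U W alpha beta S).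

Definition solvable_zone : set (R * Rn) :=
  [set q | FD q /\ (0 < q.1 -> exists! y, scheme_equation k W alpha S q.1 q.2 y)].

(** Asking for a neighbourhood of [x] common to all times below [d] makes
    this domain both open and star-shaped in time. *)
Definition time_dom : set (R * Rn) :=
  [set q | exists2 d, `|q.1| < d &
     \forall x \near q.2, forall s, `|s| < d -> solvable_zone (s, x)].

Lemma time_dom_open : open time_dom.
Proof.
rewrite openE => -[h x] [/= d hd nx].
have nx' : nbhs x [set z | \forall x' \near z, forall s, `|s| < d -> solvable_zone (s, x')].
  exact: nbhs_interior nx.
exists ([set s | `|s| < d],
  [set z | \forall x' \near z, forall s, `|s| < d -> solvable_zone (s, x')]).
  split; [exact: (@near_norm_lt R R h d hd)|exact: nx'].
by move=> [s z] [/= sd nz]; exists d.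
Qed.

Lemma time_dom_zone q : time_dom q -> solvable_zone q.
Proof. by case: q => h x [/= d hd /nbhs_singleton]; apply. Qed.

Lemma time_dom0 x : U x -> time_dom (0, x).
Proof.
move=> Ux.
have h1 : \forall q \near ((0 : R), x), FD q.
  apply: open_nbhs_nbhs; split; first exact: (fwd_dom_open oU breal sH genS).
  exact: (fwd_dom0 oU breal sH genS Ux).
have h2 := solvable Ux.
have : \forall q \near ((0 : R), x), solvable_zone q.
  by move: h1 h2; apply: filterS2 => q a b; split.
move=> /nbhs_ballP[d /= d0 dP]; exists d; first by rewrite normr0.
apply/nbhs_ballP; exists d => // z xz s sd; apply: dP; split => //.
by rewrite -ball_normE /= sub0r normrN.
Qed.

Lemma time_dom_star h x s : time_dom (h, x) -> 0 <= s <= h -> time_dom (s, x).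
Proof.
move=> [/= d hd nx] /andP[s0 sh]; exists d => //=.
rewrite ger0_norm // (le_lt_trans sh) //.
by rewrite (le_lt_trans (ler_norm h)).
Qed.

Lemma time_dom_fwd q : time_dom q -> FD q.
Proof. by move=> /time_dom_zone[]. Qed.

Lemma time_dom_source q : time_dom q -> source_dom k U W alpha S q.
Proof. by move=> /time_dom_fwd[]. Qed.

Lemma scheme_equation0 x y : scheme_equation k W alpha S 0 x y -> y = x.
Proof.
have E : scheme_point k S 0 y = (y, 0).
  rewrite /scheme_point big_nat big1 // => i /andP[i1 _].
  by rewrite expr0n eqn0Ngt i1 mul0r scale0r.
rewrite /scheme_equation E => -[Wy <-].
by rewrite (breal_alpha_unit breal (breal_sub breal Wy)).
Qed.

(** At a positive time, the solution of the scheme is unique by assumption;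
    at time 0, the equation reads [y = x]. *)
Lemma phi_fwd h x : time_dom (h, x) -> 0 <= h -> phi h x = Phi (h, x).
Proof.
move=> Dq h0; have Sq := time_dom_source Dq.
have Ux : U x := source_dom_sub breal Sq.
have [eqY ->] := fwd_dom_scheme oU breal sH genS Sq.
apply: scheme_phi => //; split=> // y' eqy'.
have [_ /= uniq] := time_dom_zone Dq.
have [hE|hn] := eqVneq h 0.
  by move: eqY eqy' => /=; rewrite hE => /scheme_equation0-> /scheme_equation0.
have hp : 0 < h by rewrite lt_neqAle eq_sym hn.
have [z [_ uz]] := uniq hp.
by rewrite -(uz _ eqY) -(uz _ eqy').
Qed.

Lemma slice_open h : open (slice time_dom h).
Proof.
have := open_preimage_on openT time_dom_open (f := fun x : Rn => (h, x)).
set B := [set x | _]; have -> : B = slice time_dom h.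
  by apply/seteqP; split => x; [case|split].
apply=> x _; have sp := smooth_pair openT (@smooth_cst R Rn R setT h) (@smooth_id R Rn setT).
exact: (smooth_continuous sp I).
Qed.

Lemma smooth_slice h (Z : normedModType R) (D : set (R * Rn)) (f : R * Rn -> Z) (A : set Rn) :
  open A -> (forall x, A x -> D (h, x)) -> smooth_on D f ->
  smooth_on A (fun x => f (h, x)).
Proof.
move=> oA AD sf.
have sp := smooth_pair oA (@smooth_cst R Rn R A h) (@smooth_id R Rn A).
exact: (smooth_comp (B := D) (@frame_time_space R n) oA AD sp sf).
Qed.

Lemma phi_diffeo h : 0 <= h -> diffeo_onto_image (slice time_dom h) (phi h).
Proof.
move=> h0; have oA := @slice_open h.
have sPhi := smooth_fwd oU breal sH genS.
have sPsi := smooth_bwd oU breal sH genS.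
have oBD := bwd_dom_open oU breal sH genS.
have sPA : smooth_on (slice time_dom h) (phi h).
  have := smooth_slice oA (fun x Ax => time_dom_source Ax) sPhi.
  by apply: eq_smooth => // x Ax; rewrite phi_fwd.
pose T := [set z | bwd_dom k U W alpha beta S (h, z)].
have oT : open T.
  have := open_preimage_on openT oBD (f := fun x : Rn => (h, x)).
  set B := [set x | _]; have -> : B = T by apply/seteqP; split => x; [case|split].
  apply=> x _; have sp := smooth_pair openT (@smooth_cst R Rn R setT h) (@smooth_id R Rn setT).
  exact: (smooth_continuous sp I).
have sPT : smooth_on T (fun z => Psi (h, z)).
  by apply: (smooth_slice oT _ sPsi) => z [].
have imE : phi h @` slice time_dom h = [set z | T z /\ slice time_dom h (Psi (h, z))].
  apply/seteqP; split => [_ [x Ax <-]|z [Tz Az]] /=.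
    rewrite phi_fwd //; have [Bx _ E] := fwdK (time_dom_fwd Ax).
    by split; [exact: Bx|rewrite E].
  exists (Psi (h, z)) => //; rewrite phi_fwd //.
  by have [_ _ ] := bwdK Tz.
have oI : open (phi h @` slice time_dom h).
  rewrite imE; apply: (open_preimage_on oT oA) => z Tz.
  exact: (smooth_continuous sPT Tz).
split=> //; exists (fun z => Psi (h, z)); split.
  by apply: smooth_sub sPT => z; rewrite imE => -[].
by move=> x Ax; rewrite phi_fwd //; have [_ _ ] := fwdK (time_dom_fwd Ax).
Qed.

Lemma phi_order x c : U x -> solution_from U (hamiltonian_field pi H) x c ->
  (fun h : R => phi h x - c h) =o_ (0^'+) (fun h : R => h ^+ k).
Proof.
move=> Ux sol; apply/eqoP => e e0.
have [C HC] := fwd_order oU poisson_pi breal sH genS Ux sol.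
have hD : \forall t \near (0 : R)^'+, time_dom (t, x).
  apply: near_time_right; apply: open_nbhs_nbhs.
  by split; [exact: time_dom_open|exact: time_dom0].
(* Up to this time, the factor [C * t] of the bound is less than [e]. *)
have C1 : 0 < e / (`|C| + 1) by rewrite divr_gt0 // ltr_wpDl.
have h2 : \forall t \near (0 : R)^'+, 0 < t /\ t < e / (`|C| + 1).
  have a1 := nbhs_right_gt (0 : R); have a2 := nbhs_right_lt C1.
  by move: a1 a2; apply: filterS2 => t a b; split.
move: HC hD h2; apply: filterS3 => t Ht Dt [t0 te].
rewrite phi_fwd //; last exact: ltW.
apply: le_trans Ht _; rewrite normrX (gtr0_norm t0) exprS mulrA.
rewrite ler_wpM2r //; first by rewrite exprn_ge0 // ltW.
move: te; rewrite ltr_pdivlMr ?ltr_wpDl // => te.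
have := ler_wpM2r (ltW t0) (ler_norm C); move: te; rewrite mulrDr mulr1 mulrC.
move: (`|C| * t) (C * t) => u v; lra.
Qed.

Lemma grad_fwd_comp h x (F : Rn -> R) : source_dom k U W alpha S (h, x) ->
  differentiable F (Phi (h, x)) ->
  grad (fun y => F (Phi (h, y))) x = (space_jac Phi (h, x))^T *m grad F (Phi (h, x)).
Proof.
move=> Dq dF; have dP := smooth_diff (smooth_fwd oU breal sH genS) Dq.
rewrite -(grad_spaceE (F \o Phi)); apply/colP => j; rewrite [LHS]mxE.
rewrite (derive_comp _ dP dF) (derive_grad _ dF) (space_jacE _ dP).
move: (grad F _) (space_jac _ _) => g J.
rewrite mulmxA /basis_vec -colE mxE -[g^T *m J]trmxK trmx_mul trmxK.
by rewrite mxE.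
Qed.

Lemma phi_poisson h : 0 <= h -> poisson_map pi (slice time_dom h) (phi h).
Proof.
move=> h0 F G sF sG x Ax.
have Dq := time_dom_source Ax.
have img : (phi h @` slice time_dom h) (Phi (h, x)).
  by exists x => //; rewrite phi_fwd.
have E (F' : Rn -> R) : smooth_on (phi h @` slice time_dom h) F' ->
    grad (F' \o phi h) x = (space_jac Phi (h, x))^T *m grad F' (Phi (h, x)).
  move=> sF'; rewrite -(grad_fwd_comp Dq (smooth_diff sF' img)).
  apply: near_eq_grad; apply: near_open (@slice_open h) Ax _ => y Ay /=.
  by rewrite phi_fwd.
rewrite /pbracket (E F sF) (E G sG) phi_fwd //.
have := fwd_poisson oU breal sH genS Dq => <-.
move: (grad F _) (grad G _) (space_jac _ _) (pi _) => f g J P.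
by rewrite trmx_mul trmxK !mulmxA.
Qed.

Lemma phi_integrator : integrator k U (hamiltonian_field pi H) phi time_dom.
Proof.
split.
- exact: time_dom_open.
- exact: time_dom0.
- by move=> h x Dq; exact: (source_dom_sub breal (time_dom_source Dq)).
- exact: time_dom_star.
- exists Phi; split; last exact: phi_fwd.
  by apply: smooth_sub (smooth_fwd oU breal sH genS) => q; exact: time_dom_source.
- move=> h x Dq h0; rewrite phi_fwd //.
  exact: (fwd_sub breal (time_dom_source Dq)).
- exact: phi_diffeo.
- exact: phi_order.
Qed.

Lemma phi_generated : generated_by k U pi H phi time_dom (fun t z => Hb (t, z)).
Proof.
exists (bwd_dom k U W alpha beta S); split.
- split; first exact: (bwd_dom_open oU breal sH genS).
  by move=> t z [Dz _]; exact: (target_dom_sub breal Dz).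
- move=> t x Dq t0; rewrite phi_fwd //.
  by have [] := fwdK (time_dom_fwd Dq).
- have oE := bwd_dom_open oU breal sH genS.
  have sE : smooth_on (bwd_dom k U W alpha beta S) Hb.
    by apply: smooth_sub (smooth_fwd_ham oU breal sH genS) => q [].
  by apply: eq_smooth sE => // -[t z].
- move=> x Ux; apply/eqO_exP.
  have [C HC] := target_defect_vanishes oU poisson_pi breal sH genS Ux.
  exists (`|C| + 1); first by rewrite ltr_wpDl //.
  have h0 := nbhs_right_gt (0 : R).
  move: h0 HC; apply: filterS2 => t t0 /le_trans; apply.
  rewrite normrX (gtr0_norm t0) ler_wpM2r ?exprn_ge0 ?(ltW t0) //.
  by rewrite (le_trans (ler_norm C)) // lerDl.
- move=> x Ux; split.
    by rewrite phi_fwd ?lexx //; [exact: (fwd0 oU breal sH genS Ux)|exact: time_dom0].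
  move=> t t0 Dq; have Sq := time_dom_source Dq.
  have dP := smooth_diff (smooth_fwd oU breal sH genS) Sq.
  have near_phi : \forall s \near t, Phi (s, x) = phi s x.
    have h1 : \forall s \near t, time_dom (s, x).
      apply: (near_preimage (@continuous_time_line R Rn x t)).
      by apply: open_nbhs_nbhs; split => //; exact: time_dom_open.
    have h2 : \forall s \near t, 0 < s by exact: lt_nbhsr.
    by move: h1 h2; apply: filterS2 => s Ds s0; rewrite phi_fwd // ltW.
  apply: (near_eq_is_derive near_phi).
  have := is_derive_time dP; rewrite (fwd_time oU breal sH genS (time_dom_fwd Dq)).
  by rewrite grad_spaceE /= /hamiltonian_field phi_fwd // ltW.
Qed.

End Integrator.

Theorem theorem4p7 (R : realType) (n k : nat) (U : set 'cV[R]_n)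
    (pi : 'cV[R]_n -> 'M[R]_n) (W : set ('cV[R]_n * 'cV[R]_n))
    (alpha beta : 'cV[R]_n * 'cV[R]_n -> 'cV[R]_n) (H : 'cV[R]_n -> R)
    (S : nat -> 'cV[R]_n -> R) (phi : R -> 'cV[R]_n -> 'cV[R]_n)
    (openU : open U) (poisson_pi : poisson_structure U pi)
    (breal : bi_realisation U pi W alpha beta)
    (smoothH : smooth_on U H) (k_ge1 : (1 <= k)%N)
    (genS : generating_sequence k U alpha H S)
    (solvable : scheme_solvable k U W alpha S)
    (scheme_phi : scheme_map k U W alpha beta S phi) :
  poisson_hamiltonian_integrator k U pi H phi.
Proof.
exists (time_dom k U W alpha beta S); split.
  split; first exact: phi_integrator.
  by move=> h h0; exact: (phi_poisson openU breal smoothH genS scheme_phi h0).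
by exists (fun t z => fwd_ham k U W beta S (t, z)); exact: phi_generated.
Qed.
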